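(* Let $\mathbb{A}$ and $\mathbb{B}$ be double categories such that $\mathbb{A}$ is weakly horizontally invariant. Then a double functor $F\colon\mathbb{A}\to\mathbb{B}$ is a double biequivalence if and only if there is a pseudo double functor $G\colon\mathbb{B}\to\mathbb{A}$ together with horizontal pseudo natural equivalences $\mathrm{id}_{\mathbb{A}}\simeq GF$ and $FG\simeq\mathrm{id}_{\mathbb{B}}$.
   Context: A (strict) double category $\mathbb{A}$ has objects, horizontal morphisms $a\colon A\to C$, vertical morphisms $u\colon A\nrightarrow A'$, and squares; a square with left boundary $u\colon A\nrightarrow A'$, right boundary $w\colon C\nrightarrow C'$, top boundary $a\colon A\to C$ and bottom boundary $a'\colon A'\to C'$ is written $\alpha\colon(u\ {}^{a}_{a'}\ w)$. Horizontal and vertical compositions are strictly associative and unital and satisfy interchange. Horizontal identities are $\mathrm{id}_A,\mathrm{id}_u$, vertical identities $e_A,e_a$. Write $\alpha\mid\beta$ for the horizontal composite ($\alpha$ left of $\beta$) and $\alpha/\beta$ for the vertical composite ($\alpha$ on top of $\beta$). Double functors are strict. A square is vertically (horizontally) invertible if it is invertible for vertical (horizontal) composition. The underlying horizontal $2$-category $\mathbf{H}\mathbb{A}$ has the objects and horizontal morphisms of $\mathbb{A}$, and $2$-morphisms $a\Rightarrow a'$ the squares $(e_A\ {}^{a}_{a'}\ e_C)$. A horizontal equivalence is an equivalence in $\mathbf{H}\mathbb{A}$. A square $\alpha\colon(u\ {}^{a}_{a'}\ w)$, $u\colon A\nrightarrow A'$, $w\colon C\nrightarrow C'$, is weakly horizontally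 invertible if there are a square $\gamma\colon(w\ {}^{c}_{c'}\ u)$ and vertically invertible squares $\eta\colon(e_A\ {}^{\mathrm{id}_A}_{ca}\ e_A)$, $\eta'\colon(e_{A'}\ {}^{\mathrm{id}_{A'}}_{c'a'}\ e_{A'})$, $\epsilon\colon(e_C\ {}^{ac}_{\mathrm{id}_C}\ e_C)$, $\epsilon'\colon(e_{C'}\ {}^{a'c'}_{\mathrm{id}_{C'}}\ e_{C'})$ such that $\eta/(\alpha\mid\gamma)=\mathrm{id}_u/\eta'$ and $\epsilon/\mathrm{id}_w=(\gamma\mid\alpha)/\epsilon'$. $\mathbb{A}$ is weakly horizontally invariant if for all horizontal equivalences $a\colon A\to C$, $a'\colon A'\to C'$ and every vertical $w\colon C\nrightarrow C'$ there are a vertical $u\colon A\nrightarrow A'$ and a weakly horizontally invertible square $(u\ {}^{a}_{a'}\ w)$. Double biequivalence: a double functor $F\colon\mathbb{A}\to\mathbb{B}$ such that (db1) for every object $B\in\mathbb{B}$ there are $A\in\mathbb{A}$ and a horizontal equivalence $B\to FA$; (db2) for all $A,C\in\mathbb{A}$ and every horizontal $b\colon FA\to FC$ there are $a\colon A\to C$ and a vertically invertible square $(e_{FA}\ {}^{b}_{Fa}\ e_{FC})$; (db3) for every vertical $v\colon B\nrightarrow B'$ in $\mathbb{B}$ there are a vertical $u\colon A\nrightarrow A'$ in $\mathbb{A}$ and a weakly horizontally invertible square with left boundary $v$ and right boundary $Fu$; (db4) every square $(Fu\ {}^{Fa}_{Fa'}\ Fw)$ is $F\alpha$ for a unique square $\alpha\colon(u\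 {}^{a}_{a'}\ w)$. Pseudo double functor $G\colon\mathbb{B}\to\mathbb{A}$: maps on objects, horizontal morphisms, vertical morphisms and squares, compatible with sources and targets (boundaries), with vertically invertible squares $\Phi_{b,d}\colon(e_{GB}\ {}^{(Gd)(Gb)}_{G(db)}\ e_{GD})$ and $\Phi_B\colon(e_{GB}\ {}^{\mathrm{id}_{GB}}_{G\mathrm{id}_B}\ e_{GB})$ for horizontal $b\colon B\to C$, $d\colon C\to D$ and objects $B$, and, transposed, horizontally invertible squares $\Psi_{v,v'}$ with trivial horizontal boundaries, left boundary the vertical composite of $Gv$ then $Gv'$ and right boundary $G(v'v)$, and $\Psi_B$ with left boundary $e_{GB}$ and right boundary $Ge_B$. These satisfy the standard coherences: compatibility with composition of squares, $(G\alpha\mid G\beta)/\Phi=\Phi/G(\alpha\mid\beta)$ and $\mathrm{id}_{Gv}/\Phi_{B'}=\Phi_B/G\mathrm{id}_v$ (for $v\colon B\nrightarrow B'$); associativity $(\Phi_{b,d}\mid e_{Gf})/\Phi_{db,f}=(e_{Gb}\mid\Phi_{d,f})/\Phi_{b,fd}$ and unitality $(\Phi_B\mid e_{Gb})/\Phi_{\mathrm{id}_B,b}=e_{Gb}=(e_{Gb}\mid\Phi_C)/\Phi_{b,\mathrm{id}_C}$; and the transposed conditions for $\Psi$. Horizontal pseudo natural transformation $\varphi\colon F\Rightarrow G$ of pseudo double functors $\mathbb{A}\to\mathbb{B}$: horizontal morphisms $\varphi_A\colon FA\to GA$ for objects $A$; vertically invertible squares $\varphi_a\colon(e_{FA}\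 {}^{(Ga)\varphi_A}_{\varphi_C(Fa)}\ e_{GC})$ for horizontal $a\colon A\to C$; squares $\varphi_u\colon(Fu\ {}^{\varphi_A}_{\varphi_{A'}}\ Gu)$ for vertical $u\colon A\nrightarrow A'$; such that $(\varphi_u\mid G\alpha)/\varphi_{a'}=\varphi_a/(F\alpha\mid\varphi_w)$ for each square $\alpha\colon(u\ {}^{a}_{a'}\ w)$; $(e_{\varphi_A}\mid\Phi^G_{a,c})/\varphi_{ca}=(\varphi_a\mid e_{Gc})/(e_{Fa}\mid\varphi_c)/(\Phi^F_{a,c}\mid e_{\varphi_E})$ for $a\colon A\to C$, $c\colon C\to E$, and $(e_{\varphi_A}\mid\Phi^G_A)/\varphi_{\mathrm{id}_A}=\Phi^F_A\mid e_{\varphi_A}$; $\Psi^F_{u,u'}\mid\varphi_{u'u}=(\varphi_u/\varphi_{u'})\mid\Psi^G_{u,u'}$ and $\Psi^F_A\mid\varphi_{e_A}=e_{\varphi_A}\mid\Psi^G_A$. A modification (with trivial vertical boundaries) $\theta\colon\varphi\Rightarrow\psi$ between such transformations $F\Rightarrow G$: squares $\theta_A\colon(e_{FA}\ {}^{\varphi_A}_{\psi_A}\ e_{GA})$ with $(\theta_A\mid e_{Ga})/\psi_a=\varphi_a/(e_{Fa}\mid\theta_C)$ for horizontal $a\colon A\to C$ and $\theta_A/\psi_u=\varphi_u/\theta_{A'}$ for vertical $u\colon A\nrightarrow A'$. A horizontal pseudo natural equivalence is an equivalence in the $2$-category of pseudo double functors $\mathbb{A}\to\mathbb{B}$, horizontal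 pseudo natural transformations, and such modifications. *)

(* Defs.v *)
From Stdlib Require Import Eqdep Program.Equality ProofIrrelevance.

Set Implicit Arguments.
Unset Strict Implicit.

Declare Scope double_scope.
Delimit Scope double_scope with dbl.
Local Open Scope double_scope.

Reserved Notation "a ⨾ c" (at level 38, left associativity).
Reserved Notation "u • v" (at level 38, left associativity).
Reserved Notation "s ∣ t" (at level 40, left associativity).
Reserved Notation "s ≈ t" (at level 70, no associativity).

(** All composites are written in diagrammatic order: [a ⨾ c] is the horizontal
    morphism usually written [ca], and [u • v] is the vertical one usually
    written [vu].  [sq u a a' w] is the type of squares with left boundary [u],
    top [a], bottom [a'] and right boundary [w]. *)

Record doubleData := {
  ob : Type;
  hor : ob -> ob -> Type;
  ver : ob -> ob -> Type;
  sq : forall A C A' C' : ob,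
    ver A A' -> hor A C -> hor A' C' -> ver C C' -> Type;
  hid : forall A, hor A A;
  hcomp : forall A C E, hor A C -> hor C E -> hor A E;
  vid : forall A, ver A A;
  vcomp : forall A A' A'', ver A A' -> ver A' A'' -> ver A A'';
  sqhid : forall A A' (u : ver A A'), sq u (hid A) (hid A') u;
  sqvid : forall A C (a : hor A C), sq (vid A) a a (vid C);
  sqhcomp : forall A C E A' C' E' (u : ver A A') (v : ver C C') (w : ver E E')
    (a : hor A C) (a' : hor A' C') (c : hor C E) (c' : hor C' E'),
    sq u a a' v -> sq v c c' w -> sq u (hcomp a c) (hcomp a' c') w;
  sqvcomp : forall A C A' C' A'' C''
    (a : hor A C) (a' : hor A' C') (a'' : hor A'' C'')
    (u : ver A A') (w : ver C C') (u' : ver A' A'') (w' : ver C' C''),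
    sq u a a' w -> sq u' a' a'' w' -> sq (vcomp u u') a a'' (vcomp w w')
}.

Arguments sq {d A C A' C'} u a a' w.
Arguments hid {d} A.
Arguments vid {d} A.

Notation "a ⨾ c" := (hcomp a c) : double_scope.
Notation "u • v" := (vcomp u v) : double_scope.
Notation "s ∣ t" := (sqhcomp s t) : double_scope.
Notation "s / t" := (sqvcomp s t) : double_scope.

(** Equality of squares whose boundaries are equal, but possibly not
    convertible: the boundaries agree and, along these equalities, so do the
    squares. *)
Inductive sqeq {D : doubleData} {A C A' C' : ob D}
    {u : ver A A'} {a : hor A C} {a' : hor A' C'} {w : ver C C'}
    (s : sq u a a' w) :
    forall (v : ver A A') (b : hor A C) (b' : hor A' C') (x : ver C C'),
      sq v b b' x -> Prop :=
  sqeq_refl : sqeq s s.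

Arguments sqeq_refl {D A C A' C' u a a' w} s.

Notation "s ≈ t" := (sqeq s t) : double_scope.

Record isDouble (D : doubleData) : Prop := {
  hcompA : forall (A B C E : ob D) (a : hor A B) (b : hor B C) (c : hor C E),
    (a ⨾ b) ⨾ c = a ⨾ (b ⨾ c);
  hid_l : forall (A C : ob D) (a : hor A C), hid A ⨾ a = a;
  hid_r : forall (A C : ob D) (a : hor A C), a ⨾ hid C = a;
  vcompA : forall (A B C E : ob D) (u : ver A B) (v : ver B C) (w : ver C E),
    (u • v) • w = u • (v • w);
  vid_l : forall (A A' : ob D) (u : ver A A'), vid A • u = u;
  vid_r : forall (A A' : ob D) (u : ver A A'), u • vid A' = u;
  sqhcompA : forall (A B C E A' B' C' E' : ob D)
    (u : ver A A') (v : ver B B') (w : ver C C') (x : ver E E')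
    (a : hor A B) (b : hor B C) (c : hor C E)
    (a' : hor A' B') (b' : hor B' C') (c' : hor C' E')
    (r : sq u a a' v) (s : sq v b b' w) (t : sq w c c' x),
    (r ∣ s) ∣ t ≈ r ∣ (s ∣ t);
  sqhid_l : forall (A C A' C' : ob D) (u : ver A A') (w : ver C C')
    (a : hor A C) (a' : hor A' C') (s : sq u a a' w), sqhid u ∣ s ≈ s;
  sqhid_r : forall (A C A' C' : ob D) (u : ver A A') (w : ver C C')
    (a : hor A C) (a' : hor A' C') (s : sq u a a' w), s ∣ sqhid w ≈ s;
  sqvcompA : forall (A C A' C' A'' C'' A''' C''' : ob D)
    (a : hor A C) (b : hor A' C') (c : hor A'' C'') (d : hor A''' C''')
    (u : ver A A') (u' : ver A' A'') (u'' : ver A'' A''')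
    (w : ver C C') (w' : ver C' C'') (w'' : ver C'' C''')
    (r : sq u a b w) (s : sq u' b c w') (t : sq u'' c d w''),
    (r / s) / t ≈ r / (s / t);
  sqvid_l : forall (A C A' C' : ob D) (u : ver A A') (w : ver C C')
    (a : hor A C) (a' : hor A' C') (s : sq u a a' w), sqvid a / s ≈ s;
  sqvid_r : forall (A C A' C' : ob D) (u : ver A A') (w : ver C C')
    (a : hor A C) (a' : hor A' C') (s : sq u a a' w), s / sqvid a' ≈ s;
  interchange : forall (A C E A' C' E' A'' C'' E'' : ob D)
    (a : hor A C) (c : hor C E) (a' : hor A' C') (c' : hor C' E')
    (a'' : hor A'' C'') (c'' : hor C'' E'')
    (u : ver A A') (v : ver C C') (w : ver E E')
    (u' : ver A' A'') (v' : ver C' C'') (w' : ver E' E'')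
    (p : sq u a a' v) (q : sq v c c' w)
    (r : sq u' a' a'' v') (s : sq v' c' c'' w'),
    (p ∣ q) / (r ∣ s) = (p / r) ∣ (q / s);
  sqhid_comp : forall (A A' A'' : ob D) (u : ver A A') (v : ver A' A''),
    sqhid u / sqhid v = sqhid (u • v);
  sqvid_comp : forall (A C E : ob D) (a : hor A C) (c : hor C E),
    sqvid a ∣ sqvid c = sqvid (a ⨾ c);
  sqhid_vid : forall A : ob D, sqhid (vid A) = sqvid (hid A)
}.

Record doubleCat := {
  dc_data :> doubleData;
  dc_laws : isDouble dc_data
}.

Definition sqcast {D : doubleData} {A C A' C' : ob D}
    {u v : ver A A'} {a b : hor A C} {a' b' : hor A' C'} {w x : ver C C'}
    (eu : u = v) (ea : a = b) (ea' : a' = b') (ew : w = x)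
    (s : sq u a a' w) : sq v b b' x :=
  match eu in _ = v0, ea in _ = b0, ea' in _ = b0', ew in _ = x0
    return sq v0 b0 b0' x0 with
  | eq_refl, eq_refl, eq_refl, eq_refl => s
  end.

(** Vertical composite of squares whose common boundary agrees only up to a
    provable equality (typically an associativity law). *)
Definition sqvcompE {D : doubleData} {A C A' C' A'' C'' : ob D}
    {a : hor A C} {b b' : hor A' C'} {c : hor A'' C''}
    {u : ver A A'} {w : ver C C'} {u' : ver A' A''} {w' : ver C' C''}
    (s : sq u a b w) (e : b = b') (t : sq u' b' c w') :
    sq (u • u') a c (w • w') :=
  s / sqcast eq_refl (eq_sym e) eq_refl eq_refl t.

Notation "s /[ e ] t" := (sqvcompE s e t)
  (at level 40, left associativity, format "s  /[ e ]  t") : double_scope.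

Definition vinvertible {D : doubleData} {A C A' C' : ob D}
    {u : ver A A'} {a : hor A C} {a' : hor A' C'} {w : ver C C'}
    (s : sq u a a' w) : Prop :=
  exists (u' : ver A' A) (w' : ver C' C) (t : sq u' a' a w'),
    s / t ≈ sqvid a /\ t / s ≈ sqvid a'.

Definition hinvertible {D : doubleData} {A C A' C' : ob D}
    {u : ver A A'} {a : hor A C} {a' : hor A' C'} {w : ver C C'}
    (s : sq u a a' w) : Prop :=
  exists (c : hor C A) (c' : hor C' A') (t : sq w c c' u),
    s ∣ t ≈ sqhid u /\ t ∣ s ≈ sqhid w.

Definition horizontal_equivalence {D : doubleData} {A C : ob D}
    (a : hor A C) : Prop :=
  exists (c : hor C A)
    (eta : sq (vid A) (hid A) (a ⨾ c) (vid A))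
    (eps : sq (vid C) (c ⨾ a) (hid C) (vid C)),
    vinvertible eta /\ vinvertible eps.

Definition weakly_hinvertible {D : doubleData} {A C A' C' : ob D}
    {u : ver A A'} {a : hor A C} {a' : hor A' C'} {w : ver C C'}
    (s : sq u a a' w) : Prop :=
  exists (c : hor C A) (c' : hor C' A') (t : sq w c c' u)
    (eta : sq (vid A) (hid A) (a ⨾ c) (vid A))
    (eta' : sq (vid A') (hid A') (a' ⨾ c') (vid A'))
    (eps : sq (vid C) (c ⨾ a) (hid C) (vid C))
    (eps' : sq (vid C') (c' ⨾ a') (hid C') (vid C')),
    vinvertible eta /\ vinvertible eta' /\
    vinvertible eps /\ vinvertible eps' /\
    eta / (s ∣ t) ≈ sqhid u / eta' /\
    eps / sqhid w ≈ (t ∣ s) / eps'.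

Definition weakly_horizontally_invariant (D : doubleCat) : Prop :=
  forall (A C A' C' : ob D) (a : hor A C) (a' : hor A' C') (w : ver C C'),
    horizontal_equivalence a -> horizontal_equivalence a' ->
    exists (u : ver A A') (s : sq u a a' w), weakly_hinvertible s.

Record doubleFunctor (D E : doubleCat) := {
  fob :> ob D -> ob E;
  fhor : forall A C, hor A C -> hor (fob A) (fob C);
  fver : forall A A', ver A A' -> ver (fob A) (fob A');
  fsq : forall A C A' C' (u : ver A A') (a : hor A C) (a' : hor A' C')
    (w : ver C C'),
    sq u a a' w -> sq (fver u) (fhor a) (fhor a') (fver w);
  fhor_id : forall A, fhor (hid A) = hid (fob A);
  fhor_comp : forall A B C (a : hor A B) (c : hor B C),
    fhor (a ⨾ c) = fhor a ⨾ fhor c;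
  fver_id : forall A, fver (vid A) = vid (fob A);
  fver_comp : forall A B C (u : ver A B) (v : ver B C),
    fver (u • v) = fver u • fver v;
  fsq_hid : forall A A' (u : ver A A'), fsq (sqhid u) ≈ sqhid (fver u);
  fsq_hcomp : forall A B C A' B' C' (u : ver A A') (v : ver B B')
    (w : ver C C') (a : hor A B) (a' : hor A' B') (c : hor B C)
    (c' : hor B' C') (s : sq u a a' v) (t : sq v c c' w),
    fsq (s ∣ t) ≈ fsq s ∣ fsq t;
  fsq_vid : forall A C (a : hor A C), fsq (sqvid a) ≈ sqvid (fhor a);
  fsq_vcomp : forall A C A' C' A'' C'' (a : hor A C) (a' : hor A' C')
    (a'' : hor A'' C'') (u : ver A A') (w : ver C C')
    (u' : ver A' A'') (w' : ver C' C'')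
    (s : sq u a a' w) (t : sq u' a' a'' w'),
    fsq (s / t) ≈ fsq s / fsq t
}.

Definition double_biequivalence {D E : doubleCat} (F : doubleFunctor D E) :
    Prop :=
  (forall B : ob E, exists (A : ob D) (b : hor B (F A)),
      horizontal_equivalence b) /\
  (forall (A C : ob D) (b : hor (F A) (F C)),
      exists (a : hor A C) (s : sq (vid (F A)) b (fhor F a) (vid (F C))),
        vinvertible s) /\
  (forall (B B' : ob E) (v : ver B B'),
      exists (A A' : ob D) (u : ver A A') (b : hor B (F A))
        (b' : hor B' (F A')) (s : sq v b b' (fver F u)),
        weakly_hinvertible s) /\
  (forall (A C A' C' : ob D) (u : ver A A') (a : hor A C) (a' : hor A' C')
      (w : ver C C') (t : sq (fver F u) (fhor F a) (fhor F a') (fver F w)),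
      exists! s : sq u a a' w, fsq F s = t).

(** [pPhi] and [pPhi0] compare composites and identities of horizontal
    morphisms, [pPsi] and [pPsi0] those of vertical morphisms; each condition on
    [pPsi] is the transpose of the condition on [pPhi] of the same name. *)

Record pseudoFunctor (D E : doubleCat) := {
  pob :> ob D -> ob E;
  phor : forall A C, hor A C -> hor (pob A) (pob C);
  pver : forall A A', ver A A' -> ver (pob A) (pob A');
  psq : forall A C A' C' (u : ver A A') (a : hor A C) (a' : hor A' C')
    (w : ver C C'),
    sq u a a' w -> sq (pver u) (phor a) (phor a') (pver w);
  pPhi : forall A B C (a : hor A B) (c : hor B C),
    sq (vid (pob A)) (phor a ⨾ phor c) (phor (a ⨾ c)) (vid (pob C));
  pPhi0 : forall A,
    sq (vid (pob A)) (hid (pob A)) (phor (hid A)) (vid (pob A));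
  pPsi : forall A B C (u : ver A B) (v : ver B C),
    sq (pver u • pver v) (hid (pob A)) (hid (pob C)) (pver (u • v));
  pPsi0 : forall A,
    sq (vid (pob A)) (hid (pob A)) (hid (pob A)) (pver (vid A));
  pPhi_inv : forall A B C (a : hor A B) (c : hor B C),
    vinvertible (pPhi a c);
  pPhi0_inv : forall A, vinvertible (pPhi0 A);
  pPsi_inv : forall A B C (u : ver A B) (v : ver B C),
    hinvertible (pPsi u v);
  pPsi0_inv : forall A, hinvertible (pPsi0 A);
  pPhi_nat : forall A B C A' B' C' (u : ver A A') (v : ver B B')
    (w : ver C C') (a : hor A B) (a' : hor A' B') (c : hor B C)
    (c' : hor B' C') (s : sq u a a' v) (t : sq v c c' w),
    (psq s ∣ psq t) / pPhi a' c' ≈ pPhi a c / psq (s ∣ t);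
  pPhi0_nat : forall A A' (u : ver A A'),
    sqhid (pver u) / pPhi0 A' ≈ pPhi0 A / psq (sqhid u);
  pPhi_assoc : forall A B C E (a : hor A B) (b : hor B C) (c : hor C E),
    (pPhi a b ∣ sqvid (phor c)) / pPhi (a ⨾ b) c
    ≈ (sqvid (phor a) ∣ pPhi b c) / pPhi a (b ⨾ c);
  pPhi_unit_l : forall A B (a : hor A B),
    (pPhi0 A ∣ sqvid (phor a)) / pPhi (hid A) a ≈ sqvid (phor a);
  pPhi_unit_r : forall A B (a : hor A B),
    (sqvid (phor a) ∣ pPhi0 B) / pPhi a (hid B) ≈ sqvid (phor a);
  pPsi_nat : forall A C A' C' A'' C'' (a : hor A C) (a' : hor A' C')
    (a'' : hor A'' C'') (u : ver A A') (w : ver C C')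
    (u' : ver A' A'') (w' : ver C' C'')
    (s : sq u a a' w) (t : sq u' a' a'' w'),
    (psq s / psq t) ∣ pPsi w w' ≈ pPsi u u' ∣ psq (s / t);
  pPsi0_nat : forall A C (a : hor A C),
    sqvid (phor a) ∣ pPsi0 C ≈ pPsi0 A ∣ psq (sqvid a);
  pPsi_assoc : forall A B C E (u : ver A B) (v : ver B C) (w : ver C E),
    (pPsi u v / sqhid (pver w)) ∣ pPsi (u • v) w
    ≈ (sqhid (pver u) / pPsi v w) ∣ pPsi u (v • w);
  pPsi_unit_l : forall A B (u : ver A B),
    (pPsi0 A / sqhid (pver u)) ∣ pPsi (vid A) u ≈ sqhid (pver u);
  pPsi_unit_r : forall A B (u : ver A B),
    (sqhid (pver u) / pPsi0 B) ∣ pPsi u (vid B) ≈ sqhid (pver u)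
}.

Arguments pPhi {D E} p {A B C} a c.
Arguments pPhi0 {D E} p A.
Arguments pPsi {D E} p {A B C} u v.
Arguments pPsi0 {D E} p A.

Section Calculus.
Context {D : doubleData}.

Lemma sqeq_sym {A C A' C' : ob D} {u : ver A A'} {a : hor A C}
    {a' : hor A' C'} {w : ver C C'} {v b b' x}
    (s : sq u a a' w) (t : sq v b b' x) : s ≈ t -> t ≈ s.
Proof. intros H; destruct H; constructor. Qed.

Lemma sqeq_trans {A C A' C' : ob D} {u : ver A A'} {a : hor A C}
    {a' : hor A' C'} {w : ver C C'} {v b b' x v1 b1 b1' x1}
    (s : sq u a a' w) (t : sq v b b' x) (r : sq v1 b1 b1' x1) :
  s ≈ t -> t ≈ r -> s ≈ r.
Proof. intros H K; destruct K; exact H. Qed.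

Lemma eq_sqeq {A C A' C' : ob D} {u : ver A A'} {a : hor A C}
    {a' : hor A' C'} {w : ver C C'} (s t : sq u a a' w) : s = t -> s ≈ t.
Proof. intros ->; constructor. Qed.

Lemma sqeq_eq {A C A' C' : ob D} {u : ver A A'} {a : hor A C}
    {a' : hor A' C'} {w : ver C C'} (s t : sq u a a' w) : s ≈ t -> s = t.
Proof. intros H; dependent destruction H; reflexivity. Qed.

Lemma sqeq_bdry {A C A' C' : ob D} {u : ver A A'} {a : hor A C}
    {a' : hor A' C'} {w : ver C C'} {v b b' x}
    (s : sq u a a' w) (t : sq v b b' x) :
  s ≈ t -> u = v /\ a = b /\ a' = b' /\ w = x.
Proof. intros H; destruct H; repeat split. Qed.

Lemma sqcast_sqeq {A C A' C' : ob D} {u v : ver A A'} {a b : hor A C}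
    {a' b' : hor A' C'} {w x : ver C C'}
    (eu : u = v) (ea : a = b) (ea' : a' = b') (ew : w = x) (s : sq u a a' w) :
  sqcast eu ea ea' ew s ≈ s.
Proof. destruct eu, ea, ea', ew; constructor. Qed.

Lemma sqhcomp_cong {A C E A' C' E' : ob D}
    {u : ver A A'} {v : ver C C'} {w : ver E E'}
    {a : hor A C} {a' : hor A' C'} {c : hor C E} {c' : hor C' E'}
    {u1 : ver A A'} {v1 : ver C C'} {w1 : ver E E'}
    {a1 : hor A C} {a1' : hor A' C'} {c1 : hor C E} {c1' : hor C' E'}
    (s : sq u a a' v) (t : sq v c c' w)
    (s1 : sq u1 a1 a1' v1) (t1 : sq v1 c1 c1' w1) :
  s ≈ s1 -> t ≈ t1 -> s ∣ t ≈ s1 ∣ t1.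
Proof. intros H K; destruct H; dependent destruction K; constructor. Qed.

Lemma sqvcomp_cong {A C A' C' A'' C'' : ob D}
    {a : hor A C} {a' : hor A' C'} {a'' : hor A'' C''}
    {u : ver A A'} {w : ver C C'} {u' : ver A' A''} {w' : ver C' C''}
    {a1 : hor A C} {a1' : hor A' C'} {a1'' : hor A'' C''}
    {u1 : ver A A'} {w1 : ver C C'} {u1' : ver A' A''} {w1' : ver C' C''}
    (s : sq u a a' w) (t : sq u' a' a'' w')
    (s1 : sq u1 a1 a1' w1) (t1 : sq u1' a1' a1'' w1') :
  s ≈ s1 -> t ≈ t1 -> s / t ≈ s1 / t1.
Proof. intros H K; destruct H; dependent destruction K; constructor. Qed.

Lemma sqvcompE_cong {A C A' C' A'' C'' : ob D}
    {a : hor A C} {b b' : hor A' C'} {a'' : hor A'' C''}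
    {u : ver A A'} {w : ver C C'} {u' : ver A' A''} {w' : ver C' C''}
    {a1 : hor A C} {b1 b1' : hor A' C'} {a1'' : hor A'' C''}
    {u1 : ver A A'} {w1 : ver C C'} {u1' : ver A' A''} {w1' : ver C' C''}
    (s : sq u a b w) (e : b = b') (t : sq u' b' a'' w')
    (s1 : sq u1 a1 b1 w1) (e1 : b1 = b1') (t1 : sq u1' b1' a1'' w1') :
  s ≈ s1 -> t ≈ t1 -> s /[e] t ≈ s1 /[e1] t1.
Proof. intros H K; destruct e, e1; exact (sqvcomp_cong H K). Qed.

Lemma sqvcompE_refl {A C A' C' A'' C'' : ob D}
    {a : hor A C} {b : hor A' C'} {c : hor A'' C''}
    {u : ver A A'} {w : ver C C'} {u' : ver A' A''} {w' : ver C' C''}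
    (s : sq u a b w) (t : sq u' b c w') (e : b = b) : s / t ≈ s /[e] t.
Proof. rewrite (UIP_refl _ _ e); constructor. Qed.

Lemma sqvid_cong {A C : ob D} (a b : hor A C) : a = b -> sqvid a ≈ sqvid b.
Proof. intros ->; constructor. Qed.

Lemma sqhid_cong {A C : ob D} (a b : ver A C) : a = b -> sqhid a ≈ sqhid b.
Proof. intros ->; constructor. Qed.

Hypothesis L : isDouble D.

Lemma interchangeE {A C E A' C' E' A'' C'' E'' : ob D}
    {a : hor A C} {c : hor C E} {a' b' : hor A' C'} {c' d' : hor C' E'}
    {a'' : hor A'' C''} {c'' : hor C'' E''}
    {u : ver A A'} {v : ver C C'} {w : ver E E'}
    {u' : ver A' A''} {v' : ver C' C''} {w' : ver E' E''}
    (p : sq u a a' v) (q : sq v c c' w)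
    (r : sq u' b' a'' v') (s : sq v' d' c'' w')
    (e : a' = b') (f : c' = d') (g : a' ⨾ c' = b' ⨾ d') :
  (p ∣ q) /[g] (r ∣ s) ≈ (p /[e] r) ∣ (q /[f] s).
Proof.
destruct e, f; rewrite (UIP_refl _ _ g).
apply eq_sqeq, (interchange L).
Qed.

Lemma sqvcompE_assoc {A C A' C' A'' C'' B B' : ob D}
    {a : hor A C} {b b1 : hor A' C'} {c c1 : hor A'' C''} {d : hor B B'}
    {u : ver A A'} {u' : ver A' A''} {u'' : ver A'' B}
    {w : ver C C'} {w' : ver C' C''} {w'' : ver C'' B'}
    (r : sq u a b w) (s : sq u' b1 c w') (t : sq u'' c1 d w'')
    (e e' : b = b1) (f f' : c = c1) :
  (r /[e] s) /[f] t ≈ r /[e'] (s /[f'] t).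
Proof.
rewrite (proof_irrelevance _ e' e), (proof_irrelevance _ f' f).
destruct e, f; apply (sqvcompA L).
Qed.

Lemma sqvidE_l {A C A' C' : ob D} {u : ver A A'} {w : ver C C'}
    {b a : hor A C} {a' : hor A' C'} (e : b = a) (s : sq u a a' w) :
  sqvid b /[e] s ≈ s.
Proof. destruct e; apply (sqvid_l L). Qed.

Lemma sqvidE_r {A C A' C' : ob D} {u : ver A A'} {w : ver C C'}
    {a : hor A C} {a' b : hor A' C'} (e : a' = b) (s : sq u a a' w) :
  s /[e] sqvid b ≈ s.
Proof. destruct e; apply (sqvid_r L). Qed.

Lemma vinvertible_sqeq {A C A' C' : ob D} {u v : ver A A'} {a b : hor A C}
    {a' b' : hor A' C'} {w x : ver C C'} (s : sq u a a' w) (t : sq v b b' x) :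
  s ≈ t -> vinvertible s -> vinvertible t.
Proof. intros H; destruct H; exact (fun h => h). Qed.

Lemma hinvertible_sqeq {A C A' C' : ob D} {u v : ver A A'} {a b : hor A C}
    {a' b' : hor A' C'} {w x : ver C C'} (s : sq u a a' w) (t : sq v b b' x) :
  s ≈ t -> hinvertible s -> hinvertible t.
Proof. intros H; destruct H; exact (fun h => h). Qed.

Lemma vinvertible_sqvid {A C : ob D} (a : hor A C) : vinvertible (sqvid a).
Proof. exists (vid A), (vid C), (sqvid a); split; apply (sqvid_l L). Qed.

Lemma hinvertible_sqhid {A C : ob D} (u : ver A C) : hinvertible (sqhid u).
Proof. exists (hid A), (hid C), (sqhid u); split; apply (sqhid_l L). Qed.

Lemma vinvertible_vcompE {A C A' C' A'' C'' : ob D}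
    {a : hor A C} {b b' : hor A' C'} {c : hor A'' C''}
    {u : ver A A'} {w : ver C C'} {u' : ver A' A''} {w' : ver C' C''}
    (s : sq u a b w) (e : b = b') (t : sq u' b' c w') :
  vinvertible s -> vinvertible t -> vinvertible (s /[e] t).
Proof.
destruct e; intros (v & x & s' & H1 & H2) (v' & x' & t' & K1 & K2).
exists (v' • v), (x' • x), (t' / s'); split.
- eapply sqeq_trans; [apply (sqvcompA L)|].
  eapply sqeq_trans; [|exact H1].
  eapply sqvcomp_cong; [apply sqeq_refl|].
  eapply sqeq_trans; [apply sqeq_sym, (sqvcompA L)|].
  eapply sqeq_trans; [eapply sqvcomp_cong; [exact K1|apply sqeq_refl]|].
  apply (sqvid_l L).
- eapply sqeq_trans; [apply (sqvcompA L)|].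
  eapply sqeq_trans; [|exact K2].
  eapply sqvcomp_cong; [apply sqeq_refl|].
  eapply sqeq_trans; [apply sqeq_sym, (sqvcompA L)|].
  eapply sqeq_trans; [eapply sqvcomp_cong; [exact H2|apply sqeq_refl]|].
  apply (sqvid_l L).
Qed.

Lemma vinvertible_hcomp {A C E A' C' E' : ob D}
    {u : ver A A'} {v : ver C C'} {w : ver E E'}
    {a : hor A C} {a' : hor A' C'} {c : hor C E} {c' : hor C' E'}
    (s : sq u a a' v) (t : sq v c c' w) :
  vinvertible s -> vinvertible t -> vinvertible (s ∣ t).
Proof.
intros (u1 & v1 & s' & H1 & H2) (v2 & w1 & t' & K1 & K2).
assert (ev : v1 = v2).
{ destruct (sqeq_bdry H1) as (_ & _ & _ & h1).
  destruct (sqeq_bdry K2) as (k2 & _).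
  rewrite <- (vid_l L v1), <- k2, (vcompA L), h1; apply (vid_r L). }
destruct ev; exists u1, w1, (s' ∣ t'); split.
- rewrite (interchange L).
  eapply sqeq_trans; [exact (sqhcomp_cong H1 K1)|].
  apply eq_sqeq, (sqvid_comp L).
- rewrite (interchange L).
  eapply sqeq_trans; [exact (sqhcomp_cong H2 K2)|].
  apply eq_sqeq, (sqvid_comp L).
Qed.

End Calculus.

Section FunctorCalculus.
Context {D E : doubleCat}.

Lemma fsq_cong (F : doubleFunctor D E) {A C A' C' : ob D}
    {u : ver A A'} {a : hor A C} {a' : hor A' C'} {w : ver C C'} {v b b' x}
    (s : sq u a a' w) (t : sq v b b' x) : s ≈ t -> fsq F s ≈ fsq F t.
Proof. intros H; destruct H; constructor. Qed.

Lemma psq_cong (F : pseudoFunctor D E) {A C A' C' : ob D}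
    {u : ver A A'} {a : hor A C} {a' : hor A' C'} {w : ver C C'} {v b b' x}
    (s : sq u a a' w) (t : sq v b b' x) : s ≈ t -> psq F s ≈ psq F t.
Proof. intros H; destruct H; constructor. Qed.

Lemma pPhi_cong (F : pseudoFunctor D E) {A B C : ob D}
    {a a1 : hor A B} {c c1 : hor B C} :
  a = a1 -> c = c1 -> pPhi F a c ≈ pPhi F a1 c1.
Proof. intros -> ->; constructor. Qed.

Lemma pPsi_cong (F : pseudoFunctor D E) {A B C : ob D}
    {a a1 : ver A B} {c c1 : ver B C} :
  a = a1 -> c = c1 -> pPsi F a c ≈ pPsi F a1 c1.
Proof. intros -> ->; constructor. Qed.

Lemma vinvertible_fsq (F : doubleFunctor D E)
    {A C A' C' : ob D} {u : ver A A'} {a : hor A C} {a' : hor A' C'}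
    {w : ver C C'} (s : sq u a a' w) :
  vinvertible s -> vinvertible (fsq F s).
Proof.
intros (u' & w' & t & H & K).
exists (fver F u'), (fver F w'), (fsq F t); split.
- eapply sqeq_trans; [apply sqeq_sym, fsq_vcomp|].
  eapply sqeq_trans; [exact (fsq_cong F H)|apply fsq_vid].
- eapply sqeq_trans; [apply sqeq_sym, fsq_vcomp|].
  eapply sqeq_trans; [exact (fsq_cong F K)|apply fsq_vid].
Qed.

Lemma hinvertible_fsq (F : doubleFunctor D E)
    {A C A' C' : ob D} {u : ver A A'} {a : hor A C} {a' : hor A' C'}
    {w : ver C C'} (s : sq u a a' w) :
  hinvertible s -> hinvertible (fsq F s).
Proof.
intros (c & c' & t & H & K).
exists (fhor F c), (fhor F c'), (fsq F t); split.
- eapply sqeq_trans; [apply sqeq_sym, fsq_hcomp|].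
  eapply sqeq_trans; [exact (fsq_cong F H)|apply fsq_hid].
- eapply sqeq_trans; [apply sqeq_sym, fsq_hcomp|].
  eapply sqeq_trans; [exact (fsq_cong F K)|apply fsq_hid].
Qed.

End FunctorCalculus.

(** Closes goals [s ≈ t] where [t] is obtained from [s] by inserting or
    removing transports, or by replacing boundaries by equal ones. *)
Ltac sqcongr :=
  lazymatch goal with
  | |- sqcast _ _ _ _ _ ≈ _ =>
      eapply sqeq_trans; [apply sqcast_sqeq|sqcongr]
  | |- _ ≈ sqcast _ _ _ _ _ =>
      eapply sqeq_trans; [|apply sqeq_sym, sqcast_sqeq]; sqcongr
  | |- _ / _ ≈ _ / _ => apply sqvcomp_cong; sqcongr
  | |- _ ∣ _ ≈ _ ∣ _ => apply sqhcomp_cong; sqcongr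
  | |- sqvcompE _ _ _ ≈ sqvcompE _ _ _ => apply sqvcompE_cong; sqcongr
  | |- psq ?F _ ≈ psq ?F _ => apply psq_cong; sqcongr
  | |- pPhi ?F _ _ ≈ pPhi ?F _ _ => apply pPhi_cong; sqcongr
  | |- pPsi ?F _ _ ≈ pPsi ?F _ _ => apply pPsi_cong; sqcongr
  | |- sqvid _ ≈ sqvid _ => apply sqvid_cong; sqcongr
  | |- sqhid _ ≈ sqhid _ => apply sqhid_cong; sqcongr
  | |- fsq ?F (_ / _) ≈ _ =>
      first [apply sqeq_refl | apply fsq_vcomp
        | eapply sqeq_trans; [apply fsq_vcomp|]; sqcongr]
  | |- fsq ?F (_ ∣ _) ≈ _ =>
      first [apply sqeq_refl | apply fsq_hcomp
        | eapply sqeq_trans; [apply fsq_hcomp|]; sqcongr]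
  | |- fsq ?F (sqvid _) ≈ _ => apply fsq_vid
  | |- fsq ?F (sqhid _) ≈ _ => apply fsq_hid
  | |- _ ≈ fsq ?F (_ / _) => apply sqeq_sym; sqcongr
  | |- _ ≈ fsq ?F (_ ∣ _) => apply sqeq_sym; sqcongr
  | |- _ ≈ fsq ?F (sqvid _) => apply sqeq_sym; sqcongr
  | |- _ ≈ fsq ?F (sqhid _) => apply sqeq_sym; sqcongr
  | |- _ ≈ _ => apply sqeq_refl
  | |- _ = _ =>
      first [reflexivity | apply fhor_comp | apply fver_comp | apply fhor_id
        | apply fver_id | symmetry;
          first [apply fhor_comp | apply fver_comp | apply fhor_id
            | apply fver_id]]
  end.

Local Obligation Tactic := idtac.

Program Definition psId (D : doubleCat) : pseudoFunctor D D := {|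
  pob A := A;
  phor A C a := a;
  pver A A' u := u;
  psq A C A' C' u a a' w s := s;
  pPhi A B C a c := sqvid (a ⨾ c);
  pPhi0 A := sqvid (hid A);
  pPsi A B C u v := sqhid (u • v);
  pPsi0 A := sqhid (vid A)
|}.
Next Obligation. intros; apply (vinvertible_sqvid (dc_laws D)). Qed.
Next Obligation. intros; apply (vinvertible_sqvid (dc_laws D)). Qed.
Next Obligation. intros; apply (hinvertible_sqhid (dc_laws D)). Qed.
Next Obligation. intros; apply (hinvertible_sqhid (dc_laws D)). Qed.
Next Obligation.
intros; eapply sqeq_trans; [apply (sqvid_r (dc_laws D))|].
apply sqeq_sym, (sqvid_l (dc_laws D)).
Qed.
Next Obligation.
intros; eapply sqeq_trans; [apply (sqvid_r (dc_laws D))|].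
apply sqeq_sym, (sqvid_l (dc_laws D)).
Qed.
Next Obligation.
intros; rewrite !(sqvid_comp (dc_laws D)).
eapply sqeq_trans; [apply (sqvid_r (dc_laws D))|].
apply sqeq_sym; eapply sqeq_trans; [apply (sqvid_r (dc_laws D))|].
apply sqvid_cong; symmetry; apply (hcompA (dc_laws D)).
Qed.
Next Obligation.
intros; rewrite !(sqvid_comp (dc_laws D)).
eapply sqeq_trans; [apply (sqvid_r (dc_laws D))|].
apply sqvid_cong, (hid_l (dc_laws D)).
Qed.
Next Obligation.
intros; rewrite !(sqvid_comp (dc_laws D)).
eapply sqeq_trans; [apply (sqvid_r (dc_laws D))|].
apply sqvid_cong, (hid_r (dc_laws D)).
Qed.
Next Obligation.
intros; eapply sqeq_trans; [apply (sqhid_r (dc_laws D))|].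
apply sqeq_sym, (sqhid_l (dc_laws D)).
Qed.
Next Obligation.
intros; eapply sqeq_trans; [apply (sqhid_r (dc_laws D))|].
apply sqeq_sym, (sqhid_l (dc_laws D)).
Qed.
Next Obligation.
intros; rewrite !(sqhid_comp (dc_laws D)).
eapply sqeq_trans; [apply (sqhid_r (dc_laws D))|].
apply sqeq_sym; eapply sqeq_trans; [apply (sqhid_r (dc_laws D))|].
apply sqhid_cong; symmetry; apply (vcompA (dc_laws D)).
Qed.
Next Obligation.
intros; rewrite !(sqhid_comp (dc_laws D)).
eapply sqeq_trans; [apply (sqhid_r (dc_laws D))|].
apply sqhid_cong, (vid_l (dc_laws D)).
Qed.
Next Obligation.
intros; rewrite !(sqhid_comp (dc_laws D)).
eapply sqeq_trans; [apply (sqhid_r (dc_laws D))|].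
apply sqhid_cong, (vid_r (dc_laws D)).
Qed.

(** The composite [G F].  As [F] is strict, its comparison squares are those of
    [G], with a boundary rewritten along an equality such as
    [F (a ⨾ c) = F a ⨾ F c]. *)
Program Definition psAfter {D E K : doubleCat}
    (G : pseudoFunctor E K) (F : doubleFunctor D E) : pseudoFunctor D K := {|
  pob A := G (F A);
  phor A C a := phor G (fhor F a);
  pver A A' u := pver G (fver F u);
  psq A C A' C' u a a' w s := psq G (fsq F s);
  pPhi A B C a c :=
    sqcast eq_refl eq_refl
      (f_equal (@phor _ _ G (F A) (F C)) (eq_sym (fhor_comp F a c))) eq_refl
      (pPhi G (fhor F a) (fhor F c));
  pPhi0 A :=
    sqcast eq_refl eq_refl
      (f_equal (@phor _ _ G (F A) (F A)) (eq_sym (fhor_id F A))) eq_refl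
      (pPhi0 G (F A));
  pPsi A B C u v :=
    sqcast eq_refl eq_refl eq_refl
      (f_equal (@pver _ _ G (F A) (F C)) (eq_sym (fver_comp F u v)))
      (pPsi G (fver F u) (fver F v));
  pPsi0 A :=
    sqcast eq_refl eq_refl eq_refl
      (f_equal (@pver _ _ G (F A) (F A)) (eq_sym (fver_id F A)))
      (pPsi0 G (F A))
|}.
Next Obligation.
intros; eapply vinvertible_sqeq; [apply sqeq_sym, sqcast_sqeq|].
apply pPhi_inv.
Qed.
Next Obligation.
intros; eapply vinvertible_sqeq; [apply sqeq_sym, sqcast_sqeq|].
apply pPhi0_inv.
Qed.
Next Obligation.
intros; eapply hinvertible_sqeq; [apply sqeq_sym, sqcast_sqeq|].
apply pPsi_inv.
Qed.
Next Obligation.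
intros; eapply hinvertible_sqeq; [apply sqeq_sym, sqcast_sqeq|].
apply pPsi0_inv.
Qed.
Next Obligation.
intros; eapply sqeq_trans; [|eapply sqeq_trans];
  [|apply (pPhi_nat G (fsq F s) (fsq F t))|]; sqcongr.
Qed.
Next Obligation.
intros; eapply sqeq_trans; [|eapply sqeq_trans];
  [|apply (pPhi0_nat G (fver F u))|]; sqcongr.
Qed.
Next Obligation.
intros; eapply sqeq_trans; [|eapply sqeq_trans];
  [|apply (pPhi_assoc G (fhor F a) (fhor F b) (fhor F c))|]; sqcongr.
Qed.
Next Obligation.
intros; eapply sqeq_trans; [|apply (pPhi_unit_l G (fhor F a))]; sqcongr.
Qed.
Next Obligation.
intros; eapply sqeq_trans; [|apply (pPhi_unit_r G (fhor F a))]; sqcongr.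
Qed.
Next Obligation.
intros; eapply sqeq_trans; [|eapply sqeq_trans];
  [|apply (pPsi_nat G (fsq F s) (fsq F t))|]; sqcongr.
Qed.
Next Obligation.
intros; eapply sqeq_trans; [|eapply sqeq_trans];
  [|apply (pPsi0_nat G (fhor F a))|]; sqcongr.
Qed.
Next Obligation.
intros; eapply sqeq_trans; [|eapply sqeq_trans];
  [|apply (pPsi_assoc G (fver F u) (fver F v) (fver F w))|]; sqcongr.
Qed.
Next Obligation.
intros; eapply sqeq_trans; [|apply (pPsi_unit_l G (fver F u))]; sqcongr.
Qed.
Next Obligation.
intros; eapply sqeq_trans; [|apply (pPsi_unit_r G (fver F u))]; sqcongr.
Qed.

(** The composite [F G].  As [F] is strict, its comparison squares are the
    images by [F] of those of [G], with boundaries rewritten. *)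
Program Definition psBefore {D E K : doubleCat}
    (F : doubleFunctor E K) (G : pseudoFunctor D E) : pseudoFunctor D K := {|
  pob A := F (G A);
  phor A C a := fhor F (phor G a);
  pver A A' u := fver F (pver G u);
  psq A C A' C' u a a' w s := fsq F (psq G s);
  pPhi A B C a c :=
    sqcast (fver_id F (G A)) (fhor_comp F (phor G a) (phor G c)) eq_refl
      (fver_id F (G C)) (fsq F (pPhi G a c));
  pPhi0 A :=
    sqcast (fver_id F (G A)) (fhor_id F (G A)) eq_refl (fver_id F (G A))
      (fsq F (pPhi0 G A));
  pPsi A B C u v :=
    sqcast (fver_comp F (pver G u) (pver G v)) (fhor_id F (G A))
      (fhor_id F (G C)) eq_refl (fsq F (pPsi G u v));
  pPsi0 A :=
    sqcast (fver_id F (G A)) (fhor_id F (G A)) (fhor_id F (G A)) eq_refl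
      (fsq F (pPsi0 G A))
|}.
Next Obligation.
intros; eapply vinvertible_sqeq; [apply sqeq_sym, sqcast_sqeq|].
apply vinvertible_fsq, pPhi_inv.
Qed.
Next Obligation.
intros; eapply vinvertible_sqeq; [apply sqeq_sym, sqcast_sqeq|].
apply vinvertible_fsq, pPhi0_inv.
Qed.
Next Obligation.
intros; eapply hinvertible_sqeq; [apply sqeq_sym, sqcast_sqeq|].
apply hinvertible_fsq, pPsi_inv.
Qed.
Next Obligation.
intros; eapply hinvertible_sqeq; [apply sqeq_sym, sqcast_sqeq|].
apply hinvertible_fsq, pPsi0_inv.
Qed.
Next Obligation.
intros; eapply sqeq_trans; [|eapply sqeq_trans];
  [|apply (fsq_cong F (pPhi_nat G s t))|]; sqcongr.
Qed.
Next Obligation.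
intros; eapply sqeq_trans; [|eapply sqeq_trans];
  [|apply (fsq_cong F (pPhi0_nat G u))|]; sqcongr.
Qed.
Next Obligation.
intros; eapply sqeq_trans; [|eapply sqeq_trans];
  [|apply (fsq_cong F (pPhi_assoc G a b c))|]; sqcongr.
Qed.
Next Obligation.
intros; eapply sqeq_trans; [|eapply sqeq_trans];
  [|apply (fsq_cong F (pPhi_unit_l G a))|]; sqcongr.
Qed.
Next Obligation.
intros; eapply sqeq_trans; [|eapply sqeq_trans];
  [|apply (fsq_cong F (pPhi_unit_r G a))|]; sqcongr.
Qed.
Next Obligation.
intros; eapply sqeq_trans; [|eapply sqeq_trans];
  [|apply (fsq_cong F (pPsi_nat G s t))|]; sqcongr.
Qed.
Next Obligation.
intros; eapply sqeq_trans; [|eapply sqeq_trans];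
  [|apply (fsq_cong F (pPsi0_nat G a))|]; sqcongr.
Qed.
Next Obligation.
intros; eapply sqeq_trans; [|eapply sqeq_trans];
  [|apply (fsq_cong F (pPsi_assoc G u v w))|]; sqcongr.
Qed.
Next Obligation.
intros; eapply sqeq_trans; [|eapply sqeq_trans];
  [|apply (fsq_cong F (pPsi_unit_l G u))|]; sqcongr.
Qed.
Next Obligation.
intros; eapply sqeq_trans; [|eapply sqeq_trans];
  [|apply (fsq_cong F (pPsi_unit_r G u))|]; sqcongr.
Qed.

Record hTrans {D E : doubleCat} (F G : pseudoFunctor D E) := {
  tob : forall A, hor (F A) (G A);
  thor : forall A C (a : hor A C),
    sq (vid (F A)) (tob A ⨾ phor G a) (phor F a ⨾ tob C) (vid (G C));
  tver : forall A A' (u : ver A A'),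
    sq (pver F u) (tob A) (tob A') (pver G u);
  thor_inv : forall A C (a : hor A C), vinvertible (thor a);
  t_nat : forall A C A' C' (u : ver A A') (a : hor A C) (a' : hor A' C')
    (w : ver C C') (s : sq u a a' w),
    (tver u ∣ psq G s) / thor a' ≈ thor a / (psq F s ∣ tver w);
  thor_comp : forall A B C (a : hor A B) (c : hor B C),
    (sqvid (tob A) ∣ pPhi G a c) / thor (a ⨾ c)
    ≈ (thor a ∣ sqvid (phor G c))
        /[hcompA (dc_laws E) (phor F a) (tob B) (phor G c)]
      ((sqvid (phor F a) ∣ thor c)
        /[eq_sym (hcompA (dc_laws E) (phor F a) (phor F c) (tob C))]
      (pPhi F a c ∣ sqvid (tob C)));
  thor_id : forall A,
    (sqvid (tob A) ∣ pPhi0 G A) / thor (hid A) ≈ pPhi0 F A ∣ sqvid (tob A);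
  tver_comp : forall A B C (u : ver A B) (v : ver B C),
    pPsi F u v ∣ tver (u • v) ≈ (tver u / tver v) ∣ pPsi G u v;
  tver_id : forall A,
    pPsi0 F A ∣ tver (vid A) ≈ sqvid (tob A) ∣ pPsi0 G A
}.

Arguments tob {D E F G} h A.
Arguments thor {D E F G} h {A C} a.
Arguments tver {D E F G} h {A A'} u.

(** Modifications with trivial vertical boundaries. *)
Record modification {D E : doubleCat} {F G : pseudoFunctor D E}
    (phi psi : hTrans F G) := {
  mob : forall A, sq (vid (F A)) (tob phi A) (tob psi A) (vid (G A));
  m_hor : forall A C (a : hor A C),
    (mob A ∣ sqvid (phor G a)) / thor psi a
    ≈ thor phi a / (sqvid (phor F a) ∣ mob C);
  m_ver : forall A A' (u : ver A A'),
    mob A / tver psi u ≈ tver phi u / mob A'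
}.

Arguments mob {D E F G phi psi} m A.

(** Invertibility in the category of transformations [F => G] and
    modifications, whose composition is the componentwise vertical one. *)
Definition minvertible {D E : doubleCat} {F G : pseudoFunctor D E}
    {phi psi : hTrans F G} (th : modification phi psi) : Prop :=
  exists th' : modification psi phi,
    (forall A, mob th A / mob th' A ≈ sqvid (tob phi A)) /\
    (forall A, mob th' A / mob th A ≈ sqvid (tob psi A)).

Program Definition tId {D E : doubleCat} (F : pseudoFunctor D E) :
    hTrans F F := {|
  tob A := hid (F A);
  thor A C a :=
    sqcast eq_refl (eq_sym (hid_l (dc_laws E) (phor F a)))
      (eq_sym (hid_r (dc_laws E) (phor F a))) eq_refl (sqvid (phor F a));
  tver A A' u := sqhid (pver F u)
|}.
Next Obligation.
intros; eapply vinvertible_sqeq; [apply sqeq_sym, sqcast_sqeq|].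
apply (vinvertible_sqvid (dc_laws E)).
Qed.
Next Obligation.
intros D E F A C A' C' u a a' w s.
assert (L := dc_laws E).
eapply sqeq_trans.
{ eapply sqeq_trans; [apply (sqvcompE_refl _ _ eq_refl)|].
  eapply sqeq_trans;
    [eapply sqvcompE_cong with (e1 := eq_refl); [apply (sqhid_l L)|
       apply sqcast_sqeq]|].
  apply (sqvid_r L). }
apply sqeq_sym.
eapply sqeq_trans; [apply (sqvcompE_refl _ _ eq_refl)|].
eapply sqeq_trans;
  [eapply sqvcompE_cong with (e1 := eq_refl); [apply sqcast_sqeq|
     apply (sqhid_r L)]|].
apply (sqvid_l L).
Qed.
Next Obligation.
intros D E F A B C a c.
assert (L := dc_laws E).
eapply sqeq_trans.
{ eapply sqeq_trans; [apply (sqvcompE_refl _ _ eq_refl)|].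
  eapply sqeq_trans;
    [eapply sqvcompE_cong with (e1 := eq_refl);
       [rewrite <- (sqhid_vid L); apply (sqhid_l L)|apply sqcast_sqeq]|].
  apply (sqvid_r L). }
apply sqeq_sym.
eapply sqeq_trans.
{ eapply sqvcompE_cong with (e1 := eq_refl).
  - eapply sqeq_trans;
      [eapply sqhcomp_cong; [apply sqcast_sqeq|apply sqeq_refl]|].
    apply eq_sqeq, (sqvid_comp L).
  - eapply sqvcompE_cong with (e1 := eq_refl).
    + eapply sqeq_trans;
        [eapply sqhcomp_cong; [apply sqeq_refl|apply sqcast_sqeq]|].
      apply eq_sqeq, (sqvid_comp L).
    + rewrite <- (sqhid_vid L); apply (sqhid_r L). }
eapply sqeq_trans; [apply (sqvid_l L)|apply (sqvid_l L)].
Qed.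
Next Obligation.
intros D E F A.
assert (L := dc_laws E).
eapply sqeq_trans.
{ eapply sqeq_trans; [apply (sqvcompE_refl _ _ eq_refl)|].
  eapply sqeq_trans;
    [eapply sqvcompE_cong with (e1 := eq_refl);
       [rewrite <- (sqhid_vid L); apply (sqhid_l L)|apply sqcast_sqeq]|].
  apply (sqvid_r L). }
rewrite <- (sqhid_vid L); apply sqeq_sym, (sqhid_r L).
Qed.
Next Obligation.
intros D E F A B C u v.
assert (L := dc_laws E).
eapply sqeq_trans; [apply (sqhid_r L)|].
rewrite (sqhid_comp L); apply sqeq_sym, (sqhid_l L).
Qed.
Next Obligation.
intros D E F A.
assert (L := dc_laws E).
eapply sqeq_trans; [apply (sqhid_r L)|].
rewrite <- (sqhid_vid L); apply sqeq_sym, (sqhid_l L).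
Qed.

Section TransformationComp.
Context {D E : doubleCat} {F G H : pseudoFunctor D E}.
Context (phi : hTrans F G) (psi : hTrans G H).
Local Notation L := (dc_laws E).

(** The component at [a] of the composite of [phi] followed by [psi]: first
    slide [a] past [psi], then past [phi]. *)
Definition tcomp_hor A C (a : hor A C) :
    sq (vid (F A)) ((tob phi A ⨾ tob psi A) ⨾ phor H a)
      (phor F a ⨾ (tob phi C ⨾ tob psi C)) (vid (H C)) :=
  sqcast (vid_l L (vid (F A)))
    (eq_sym (hcompA L (tob phi A) (tob psi A) (phor H a)))
    (hcompA L (phor F a) (tob phi C) (tob psi C))
    (vid_l L (vid (H C)))
    ((sqvid (tob phi A) ∣ thor psi a)
       /[eq_sym (hcompA L (tob phi A) (phor G a) (tob psi C))]
     (thor phi a ∣ sqvid (tob psi C))).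

Lemma tcomp_horE A C (a : hor A C) :
  tcomp_hor a
  ≈ (sqvid (tob phi A) ∣ thor psi a)
       /[eq_sym (hcompA L (tob phi A) (phor G a) (tob psi C))]
     (thor phi a ∣ sqvid (tob psi C)).
Proof. apply sqcast_sqeq. Qed.

Lemma sqvidE2 {A B : ob E} (b : hor A B) (e : b = b) :
  sqvid b ≈ sqvid b /[e] sqvid b.
Proof. apply sqeq_sym, (sqvidE_l L). Qed.

Lemma whisker2L {A B C : ob E} (b : hor A B) {c0 f0 c d d' f : hor B C}
    {v x y z} {w : ver A A} (q : sq w b b v) (p : sq v c0 f0 z)
    (s : sq (vid B) c d x) (e : d = d') (t : sq (vid B) d' f y)
    (e' : b ⨾ d = b ⨾ d') :
  q ≈ sqvid b -> p ≈ s /[e] t ->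
  q ∣ p ≈ (sqvid b ∣ s) /[e'] (sqvid b ∣ t).
Proof.
intros Hq Hp.
eapply sqeq_trans;
  [|apply sqeq_sym, (interchangeE L) with (e := eq_refl) (f := e)].
apply sqhcomp_cong; [|exact Hp].
eapply sqeq_trans; [exact Hq|apply sqvidE2].
Qed.

Lemma whisker2R {A B C : ob E} (b : hor B C) {c0 f0 c d d' f : hor A B}
    {v x y z} {w : ver C C} (p : sq z c0 f0 v) (q : sq v b b w)
    (s : sq x c d (vid B)) (e : d = d') (t : sq y d' f (vid B))
    (e' : d ⨾ b = d' ⨾ b) :
  q ≈ sqvid b -> p ≈ s /[e] t ->
  p ∣ q ≈ (s ∣ sqvid b) /[e'] (t ∣ sqvid b).
Proof.
intros Hq Hp.
eapply sqeq_trans;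
  [|apply sqeq_sym, (interchangeE L) with (e := e) (f := eq_refl)].
apply sqhcomp_cong; [exact Hp|].
eapply sqeq_trans; [exact Hq|apply sqvidE2].
Qed.

Lemma whisker3L {A B C : ob E} (b : hor A B) {c0 g0 c d d' f f' g : hor B C}
    {v x y y' z} {w : ver A A} (q : sq w b b v) (p : sq v c0 g0 z)
    (s : sq (vid B) c d x) (e : d = d') (t : sq (vid B) d' f y)
    (h : f = f') (r : sq (vid B) f' g y')
    (e' : b ⨾ d = b ⨾ d') (h' : b ⨾ f = b ⨾ f') :
  q ≈ sqvid b -> p ≈ s /[e] (t /[h] r) ->
  q ∣ p ≈ (sqvid b ∣ s) /[e'] ((sqvid b ∣ t) /[h'] (sqvid b ∣ r)).
Proof.
destruct e, h; rewrite (UIP_refl _ _ e'), (UIP_refl _ _ h').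
intros Hq Hp.
change (q ∣ p ≈ (sqvid b ∣ s) / ((sqvid b ∣ t) / (sqvid b ∣ r))).
rewrite !(interchange L).
apply sqhcomp_cong; [|exact Hp].
eapply sqeq_trans; [exact Hq|].
apply sqeq_sym; eapply sqeq_trans; apply (sqvid_l L).
Qed.

Lemma whisker3R {A B C : ob E} (b : hor B C) {c0 g0 c d d' f f' g : hor A B}
    {v x y y' z} {w : ver C C} (p : sq z c0 g0 v) (q : sq v b b w)
    (s : sq x c d (vid B)) (e : d = d') (t : sq y d' f (vid B))
    (h : f = f') (r : sq y' f' g (vid B))
    (e' : d ⨾ b = d' ⨾ b) (h' : f ⨾ b = f' ⨾ b) :
  q ≈ sqvid b -> p ≈ s /[e] (t /[h] r) ->
  p ∣ q ≈ (s ∣ sqvid b) /[e'] ((t ∣ sqvid b) /[h'] (r ∣ sqvid b)).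
Proof.
destruct e, h; rewrite (UIP_refl _ _ e'), (UIP_refl _ _ h').
intros Hq Hp.
change (p ∣ q ≈ (s ∣ sqvid b) / ((t ∣ sqvid b) / (r ∣ sqvid b))).
rewrite !(interchange L).
apply sqhcomp_cong; [exact Hp|].
eapply sqeq_trans; [exact Hq|].
apply sqeq_sym; eapply sqeq_trans; apply (sqvid_l L).
Qed.

Lemma exchangeE {A B C : ob E} {a b : hor A B} {c d : hor B C}
    {a1 a2 a3 a4 b1 b2 b3 b4 : hor A C} {v1 v2 v3 v4 w1 w2 w3 w4}
    (s : sq (vid A) a b (vid B)) (t : sq (vid B) c d (vid C))
    (p1 : sq v1 a1 b1 w1) (p2 : sq v2 a2 b2 w2)
    (q1 : sq v3 a3 b3 w3) (q2 : sq v4 a4 b4 w4) (e : b1 = a2) (e' : b3 = a4) :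
  p1 ≈ sqvid a ∣ t -> p2 ≈ s ∣ sqvid d ->
  q1 ≈ s ∣ sqvid c -> q2 ≈ sqvid b ∣ t ->
  p1 /[e] p2 ≈ q1 /[e'] q2.
Proof.
intros H1 H2 H3 H4.
eapply sqeq_trans; [exact (sqvcompE_cong e eq_refl H1 H2)|].
apply sqeq_sym.
eapply sqeq_trans; [exact (sqvcompE_cong e' eq_refl H3 H4)|].
apply sqeq_sym.
eapply sqeq_trans;
  [apply (interchangeE L) with (e := eq_refl) (f := eq_refl)|].
apply sqeq_sym; eapply sqeq_trans;
  [apply (interchangeE L) with (e := eq_refl) (f := eq_refl)|].
apply sqhcomp_cong.
- eapply sqeq_trans; [apply (sqvid_r L)|apply sqeq_sym, (sqvid_l L)].
- eapply sqeq_trans; [apply (sqvid_l L)|apply sqeq_sym, (sqvid_r L)].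
Qed.

Lemma sqvcompE_swap {A C : ob E}
    {a0 a1 a1' a2 a2' a3 a3' a4 b1' b2 b2' b3 : hor A C}
    {v1 v2 v3 v4 v5 v6 w1 w2 w3 w4 w5 w6 : ver _ _}
    (p : sq v1 a0 a1 w1) (q : sq v2 a1' a2 w2) (r : sq v3 a2' a3 w3)
    (x : sq v4 a3' a4 w4) (r' : sq v5 b1' b2 w5) (q' : sq v6 b2' b3 w6)
    (e1 : a1 = a1') (e1' : a1 = b1') (e2 : a2 = a2') (e3 : a3 = a3')
    (e3' : b3 = a3') (e2' : b2 = b2') :
  q /[e2] r ≈ r' /[e2'] q' ->
  p /[e1] (q /[e2] (r /[e3] x)) ≈ p /[e1'] (r' /[e2'] (q' /[e3'] x)).
Proof.
intros K.
apply sqvcompE_cong; [apply sqeq_refl|].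
eapply sqeq_trans; [apply sqeq_sym, (sqvcompE_assoc L) with (f := e3)|].
eapply sqeq_trans; [exact (sqvcompE_cong e3 e3' K (sqeq_refl x))|].
apply (sqvcompE_assoc L).
Qed.

Lemma tcomp_nat A C A' C' (u : ver A A') (a : hor A C) (a' : hor A' C')
    (w : ver C C') (s : sq u a a' w) :
  ((tver phi u ∣ tver psi u) ∣ psq H s) / tcomp_hor a'
  ≈ tcomp_hor a / (psq F s ∣ (tver phi w ∣ tver psi w)).
Proof.
eapply sqeq_trans.
{ eapply sqeq_trans; [apply (sqvcompE_refl _ _ eq_refl)|].
  eapply sqeq_trans.
  { eapply sqvcompE_cong with (e1 := eq_refl);
      [apply (sqhcompA L)|apply tcomp_horE]. }
  eapply sqeq_trans.
  { apply sqeq_sym. apply (sqvcompE_assoc L) with (e := eq_refl)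
      (f := eq_sym (hcompA L (tob phi A') (phor G a') (tob psi C'))). }
  eapply sqeq_trans.
  { eapply sqvcompE_cong; [|apply sqeq_refl].
    eapply sqeq_trans; [apply (interchangeE L) with (e := eq_refl)
      (f := eq_refl)|].
    eapply sqeq_trans.
    { eapply sqhcomp_cong; [|apply (t_nat psi s)].
      eapply sqeq_trans; [apply (sqvid_r L)|].
      apply sqeq_sym, (sqvid_l L). }
    rewrite <- (interchange L).
    apply (sqvcompE_refl _ _ eq_refl). }
  eapply sqeq_trans.
  { apply (sqvcompE_assoc L) with (e' := eq_refl)
      (f' := eq_sym (hcompA L (tob phi A') (phor G a') (tob psi C'))). }
  eapply sqvcompE_cong with (e1 := eq_sym (hcompA L _ _ _));
    [apply sqeq_refl|].
  eapply sqeq_trans.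
  { eapply sqvcompE_cong with (e1 := eq_refl);
      [apply sqeq_sym, (sqhcompA L)|apply sqeq_refl]. }
  eapply sqeq_trans; [apply (interchangeE L) with (e := eq_refl)
    (f := eq_refl)|].
  eapply sqeq_trans.
  { eapply sqhcomp_cong; [apply (t_nat phi s)|].
    eapply sqeq_trans; [apply (sqvid_r L)|].
    apply sqeq_sym, (sqvid_l L). }
  rewrite <- (interchange L).
  eapply sqeq_trans; [apply (sqvcompE_refl _ _ eq_refl)|].
  eapply sqvcompE_cong with (e1 := hcompA L _ _ _);
    [apply sqeq_refl|apply (sqhcompA L)]. }
apply sqeq_sym.
eapply sqeq_trans; [apply (sqvcompE_refl _ _ eq_refl)|].
eapply sqeq_trans.
{ eapply sqvcompE_cong; [apply tcomp_horE|apply sqeq_refl]. }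
apply (sqvcompE_assoc L).
Unshelve. all: rewrite ?(hcompA L); reflexivity.
Qed.

Lemma tcomp_thor_comp A B C (a : hor A B) (c : hor B C) :
  (sqvid (tob phi A ⨾ tob psi A) ∣ pPhi H a c) / tcomp_hor (a ⨾ c)
  ≈ (tcomp_hor a ∣ sqvid (phor H c))
      /[hcompA L (phor F a) (tob phi B ⨾ tob psi B) (phor H c)]
    ((sqvid (phor F a) ∣ tcomp_hor c)
      /[eq_sym (hcompA L (phor F a) (phor F c) (tob phi C ⨾ tob psi C))]
    (pPhi F a c ∣ sqvid (tob phi C ⨾ tob psi C))).
Proof.
eapply sqeq_trans.
{ eapply sqeq_trans; [apply (sqvcompE_refl _ _ eq_refl)|].
  eapply sqeq_trans.
  { eapply sqvcompE_cong with (e1 := eq_refl); [|apply tcomp_horE].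
    rewrite <- (sqvid_comp L); apply (sqhcompA L). }
  eapply sqeq_trans.
  { apply sqeq_sym. apply (sqvcompE_assoc L) with (e := eq_refl)
      (f := eq_sym (hcompA L _ _ _)). }
  eapply sqeq_trans.
  { eapply sqvcompE_cong with (e1 := eq_sym (hcompA L _ _ _));
      [|apply sqeq_refl].
    eapply sqeq_trans;
      [apply (interchangeE L) with (e := eq_refl) (f := eq_refl)|].
    eapply whisker3L; [apply (sqvidE_l L)|].
    exact (thor_comp psi a c). }
  eapply sqeq_trans; [apply (sqvcompE_assoc L)|].
  eapply sqvcompE_cong; [apply sqeq_refl|].
  eapply sqeq_trans; [apply (sqvcompE_assoc L)|].
  eapply sqvcompE_cong; [apply sqeq_refl|].
  eapply sqeq_trans.
  { eapply sqvcompE_cong with (e1 := eq_refl);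
      [apply sqeq_sym, (sqhcompA L)|apply sqeq_refl]. }
  eapply sqeq_trans;
    [apply (interchangeE L) with (e := eq_refl) (f := eq_refl)|].
  eapply whisker3R; [apply (sqvidE_l L)|].
  exact (thor_comp phi a c). }
apply sqeq_sym.
eapply sqeq_trans.
{ eapply sqvcompE_cong.
  - eapply whisker2R; [apply sqeq_refl|apply tcomp_horE].
  - eapply sqvcompE_cong; [|apply sqeq_refl].
    eapply whisker2L; [apply sqeq_refl|apply tcomp_horE]. }
eapply sqeq_trans; [apply (sqvcompE_assoc L)|].
eapply sqeq_trans.
{ eapply sqvcompE_cong; [apply sqeq_refl|].
  eapply sqvcompE_cong; [apply sqeq_refl|].
  apply (sqvcompE_assoc L). }
eapply sqeq_trans.
{ eapply sqvcompE_swap.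
  apply sqeq_sym, exchangeE with (s := thor phi a) (t := thor psi c)
    (p1 := sqvid (tob phi A) ∣ (sqvid (phor G a) ∣ thor psi c))
    (p2 := (thor phi a ∣ sqvid (phor G c)) ∣ sqvid (tob psi C)).
  - rewrite <- (sqvid_comp L); apply sqeq_sym, (sqhcompA L).
  - rewrite <- (sqvid_comp L); apply (sqhcompA L).
  - rewrite <- (sqvid_comp L); apply (sqhcompA L).
  - rewrite <- (sqvid_comp L); apply sqeq_sym, (sqhcompA L). }
eapply sqvcompE_cong; [apply (sqhcompA L)|].
eapply sqvcompE_cong; [apply sqeq_refl|].
eapply sqvcompE_cong; [apply sqeq_refl|].
eapply sqvcompE_cong; [apply sqeq_sym, (sqhcompA L)|].
rewrite <- (sqvid_comp L); apply sqeq_sym, (sqhcompA L).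
Unshelve. all: rewrite ?(hcompA L); reflexivity.
Qed.

Lemma tcomp_thor_id A :
  (sqvid (tob phi A ⨾ tob psi A) ∣ pPhi0 H A) / tcomp_hor (hid A)
  ≈ pPhi0 F A ∣ sqvid (tob phi A ⨾ tob psi A).
Proof.
eapply sqeq_trans; [apply (sqvcompE_refl _ _ eq_refl)|].
eapply sqeq_trans.
{ eapply sqvcompE_cong with (e1 := eq_refl); [|apply tcomp_horE].
  rewrite <- (sqvid_comp L); apply (sqhcompA L). }
eapply sqeq_trans.
{ apply sqeq_sym. apply (sqvcompE_assoc L) with (e := eq_refl)
    (f := eq_sym (hcompA L _ _ _)). }
eapply sqeq_trans.
{ eapply sqvcompE_cong with (e1 := eq_refl); [|apply sqeq_refl].
  eapply sqeq_trans;
    [apply (interchangeE L) with (e := eq_refl) (f := eq_refl)|].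
  eapply sqeq_trans;
    [eapply sqhcomp_cong; [apply (sqvidE_l L)|exact (thor_id psi A)]|].
  apply sqeq_sym, (sqhcompA L). }
eapply sqeq_trans;
  [apply (interchangeE L) with (e := eq_refl) (f := eq_refl)|].
eapply sqeq_trans;
  [eapply sqhcomp_cong; [exact (thor_id phi A)|apply (sqvidE_l L)]|].
rewrite <- (sqvid_comp L); apply (sqhcompA L).
Qed.

Lemma tcomp_ver_comp A B C (u : ver A B) (v : ver B C) :
  pPsi F u v ∣ (tver phi (u • v) ∣ tver psi (u • v))
  ≈ ((tver phi u ∣ tver psi u) / (tver phi v ∣ tver psi v)) ∣ pPsi H u v.
Proof.
eapply sqeq_trans; [apply sqeq_sym, (sqhcompA L)|].
eapply sqeq_trans;
  [eapply sqhcomp_cong; [apply (tver_comp phi)|apply sqeq_refl]|].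
eapply sqeq_trans; [apply (sqhcompA L)|].
eapply sqeq_trans;
  [eapply sqhcomp_cong; [apply sqeq_refl|apply (tver_comp psi)]|].
rewrite (interchange L); apply sqeq_sym, (sqhcompA L).
Qed.

Lemma tcomp_ver_id A :
  pPsi0 F A ∣ (tver phi (vid A) ∣ tver psi (vid A))
  ≈ sqvid (tob phi A ⨾ tob psi A) ∣ pPsi0 H A.
Proof.
eapply sqeq_trans; [apply sqeq_sym, (sqhcompA L)|].
eapply sqeq_trans;
  [eapply sqhcomp_cong; [apply (tver_id phi)|apply sqeq_refl]|].
eapply sqeq_trans; [apply (sqhcompA L)|].
eapply sqeq_trans;
  [eapply sqhcomp_cong; [apply sqeq_refl|apply (tver_id psi)]|].
rewrite <- (sqvid_comp L); apply sqeq_sym, (sqhcompA L).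
Qed.

Lemma tcomp_hor_inv A C (a : hor A C) : vinvertible (tcomp_hor a).
Proof.
eapply vinvertible_sqeq; [apply sqeq_sym, tcomp_horE|].
apply (vinvertible_vcompE L); apply (vinvertible_hcomp L);
  (apply (vinvertible_sqvid L) || apply thor_inv).
Qed.

Definition tComp : hTrans F H := {|
  tob A := tob phi A ⨾ tob psi A;
  thor A C a := tcomp_hor a;
  tver A A' u := tver phi u ∣ tver psi u;
  thor_inv := tcomp_hor_inv;
  t_nat := tcomp_nat;
  thor_comp := tcomp_thor_comp;
  thor_id := tcomp_thor_id;
  tver_comp := tcomp_ver_comp;
  tver_id := tcomp_ver_id
|}.

End TransformationComp.

(** [phi] is an equivalence in the 2-category of pseudo double functors
    [D -> E], horizontal pseudo natural transformations and modifications. *)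
Definition is_hEquivalence {D E : doubleCat} {F G : pseudoFunctor D E}
    (phi : hTrans F G) : Prop :=
  exists (psi : hTrans G F)
    (eta : modification (tId F) (tComp phi psi))
    (eps : modification (tComp psi phi) (tId G)),
    minvertible eta /\ minvertible eps.

(* Main.v *)
(** Call a square [s] cartesian if every square with the right boundary of [s],
    whose top and bottom end with those of [s], factors uniquely as [x ∣ s].
    Weakly horizontally invertible squares are cartesian.

    Given a double biequivalence [F], choose an equivalence [F (G X) -> X] for
    each object, an invertible cell [e X ⨾ b => F (G b) ⨾ e Y] for each
    horizontal [b], and a cartesian square [F (G v) -> v] for each vertical [v];
    weak horizontal invariance is what lets the vertical morphism given by the
    third axiom be replaced by one between the chosen objects. By unique
    factorisation and full faithfulness of [F] on squares, a square of [A] is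
    the same thing as a square of [B] between the images of its boundary, so [G] on
    squares and its comparison squares are determined, and every coherence law
    can be checked after composing with the chosen squares. The unit, and a
    pseudo-inverse of any transformation made of equivalences and cartesian
    squares, arise in the same way.

    Conversely, the vertical components of an equivalence of transformations are
    weakly horizontally invertible, hence cancellable on either side, so an
    endofunctor equivalent to the identity is bijective on squares. Applied to
    [G F] and [F G], this makes [F] bijective on squares. *)

From Stdlib Require Import Eqdep Program.Equality ProofIrrelevance.
From Stdlib Require Import ClassicalEpsilon Setoid Morphisms.
Require Import Defs.

Set Implicit Arguments.
Unset Strict Implicit.
Local Open Scope double_scope.

(** * Squares with forgotten boundaries *)

(** Every datum to be constructed is the unknown [x] in one kind of equation:
    [t // (tot (fsq F x) ** tot r) // t'] is a given square, where [t] and [t'] are invertible cells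
    and [r] is cartesian. Cancelling the cells, factoring through [r] and lifting along [F] solves
    it, and two solutions agree. Identity squares of horizontal equivalences are cartesian, so
    comparison cells between horizontal morphisms fall under the same scheme, with such an identity
    as [r]. The equation imposed is the transformation or modification law wanted later, and a
    coherence law amounts to the equality of two pastings of given squares. Weak horizontal
    invertibility is less convenient: its data would have to be carried along, and its cells need
    not satisfy triangle identities. The cost of working with cartesian squares appears in vertical
    composition, where adjoint equivalences are needed. Pseudo-inverses of transformations come from
    the same lifting, with the identity functor in place of [F] and the identity transformation as
    the one to be lifted. *)

Lemma Some_inj X (x y : X) : Some x = Some y -> x = y.
Proof. intros [= h]; exact h. Qed.

(** A square is packed with its boundary, and both compositions become total
    operations on [option sqT], with value [None] when the boundaries do not
    match. Then [≈] becomes [=] and no transport is left; associativity holds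
    without condition, the other laws under equations between boundaries, which
    the tactic [bdry] solves. *)
Section TotalSquares.
Context {D : doubleCat}.
Local Notation L := (dc_laws D).

Record horT := HorT { horT_src : ob D; horT_tgt : ob D;
  horT_mor : hor horT_src horT_tgt }.
Record verT := VerT { verT_src : ob D; verT_tgt : ob D;
  verT_mor : ver verT_src verT_tgt }.
Record sqT := SqT { sqT_nw : ob D; sqT_ne : ob D; sqT_sw : ob D; sqT_se : ob D;
  sqT_left : ver sqT_nw sqT_sw; sqT_top : hor sqT_nw sqT_ne;
  sqT_bot : hor sqT_sw sqT_se; sqT_right : ver sqT_ne sqT_se;
  sqT_sq : sq sqT_left sqT_top sqT_bot sqT_right }.

Lemma HorT_inj A C (a b : hor A C) : HorT a = HorT b -> a = b.
Proof. intros h; inversion h; now do 2 apply inj_pair2 in H0. Qed.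

Definition toH {A C : ob D} (a : hor A C) : option horT := Some (HorT a).
Definition toV {A C : ob D} (u : ver A C) : option verT := Some (VerT u).
Definition tot {A C A' C' : ob D} {u : ver A A'} {a : hor A C} {a' : hor A' C'}
  {w : ver C C'} (s : sq u a a' w) : option sqT := Some (SqT s).

Definition lf (x : option sqT) : option verT :=
  match x with Some s => toV (sqT_left s) | None => None end.
Definition rt (x : option sqT) : option verT :=
  match x with Some s => toV (sqT_right s) | None => None end.
Definition tp (x : option sqT) : option horT :=
  match x with Some s => toH (sqT_top s) | None => None end.
Definition bt (x : option sqT) : option horT :=
  match x with Some s => toH (sqT_bot s) | None => None end.

(** Composing packed squares directly would need a transport along an equality of packed boundaries.
    A relation whose only constructor takes composable typed squares avoids it; [the_option] then
    makes a total operation of the relation, by excluded middle and description. *)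
Inductive hrel : option sqT -> option sqT -> sqT -> Prop :=
  hrel_intro A C E A' C' E' (u : ver A A') (v : ver C C') (w : ver E E')
    (a : hor A C) (a' : hor A' C') (c : hor C E) (c' : hor C' E')
    (s : sq u a a' v) (t : sq v c c' w) : hrel (tot s) (tot t) (SqT (s ∣ t)).
Inductive vrel : option sqT -> option sqT -> sqT -> Prop :=
  vrel_intro A C A' C' A'' C''
    (a : hor A C) (a' : hor A' C') (a'' : hor A'' C'')
    (u : ver A A') (w : ver C C') (u' : ver A' A'') (w' : ver C' C'')
    (s : sq u a a' w) (t : sq u' a' a'' w') :
    vrel (tot s) (tot t) (SqT (s / t)).
Inductive hhrel : option horT -> option horT -> horT -> Prop :=
  hhrel_intro A C E (a : hor A C) (c : hor C E) :
    hhrel (toH a) (toH c) (HorT (a ⨾ c)).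
Inductive vvrel : option verT -> option verT -> verT -> Prop :=
  vvrel_intro A C E (a : ver A C) (c : ver C E) :
    vvrel (toV a) (toV c) (VerT (a • c)).

Definition the_option {X : Type} (P : X -> Prop) : option X :=
  match excluded_middle_informative (exists r, P r) with
  | left h => Some (proj1_sig (constructive_indefinite_description _ h))
  | right _ => None
  end.

Lemma the_option_Some X (P : X -> Prop) r :
  P r -> (forall r', P r' -> r' = r) -> the_option P = Some r.
Proof.
intros h hu; unfold the_option; destruct excluded_middle_informative as [e|n].
- f_equal; apply hu; exact (proj2_sig (constructive_indefinite_description _
    e)).
- destruct n; exists r; exact h.
Qed.

Lemma the_option_spec X (P : X -> Prop) r : the_option P = Some r -> P r.
Proof.
unfold the_option; destruct excluded_middle_informative as [e|n];
  [|discriminate].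
intros [= <-]; exact (proj2_sig (constructive_indefinite_description _ e)).
Qed.

Definition hc (x y : option sqT) := the_option (hrel x y).
Definition vc (x y : option sqT) := the_option (vrel x y).
Definition hcH (x y : option horT) := the_option (hhrel x y).
Definition vcV (x y : option verT) := the_option (vvrel x y).

Local Notation "x ** y" := (hc x y) (at level 40, left associativity).
Local Notation "x // y" := (vc x y) (at level 41, left associativity).

Lemma tot_hcomp A C E A' C' E' (u : ver A A') (v : ver C C') (w : ver E E')
    (a : hor A C) (a' : hor A' C') (c : hor C E) (c' : hor C' E')
    (s : sq u a a' v) (t : sq v c c' w) : tot (s ∣ t) = tot s ** tot t.
Proof.
symmetry; apply the_option_Some; [constructor|].
intros r h; dependent destruction h; reflexivity.
Qed.

Lemma tot_vcomp A C A' C' A'' C''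
    (a : hor A C) (a' : hor A' C') (a'' : hor A'' C'')
    (u : ver A A') (w : ver C C') (u' : ver A' A'') (w' : ver C' C'')
    (s : sq u a a' w) (t : sq u' a' a'' w') : tot (s / t) = tot s // tot t.
Proof.
symmetry; apply the_option_Some; [constructor|].
intros r h; dependent destruction h; reflexivity.
Qed.

Lemma hcH_tot A C E (a : hor A C) (c : hor C E) :
  hcH (toH a) (toH c) = toH (a ⨾ c).
Proof.
apply the_option_Some; [constructor|].
intros r h; dependent destruction h; reflexivity.
Qed.

Lemma vcV_tot A C E (a : ver A C) (c : ver C E) :
  vcV (toV a) (toV c) = toV (a • c).
Proof.
apply the_option_Some; [constructor|].
intros r h; dependent destruction h; reflexivity.
Qed.

Lemma tot_eq A C A' C' (u : ver A A') (a : hor A C) (a' : hor A' C')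
    (w : ver C C') v b b' x (s : sq u a a' w) (t : sq v b b' x) :
  s ≈ t -> tot s = tot t.
Proof. intros h; destruct h; reflexivity. Qed.

Lemma tot_inj A C A' C' (u : ver A A') (a : hor A C) (a' : hor A' C')
    (w : ver C C') v b b' x (s : sq u a a' w) (t : sq v b b' x) :
  tot s = tot t -> s ≈ t.
Proof.
intros h.
apply (f_equal (fun o => match o with Some r => r | None => SqT s end))
  in h; cbn in h.
dependent destruction h; constructor.
Qed.

Lemma tot_cast A C A' C' (u v : ver A A') (a b : hor A C)
    (a' b' : hor A' C') (w x : ver C C')
    (eu : u = v) (ea : a = b) (ea' : a' = b') (ew : w = x) (s : sq u a a' w) :
  tot (sqcast eu ea ea' ew s) = tot s.
Proof. apply tot_eq, sqcast_sqeq. Qed.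

Lemma tot_vcompE A C A' C' A'' C''
    (a : hor A C) (b b' : hor A' C') (c : hor A'' C'')
    (u : ver A A') (w : ver C C') (u' : ver A' A'') (w' : ver C' C'')
    (s : sq u a b w) (e : b = b') (t : sq u' b' c w') :
  tot (s /[e] t) = tot s // tot t.
Proof. unfold sqvcompE; rewrite tot_vcomp, tot_cast; reflexivity. Qed.

(** The way back to typed squares: a pasting whose boundary has been computed is the image of a
    typed square, to which unique factorisation or full faithfulness can be applied. *)
Lemma tot_surj A C A' C' (u : ver A A') (a : hor A C) (a' : hor A' C')
    (w : ver C C') (x : option sqT) :
  lf x = toV u -> tp x = toH a -> bt x = toH a' -> rt x = toV w ->
  exists s : sq u a a' w, x = tot s.
Proof.
destruct x as [[A1 C1 A1' C1' u1 a1 a1' w1 s]|]; [|discriminate].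
cbn; intros h1 h2 h3 h4.
apply Some_inj in h1, h2, h3, h4.
dependent destruction h1; dependent destruction h2.
revert h3; dependent destruction h4; intros h3; apply HorT_inj in h3; subst.
exists s; reflexivity.
Qed.

(** The boundary of [None] is [None], so two undefined squares also satisfy the hypothesis; hence
    the first case. *)
Lemma hc_cases x y : rt x = lf y -> (x = None /\ y = None) \/
  exists A C E A' C' E' (u : ver A A') (v : ver C C') (w : ver E E')
    (a : hor A C) (a' : hor A' C') (c : hor C E) (c' : hor C' E')
    (s : sq u a a' v) (t : sq v c c' w), x = tot s /\ y = tot t.
Proof.
destruct x as [[A1 C1 A1' C1' u1 a1 a1' w1 s]|],
  y as [[A2 C2 A2' C2' u2 a2 a2' w2 t]|]; cbn; try discriminate; [|now left].
intros h; apply Some_inj in h; right.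
dependent destruction h.
do 15 eexists; split; reflexivity.
Qed.

Lemma vc_cases x y : bt x = tp y -> (x = None /\ y = None) \/
  exists A C A' C' A'' C''
    (a : hor A C) (a' : hor A' C') (a'' : hor A'' C'')
    (u : ver A A') (w : ver C C') (u' : ver A' A'') (w' : ver C' C'')
    (s : sq u a a' w) (t : sq u' a' a'' w'), x = tot s /\ y = tot t.
Proof.
destruct x as [[A1 C1 A1' C1' u1 a1 a1' w1 s]|],
  y as [[A2 C2 A2' C2' u2 a2 a2' w2 t]|]; cbn; try discriminate; [|now left].
intros h; apply Some_inj in h; right.
dependent destruction h.
do 15 eexists; split; reflexivity.
Qed.

Lemma hc_None_l y : None ** y = None.
Proof.
destruct (None ** y) eqn:h; [|reflexivity].
apply the_option_spec in h; dependent destruction h.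
Qed.
Lemma hc_None_r x : x ** None = None.
Proof.
destruct (x ** None) eqn:h; [|reflexivity].
apply the_option_spec in h; dependent destruction h.
Qed.
Lemma vc_None_l y : None // y = None.
Proof.
destruct (None // y) eqn:h; [|reflexivity].
apply the_option_spec in h; dependent destruction h.
Qed.
Lemma vc_None_r x : x // None = None.
Proof.
destruct (x // None) eqn:h; [|reflexivity].
apply the_option_spec in h; dependent destruction h.
Qed.

Lemma hc_composable x y r : x ** y = Some r -> rt x = lf y.
Proof. intros h; apply the_option_spec in h; destruct h; reflexivity. Qed.
Lemma vc_composable x y r : x // y = Some r -> bt x = tp y.
Proof. intros h; apply the_option_spec in h; destruct h; reflexivity. Qed.

Ltac hsplit H := destruct (hc_cases H) as
  [(-> & ->)|(? & ? & ? & ? & ? & ? & ? & ? & ? & ? & ? & ? & ? & ? & ? & ->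
    & ->)].
Ltac vsplit H := destruct (vc_cases H) as
  [(-> & ->)|(? & ? & ? & ? & ? & ? & ? & ? & ? & ? & ? & ? & ? & ? & ? & ->
    & ->)].

Lemma lf_hc x y : rt x = lf y -> lf (x ** y) = lf x.
Proof.
intros h; hsplit h; [rewrite hc_None_l|rewrite <- tot_hcomp]; reflexivity.
Qed.
Lemma rt_hc x y : rt x = lf y -> rt (x ** y) = rt y.
Proof.
intros h; hsplit h; [rewrite hc_None_l|rewrite <- tot_hcomp]; reflexivity.
Qed.
Lemma tp_hc x y : rt x = lf y -> tp (x ** y) = hcH (tp x) (tp y).
Proof.
intros h; hsplit h; [rewrite hc_None_l|rewrite <- tot_hcomp].
- cbn; unfold hcH; destruct (the_option _) eqn:e; [|reflexivity].
  apply the_option_spec in e; dependent destruction e.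
- symmetry; apply hcH_tot.
Qed.
Lemma bt_hc x y : rt x = lf y -> bt (x ** y) = hcH (bt x) (bt y).
Proof.
intros h; hsplit h; [rewrite hc_None_l|rewrite <- tot_hcomp].
- cbn; unfold hcH; destruct (the_option _) eqn:e; [|reflexivity].
  apply the_option_spec in e; dependent destruction e.
- symmetry; apply hcH_tot.
Qed.
Lemma tp_vc x y : bt x = tp y -> tp (x // y) = tp x.
Proof.
intros h; vsplit h; [rewrite vc_None_l|rewrite <- tot_vcomp]; reflexivity.
Qed.
Lemma bt_vc x y : bt x = tp y -> bt (x // y) = bt y.
Proof.
intros h; vsplit h; [rewrite vc_None_l|rewrite <- tot_vcomp]; reflexivity.
Qed.
Lemma lf_vc x y : bt x = tp y -> lf (x // y) = vcV (lf x) (lf y).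
Proof.
intros h; vsplit h; [rewrite vc_None_l|rewrite <- tot_vcomp].
- cbn; unfold vcV; destruct (the_option _) eqn:e; [|reflexivity].
  apply the_option_spec in e; dependent destruction e.
- symmetry; apply vcV_tot.
Qed.
Lemma rt_vc x y : bt x = tp y -> rt (x // y) = vcV (rt x) (rt y).
Proof.
intros h; vsplit h; [rewrite vc_None_l|rewrite <- tot_vcomp].
- cbn; unfold vcV; destruct (the_option _) eqn:e; [|reflexivity].
  apply the_option_spec in e; dependent destruction e.
- symmetry; apply vcV_tot.
Qed.


(** If either side is defined, its composability conditions are those of the typed law; otherwise
    both sides are [None]. *)
Lemma hc_assoc x y z : x ** y ** z = x ** (y ** z).
Proof.
assert (main : rt x = lf y -> rt y = lf z -> x ** y ** z = x ** (y ** z)).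
{ intros h1 h2; hsplit h1; [now rewrite !hc_None_l|].
  destruct z as [[]|]; [|discriminate]; cbn in h2.
  apply Some_inj in h2; dependent destruction h2.
  change (Some (SqT sqT_sq0)) with (tot sqT_sq0).
  rewrite <- !tot_hcomp; apply tot_eq, (sqhcompA L). }
destruct (x ** y ** z) as [r|] eqn:h.
- pose proof (hc_composable h) as h2.
  destruct (x ** y) as [r1|] eqn:h1;
    [|rewrite hc_None_l in h; discriminate].
  pose proof (hc_composable h1) as h3; rewrite <- h1, rt_hc in h2 by exact h3.
  apply main; assumption.
- destruct (x ** (y ** z)) as [r|] eqn:h'; [|reflexivity].
  pose proof (hc_composable h') as h2.
  destruct (y ** z) as [r1|] eqn:h1;
    [|rewrite hc_None_r in h'; discriminate].
  pose proof (hc_composable h1) as h3; rewrite <- h1, lf_hc in h2 by exact h3.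
  apply main; assumption.
Qed.

Lemma vc_assoc x y z : x // y // z = x // (y // z).
Proof.
assert (main : bt x = tp y -> bt y = tp z -> x // y // z = x // (y // z)).
{ intros h1 h2; vsplit h1; [now rewrite !vc_None_l|].
  destruct z as [[]|]; [|discriminate]; cbn in h2.
  apply Some_inj in h2; dependent destruction h2.
  change (Some (SqT sqT_sq0)) with (tot sqT_sq0).
  rewrite <- !tot_vcomp; apply tot_eq, (sqvcompA L). }
destruct (x // y // z) as [r|] eqn:h.
- pose proof (vc_composable h) as h2.
  destruct (x // y) as [r1|] eqn:h1;
    [|rewrite vc_None_l in h; discriminate].
  pose proof (vc_composable h1) as h3; rewrite <- h1, bt_vc in h2 by exact h3.
  apply main; assumption.
- destruct (x // (y // z)) as [r|] eqn:h'; [|reflexivity].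
  pose proof (vc_composable h') as h2.
  destruct (y // z) as [r1|] eqn:h1;
    [|rewrite vc_None_r in h'; discriminate].
  pose proof (vc_composable h1) as h3; rewrite <- h1, tp_vc in h2 by exact h3.
  apply main; assumption.
Qed.

(** Unlike associativity, this law needs its side conditions: equality of the composites [bt p] then
    [bt q] and [tp r] then [tp s] does not give equality of the factors. *)
Lemma hc_vc p q r s : rt p = lf q -> rt r = lf s -> bt p = tp r ->
  bt q = tp s ->
  (p ** q) // (r ** s) = (p // r) ** (q // s).
Proof.
intros h1 h2 h3 h4; hsplit h1; [now rewrite !hc_None_l, !vc_None_l, hc_None_l|].
destruct r as [[]|]; [|discriminate]; cbn in h3.
apply Some_inj in h3; dependent destruction h3.
destruct s as [[]|]; [|discriminate]; cbn in h4, h2.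
apply Some_inj in h4, h2; revert h2; dependent destruction h4; intros h2;
  dependent destruction h2.
repeat match goal with |- context [Some (SqT ?s)] =>
  change (Some (SqT s)) with (tot s) end.
rewrite <- !tot_hcomp, <- !tot_vcomp, <- !tot_hcomp; f_equal.
f_equal; apply (interchange L).
Qed.

Lemma hc_idl A C (u : ver A C) x : lf x = toV u -> tot (sqhid u) ** x = x.
Proof.
destruct x as [[]|]; [|discriminate]; cbn; intros h; apply Some_inj in h.
dependent destruction h.
change (Some (SqT sqT_sq0)) with (tot sqT_sq0).
rewrite <- tot_hcomp; apply tot_eq, (sqhid_l L).
Qed.
Lemma hc_idr A C (u : ver A C) x : rt x = toV u -> x ** tot (sqhid u) = x.
Proof.
destruct x as [[]|]; [|discriminate]; cbn; intros h; apply Some_inj in h.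
dependent destruction h.
change (Some (SqT sqT_sq0)) with (tot sqT_sq0).
rewrite <- tot_hcomp; apply tot_eq, (sqhid_r L).
Qed.
Lemma vc_idl A C (u : hor A C) x : tp x = toH u -> tot (sqvid u) // x = x.
Proof.
destruct x as [[]|]; [|discriminate]; cbn; intros h; apply Some_inj in h.
dependent destruction h.
change (Some (SqT sqT_sq0)) with (tot sqT_sq0).
rewrite <- tot_vcomp; apply tot_eq, (sqvid_l L).
Qed.
Lemma vc_idr A C (u : hor A C) x : bt x = toH u -> x // tot (sqvid u) = x.
Proof.
destruct x as [[]|]; [|discriminate]; cbn; intros h; apply Some_inj in h.
dependent destruction h.
change (Some (SqT sqT_sq0)) with (tot sqT_sq0).
rewrite <- tot_vcomp; apply tot_eq, (sqvid_r L).
Qed.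

Lemma idv_comp A C E (a : hor A C) (c : hor C E) :
  tot (sqvid (a ⨾ c)) = tot (sqvid a) ** tot (sqvid c).
Proof. rewrite <- (sqvid_comp L); apply tot_hcomp. Qed.
Lemma idh_comp A C E (a : ver A C) (c : ver C E) :
  tot (sqhid (a • c)) = tot (sqhid a) // tot (sqhid c).
Proof. rewrite <- (sqhid_comp L); apply tot_vcomp. Qed.
Lemma idh_vid A : tot (sqhid (vid A)) = tot (sqvid (hid A)).
Proof. now rewrite (sqhid_vid L). Qed.
Lemma hc_idvl A x : lf x = toV (vid A) -> tot (sqvid (hid A)) ** x = x.
Proof. rewrite <- idh_vid; apply hc_idl. Qed.
Lemma hc_idvr A x : rt x = toV (vid A) -> x ** tot (sqvid (hid A)) = x.
Proof. rewrite <- idh_vid; apply hc_idr. Qed.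

Section Typed.
Context {A C A' C' : ob D} {u : ver A A'} {a : hor A C} {a' : hor A' C'}
  {w : ver C C'} (s : sq u a a' w).
Lemma lf_tot : lf (tot s) = toV u. Proof. reflexivity. Qed.
Lemma rt_tot : rt (tot s) = toV w. Proof. reflexivity. Qed.
Lemma tp_tot : tp (tot s) = toH a. Proof. reflexivity. Qed.
Lemma bt_tot : bt (tot s) = toH a'. Proof. reflexivity. Qed.
End Typed.

Lemma hcomp_assoc (A B C E : ob D) (a : hor A B) (b : hor B C) (c : hor C E) :
    (a ⨾ b) ⨾ c = a ⨾ (b ⨾ c).
Proof. apply (hcompA L). Qed.
Lemma hcomp_idl (A B : ob D) (a : hor A B) : hid A ⨾ a = a.
Proof. apply (hid_l L). Qed.
Lemma hcomp_idr (A B : ob D) (a : hor A B) : a ⨾ hid B = a.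
Proof. apply (hid_r L). Qed.
Lemma vcomp_assoc (A B C E : ob D) (a : ver A B) (b : ver B C) (c : ver C E) :
    (a • b) • c = a • (b • c).
Proof. apply (vcompA L). Qed.
Lemma vcomp_idl (A B : ob D) (a : ver A B) : vid A • a = a.
Proof. apply (vid_l L). Qed.
Lemma vcomp_idr (A B : ob D) (a : ver A B) : a • vid B = a.
Proof. apply (vid_r L). Qed.
End TotalSquares.

Notation "x ** y" := (hc x y) (at level 40, left associativity).
Notation "x // y" := (vc x y) (at level 41, left associativity).
Notation idv a := (tot (sqvid a)).
Notation idh u := (tot (sqhid u)).

(** The boundary laws for composites have side conditions that are again equations between
    boundaries, whence the recursion. Equations between typed morphisms are left to [bdry_typed]. *)
Ltac bdry :=
  lazymatch goal with |- ?x = ?y =>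
  repeat first
  [ rewrite lf_tot | rewrite rt_tot | rewrite tp_tot | rewrite bt_tot
  | match goal with
    | H : lf ?z = toV _ |- context [lf ?z] => rewrite H
    | H : rt ?z = toV _ |- context [rt ?z] => rewrite H
    | H : tp ?z = toH _ |- context [tp ?z] => rewrite H
    | H : bt ?z = toH _ |- context [bt ?z] => rewrite H
    end
  | rewrite lf_hc by bdry | rewrite rt_hc by bdry
  | rewrite tp_hc by bdry | rewrite bt_hc by bdry
  | rewrite lf_vc by bdry | rewrite rt_vc by bdry
  | rewrite tp_vc by bdry | rewrite bt_vc by bdry ];
  rewrite ?hcH_tot, ?vcV_tot; bdry_typed end
with bdry_typed :=
  first [ reflexivity | assumption |
  repeat first [ rewrite hcomp_idl | rewrite hcomp_idr | rewrite vcomp_idl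
    | rewrite vcomp_idr | rewrite hcomp_assoc | rewrite vcomp_assoc
    | rewrite fhor_comp | rewrite fhor_id | rewrite fver_comp
    | rewrite fver_id];
  first [reflexivity | congruence]].

Section Whiskering.
Context {D : doubleCat}.

Lemma whisker_r (A C : ob D) (c : hor A C) x y : bt x = tp y ->
  rt x = toV (vid A) -> rt y = toV (vid A) ->
  (x // y) ** idv c = (x ** idv c) // (y ** idv c).
Proof. intros; rewrite hc_vc, vc_idl by bdry; reflexivity. Qed.

Lemma whisker_l (A C : ob D) (c : hor A C) x y : bt x = tp y ->
  lf x = toV (vid C) -> lf y = toV (vid C) ->
  idv c ** (x // y) = (idv c ** x) // (idv c ** y).
Proof. intros; rewrite hc_vc, vc_idl by bdry; reflexivity. Qed.

(** Both sides reduce to [x ** y]. *)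
Lemma exchange (A B C : ob D) (a b : hor A B) (c d : hor B C) x y :
  tp x = toH a -> bt x = toH b -> tp y = toH c -> bt y = toH d ->
  rt x = toV (vid B) -> lf y = toV (vid B) ->
  (x ** idv c) // (idv b ** y) = (idv a ** y) // (x ** idv d).
Proof. intros; rewrite !hc_vc, !vc_idl, !vc_idr by bdry; reflexivity. Qed.
End Whiskering.

(** * Squares with the unique factorisation property *)

Section VerticalInverses.
Context {D : doubleCat}.
Local Notation L := (dc_laws D).

(** A vertical inverse may a priori have any vertical boundaries; the inverse laws force
    [vid A • u' = vid A], hence [u' = vid A]. *)
Lemma vinvertibleP (A C : ob D) (a b : hor A C)
    (s : sq (vid A) a b (vid C)) :
  vinvertible s <-> exists t : sq (vid A) b a (vid C),
    tot s // tot t = idv a /\ tot t // tot s = idv b.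
Proof.
split.
- intros (u' & w' & t & h1 & h2).
  destruct (sqeq_bdry h1) as (e1 & _ & _ & e2).
  rewrite (vid_l L) in e1; rewrite (vid_l L) in e2; subst u' w'.
  exists t; rewrite <- !tot_vcomp; split; apply tot_eq; assumption.
- intros (t & h1 & h2); exists (vid A), (vid C), t.
  rewrite <- tot_vcomp in h1, h2; split; apply tot_inj; assumption.
Qed.

Lemma vinvertible_tot (A C A' C' : ob D) (u v : ver A A') (a b : hor A C)
    (a' b' : hor A' C') (w x : ver C C') (s : sq u a a' w) (t : sq v b b' x) :
  tot s = tot t -> vinvertible s -> vinvertible t.
Proof. intros h; apply vinvertible_sqeq, tot_inj, h. Qed.
End VerticalInverses.

(** * Cancellation of weakly horizontally invertible squares *)

Section Whi.
Context {D : doubleCat}.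
Context {A C A' C' : ob D} {u : ver A A'} {a : hor A C} {a' : hor A' C'}
  {w : ver C C'} {s : sq u a a' w}.
Context {c : hor C A} {c' : hor C' A'} {t : sq w c c' u}
    {eta : sq (vid A) (hid A) (a ⨾ c) (vid A)}
    {eta' : sq (vid A') (hid A') (a' ⨾ c') (vid A')}
    {eps : sq (vid C) (c ⨾ a) (hid C) (vid C)}
    {eps' : sq (vid C') (c' ⨾ a') (hid C') (vid C')}.
Context {etai' : sq (vid A') (a' ⨾ c') (hid A') (vid A')}
    {epsi : sq (vid C) (hid C) (c ⨾ a)  (vid C)}
    {epsi' : sq (vid C') (hid C') (c' ⨾ a') (vid C')}.
Hypothesis Heta1' : tot eta' // tot etai' = idv (hid A').
Hypothesis Heps1' : tot eps' // tot epsi' = idv (c' ⨾ a').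
Hypothesis Heps2 : tot epsi // tot eps = idv (hid C).
Hypothesis H1 : tot eta // (tot s ** tot t) = idh u // tot eta'.
Hypothesis H2 : tot eps // idh w = (tot t ** tot s) // tot eps'.

(** By [H1], the square [tot s ** tot t] below [eta] is an identity above [eta'], which [etai'] then
    removes. Hence composition with [s] on the right is injective. *)
Lemma whi_retract X X' (p : ver X X') (f : hor X A) (f' : hor X' A')
    (x : sq p f f' u) :
  tot x = (idv f ** tot eta) // ((tot x ** tot s) ** tot t) // (idv f' ** tot
    etai').
Proof.
rewrite hc_assoc, hc_vc, H1, vc_idl by bdry.
rewrite <- (vc_idr (u := f') (x := tot x)) at 2 by bdry.
rewrite <- hc_vc, hc_idr, vc_assoc, hc_vc by bdry.
rewrite vc_idl, Heta1', hc_idvr, vc_idr by bdry; reflexivity.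
Qed.

(** The mirror image, from [H2]: composition with [s] on the left is injective. *)
Lemma whi_retract_l X X' (p : ver X X') (f : hor C X) (f' : hor C' X')
    (x : sq w f f' p) :
  tot x = (tot epsi ** idv f) // (tot t ** (tot s ** tot x)) // (tot eps' ** idv
    f').
Proof.
rewrite <- hc_assoc, vc_assoc, hc_vc, <- H2, vc_idr by bdry.
rewrite hc_vc by bdry. rewrite <- vc_assoc, Heps2, !vc_idl, hc_idl by bdry;
  reflexivity.
Qed.

(** By [H2], [tot t ** tot s] is an identity conjugated by [eps] and [epsi'], so factoring through
    [t] returns [y] only up to these cells. *)
Lemma whi_section X X' (p : ver X X') (f : hor X C) (f' : hor X' C')
    (y : sq p f f' w) :
  (tot y ** tot t) ** tot s = (idv f ** tot eps) // tot y // (idv f' ** tot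
    epsi').
Proof.
assert (h : tot t ** tot s = tot eps // (idh w // tot epsi')).
{ rewrite <- vc_assoc, H2, vc_assoc, Heps1', vc_idr by bdry; reflexivity. }
rewrite hc_assoc, h.
rewrite <- (vc_idl (u := f) (x := tot y)) at 1 by bdry.
rewrite <- hc_vc by bdry.
rewrite <- (vc_idr (u := f') (x := tot y)) at 1 by bdry.
rewrite <- hc_vc, hc_idr, vc_assoc by bdry; reflexivity.
Qed.
End Whi.

Section Cartesian.
Context {D : doubleCat}.

(** Squares under horizontal composition are the arrows of a category whose objects are the vertical
    morphisms. These are the cartesian arrows for the functor sending a square to its top and
    bottom. *)
Record cartesian {A C A' C' : ob D} {u : ver A A'} {a : hor A C}
    {a' : hor A' C'} {w : ver C C'} (s : sq u a a' w) : Prop := {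
  cartesian_factor : forall X X' (p : ver X X') (f : hor X A) (f' : hor X' A')
    (y : sq p (f ⨾ a) (f' ⨾ a') w), exists! x : sq p f f' u, x ∣ s = y
}.

Lemma cartesian_tot {A C A' C' : ob D} {u : ver A A'} {a : hor A C}
    {a' : hor A' C'} {w : ver C C'}
    {v : ver A A'} {b : hor A C} {b' : hor A' C'} {z : ver C C'}
    (s : sq u a a' w)
    (t : sq v b b' z) : tot s = tot t -> cartesian s -> cartesian t.
Proof. intros h; destruct (tot_inj h); trivial. Qed.

Section Factorisation.
Context {A C A' C' : ob D} {u : ver A A'} {a : hor A C}
    {a' : hor A' C'} {w : ver C C'} (s : sq u a a' w).

Lemma cartesianI :
  (forall X X' (p : ver X X') (f : hor X A) (f' : hor X' A')
    (x y : sq p f f' u), tot x ** tot s = tot y ** tot s -> tot x = tot y) ->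
  (forall X X' (p : ver X X') (f : hor X A) (f' : hor X' A')
    (y : sq p (f ⨾ a) (f' ⨾ a') w), exists x : sq p f f' u,
    tot x ** tot s = tot y) -> cartesian s.
Proof.
intros hi hs; split; intros X X' p f f' y; destruct (hs _ _ _ _ _ y) as [x hx].
exists x; split; [apply sqeq_eq, tot_inj; now rewrite tot_hcomp|].
intros x1 h; apply sqeq_eq, tot_inj, hi; rewrite hx, <- h.
apply tot_hcomp.
Qed.

Hypothesis hs : cartesian s.

Lemma cartesian_inj X X' (p : ver X X') (f : hor X A) (f' : hor X' A')
    (x y : sq p f f' u) : tot x ** tot s = tot y ** tot s -> tot x = tot y.
Proof.
rewrite <- !tot_hcomp; intros h; apply tot_inj, sqeq_eq in h.
destruct (cartesian_factor hs (x ∣ s)) as (z & _ & hz).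
now rewrite <- (hz x eq_refl), <- (hz y (eq_sym h)).
Qed.

Lemma cartesian_ex X X' (p : ver X X') (f : hor X A) (f' : hor X' A') Y :
  lf Y = toV p -> tp Y = toH (f ⨾ a) -> bt Y = toH (f' ⨾ a') -> rt Y = toV w ->
  exists x : sq p f f' u, tot x ** tot s = Y.
Proof.
intros h1 h2 h3 h4; destruct (tot_surj h1 h2 h3 h4) as [y ->].
destruct (cartesian_factor hs y) as (x & hx & _); exists x; now rewrite <- hx,
  tot_hcomp.
Qed.
End Factorisation.

Lemma cartesian_hcomp {A C E A' C' E' : ob D} {u : ver A A'} {a : hor A C}
    {a' : hor A' C'} {v : ver C C'} (s : sq u a a' v)
    {c : hor C E} {c' : hor C' E'} {w : ver E E'} (t : sq v c c' w) :
  cartesian s -> cartesian t -> cartesian (s ∣ t).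
Proof.
intros hs ht; apply cartesianI; intros X X' p f f'.
- intros x y; rewrite tot_hcomp, <- !hc_assoc, <- !tot_hcomp; intros h.
  rewrite !(tot_hcomp _ t) in h.
  apply (cartesian_inj hs); rewrite <- !tot_hcomp; exact (cartesian_inj ht h).
- intros y.
  destruct (cartesian_ex ht (p := p) (f := f ⨾ a) (f' := f' ⨾ a') (Y := tot y))
    as [z hz]; [bdry..|].
  destruct (cartesian_ex hs (p := p) (f := f) (f' := f') (Y := tot z))
    as [x hx]; [bdry..|].
  exists x; now rewrite tot_hcomp, <- hc_assoc, hx.
Qed.

Lemma cartesian_cancel {A C E A' C' E' : ob D} {u : ver A A'} {a : hor A C}
    {a' : hor A' C'} {v : ver C C'} (s : sq u a a' v)
    {c : hor C E} {c' : hor C' E'} {w : ver E E'} (t : sq v c c' w) :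
  cartesian (s ∣ t) -> cartesian t -> cartesian s.
Proof.
intros hs ht; apply cartesianI; intros X X' p f f'.
- intros x y h; apply (cartesian_inj hs); rewrite tot_hcomp, <- !hc_assoc;
    congruence.
- intros y.
  destruct (cartesian_ex hs (p := p) (f := f) (f' := f') (Y := tot y ** tot t))
    as [x hx]; [bdry..|].
  exists x; rewrite <- tot_hcomp; apply (cartesian_inj ht).
  now rewrite <- hx, !tot_hcomp, hc_assoc.
Qed.

(** Composition with [s'] is composition with [s] followed by an invertible conjugation. This moves
    a cartesian square to an isomorphic top and bottom. *)
Lemma cartesian_conj {A C A' C' : ob D} {u : ver A A'} {a b : hor A C}
    {a' b' : hor A' C'} {w : ver C C'} (s : sq u a a' w) (s' : sq u b b' w)
    (i : sq (vid A) b a (vid C)) (j : sq (vid A') a' b' (vid C')) :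
  vinvertible i -> vinvertible j -> tot s' = tot i // tot s // tot j ->
  cartesian s -> cartesian s'.
Proof.
intros [i' [h1 h2]]%vinvertibleP [j' [h3 h4]]%vinvertibleP e hs.
assert (hx : forall X X' (p : ver X X') (f : hor X A) (f' : hor X' A')
  (x : sq p f f' u), tot x ** tot s' =
  (idv f ** tot i) // (tot x ** tot s) // (idv f' ** tot j)).
{ intros; rewrite e, hc_vc, hc_vc, vc_idl, vc_idr by bdry; reflexivity. }
apply cartesianI; intros X X' p f f'.
- intros x y; rewrite !hx; intros h; apply (cartesian_inj hs).
  apply (f_equal (fun z => (idv f ** tot i') // z // (idv f' ** tot j'))) in h.
  assert (k : forall x : sq p f f' u, (idv f ** tot i') // ((idv f ** tot i) //
    (tot x ** tot s) // (idv f' ** tot j)) // (idv f' ** tot j') = tot x ** tot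
      s).
  { intros z; rewrite !vc_assoc, (hc_vc (p := idv f') (q := tot j)) by bdry.
    rewrite h3, vc_idl, <- idv_comp, vc_idr, <- vc_assoc, hc_vc, h2,
      vc_idl by bdry.
    rewrite <- idv_comp, vc_idl by bdry; reflexivity. }
  rewrite !k in h; exact h.
- intros y.
  destruct (cartesian_ex hs (p := p) (f := f) (f' := f')
    (Y := (idv f ** tot i') // tot y // (idv f' ** tot j'))) as [x hx'];
      [bdry..|].
  exists x; rewrite hx, hx', !vc_assoc, hc_vc, h4, <- !vc_assoc, hc_vc, h1,
    !vc_idl by bdry.
  rewrite <- !idv_comp, !vc_idl, !vc_idr by bdry; reflexivity.
Qed.

Lemma weakly_hinvertible_cartesian {A C A' C' : ob D} {u : ver A A'} {a : hor A
  C}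
    {a' : hor A' C'} {w : ver C C'} (s : sq u a a' w) :
  weakly_hinvertible s -> cartesian s.
Proof.
intros (c & c' & t & eta & eta' & eps & eps' & [etai [e1 e2]]%vinvertibleP &
  [etai' [e1' e2']]%vinvertibleP & [epsi [f1 f2]]%vinvertibleP &
  [epsi' [f1' f2']]%vinvertibleP & h1 & h2).
apply tot_eq in h1, h2; rewrite !tot_vcomp, !tot_hcomp in h1, h2.
assert (ret := fun X X' p f f' => @whi_retract D _ _ _ _ _ _ _ _ s _ _ t eta
  eta'
  etai' e1' h1 X X' p f f').
assert (sec := fun X X' p f f' => @whi_section D _ _ _ _ _ _ _ _ s _ _ t
  eps eps' epsi' f1' h2 X X' p f f').
apply cartesianI; intros X X' p f f'.
- intros x y h; now rewrite (ret _ _ _ _ _ x), (ret _ _ _ _ _ y), h.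
- intros y.
  (* Without the triangle identities, factoring through [t] is a section only
     up to automorphisms of [a] and [a'], so [y] is corrected by these first. *)
  set (y' := (idv f ** ((idv a ** tot epsi) // (tot etai ** idv a))) // tot y //
    (idv f' ** ((tot eta' ** idv a') // (idv a' ** tot eps')))).
  destruct (@tot_surj D _ _ _ _ p (f ⨾ a) (f' ⨾ a') w y') as [z hz];
    [subst y'; bdry..|].
  (* The candidate has the shape dictated by [whi_retract]. Its composite with [s] is [z] conjugated
     by the two cells that measure the failure of the triangle identities; the inverses of these
     cells are built into [y'], as [hl] and [hr] verify. *)
  destruct (@tot_surj D _ _ _ _ p f f' u
    ((idv f ** tot eta) // (tot z ** tot t) // (idv f' ** tot etai')))
    as [x hx]; [bdry..|].
  exists x; rewrite <- hx.
  rewrite <- (vc_idl (u := a) (x := tot s)) at 1 by bdry.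
  rewrite <- (vc_idr (u := a') (x := tot s)) at 1 by bdry.
  rewrite <- vc_assoc, <- hc_vc, <- hc_vc, sec, <- hz by bdry.
  subst y'.
  assert (hl : (tot eta ** idv a) // ((idv a ** tot eps) //
    ((idv a ** tot epsi) // (tot etai ** idv a))) = idv a).
  { rewrite <- (vc_assoc (idv a ** tot eps)), (hc_vc (p := idv a) (r :=
      idv a)) by bdry.
    rewrite f1, vc_idl, <- idv_comp, vc_idl, hc_vc, e1, vc_idl,
      hc_idvl by bdry; reflexivity. }
  assert (hr : (tot eta' ** idv a') // ((idv a' ** tot eps') //
    ((idv a' ** tot epsi') // (tot etai' ** idv a'))) = idv a').
  { rewrite <- (vc_assoc (idv a' ** tot eps')), (hc_vc (p := idv a') (r :=
      idv a')) by bdry.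
    rewrite f1', vc_idl, <- idv_comp, vc_idl, hc_vc, e1', vc_idl,
      hc_idvl by bdry; reflexivity. }
  rewrite !idv_comp, !hc_assoc, !vc_assoc.
  rewrite <- (vc_assoc (idv f ** (idv a ** tot eps))), (hc_vc (p :=
    idv f) (r := idv f)), vc_idl by bdry.
  rewrite <- (vc_assoc (idv f ** (tot eta ** idv a))), (hc_vc (p :=
    idv f) (r := idv f)), vc_idl by bdry.
  rewrite hl, <- idv_comp, vc_idl by bdry.
  rewrite (hc_vc (p := idv f') (r := idv f') (q := idv a' ** tot epsi')),
    vc_idl by bdry.
  rewrite (hc_vc (p := idv f') (r := idv f')), vc_idl by bdry.
  rewrite vc_assoc, hr, <- idv_comp, vc_idr by bdry; reflexivity.
Qed.
End Cartesian.

(** * Horizontal equivalences *)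

Section Equivalences.
Context {D : doubleCat}.

(** Factorisation through [sqvid e] says that whiskering with [e] is bijective on squares with
    trivial right boundary, so facts about cells become instances of facts about cartesian
    squares. *)
Lemma sqvid_cartesian (A C : ob D) (e : hor A C) :
  horizontal_equivalence e -> cartesian (sqvid e).
Proof.
intros (c & eta & eps & h1 & h2); apply weakly_hinvertible_cartesian.
exists c, c, (sqvid c), eta, eta, eps, eps.
split; [exact h1|split; [exact h1|split; [exact h2|split; [exact h2|]]]].
split; apply tot_inj; rewrite !tot_vcomp, !tot_hcomp, idh_vid, <- idv_comp.
- rewrite vc_idl, vc_idr by bdry; reflexivity.
- rewrite vc_idl, vc_idr by bdry; reflexivity.
Qed.

Lemma vinvertible_reflect (A B C : ob D) (e : hor B C) (f f' : hor A B)
    (s : sq (vid A) f f' (vid B)) :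
  cartesian (sqvid e) -> vinvertible (s ∣ sqvid e) -> vinvertible s.
Proof.
intros he [y [h1 h2]]%vinvertibleP; apply vinvertibleP.
rewrite tot_hcomp in h1, h2.
destruct (cartesian_ex he (p := vid A) (f := f') (f' := f) (Y := tot y))
  as [x hx]; [bdry..|].
exists x; rewrite <- hx in h1, h2; rewrite hc_vc, vc_idl in h1, h2 by bdry.
destruct (@tot_surj D _ _ _ _ (vid A) f f (vid B) (tot s // tot x))
  as [z1 hz1]; [bdry..|].
destruct (@tot_surj D _ _ _ _ (vid A) f' f' (vid B) (tot x // tot s))
  as [z2 hz2]; [bdry..|].
rewrite hz1, hz2 in *.
split; apply (cartesian_inj he); rewrite <- idv_comp; assumption.
Qed.

(** An adjoint equivalence, of which only one triangle identity is needed. *)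
Record half_adjoint (A C : ob D) (a : hor A C) (c : hor C A) := {
  ha_eta : sq (vid A) (hid A) (a ⨾ c) (vid A);
  ha_etai : sq (vid A) (a ⨾ c) (hid A) (vid A);
  ha_eps : sq (vid C) (c ⨾ a) (hid C) (vid C);
  ha_epsi : sq (vid C) (hid C) (c ⨾ a) (vid C);
  ha_1 : tot ha_eta // tot ha_etai = idv (hid A);
  ha_2 : tot ha_etai // tot ha_eta = idv (a ⨾ c);
  ha_3 : tot ha_eps // tot ha_epsi = idv (c ⨾ a);
  ha_4 : tot ha_epsi // tot ha_eps = idv (hid C);
  ha_triangle : (tot ha_eta ** idv a) // (idv a ** tot ha_eps) = idv a
}.

(** The triangle identity is solved for the unit: it says that [tot eta ** idv a] equals
    [idv a ** tot epsi], and [eta] is the factor of the latter through [sqvid a]. The given [eps] is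
    kept. *)
Lemma half_adjoint_ex (A C : ob D) (a : hor A C) :
  cartesian (sqvid a) -> forall (c : hor C A)
  (eps : sq (vid C) (c ⨾ a) (hid C) (vid C)), vinvertible eps ->
  exists h : half_adjoint a c, ha_eps h = eps.
Proof.
intros ha c eps [epsi [h3 h4]]%vinvertibleP.
destruct (cartesian_ex ha (p := vid A) (f := hid A) (f' := a ⨾ c)
  (Y := idv a ** tot epsi)) as [eta he]; [bdry..|].
destruct (cartesian_ex ha (p := vid A) (f' := hid A) (f := a ⨾ c)
  (Y := idv a ** tot eps)) as [etai hei]; [bdry..|].
assert (h1 : tot eta // tot etai = idv (hid A)).
{ destruct (@tot_surj D _ _ _ _ (vid A) (hid A) (hid A) (vid A)
    (tot eta // tot etai)) as [z hz]; [bdry..|].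
  rewrite hz; apply (cartesian_inj ha); rewrite <- hz.
  rewrite <- (vc_idl (u := a) (x := idv a)) at 1 by bdry.
  rewrite <- hc_vc, he, hei, hc_vc, h4, vc_idl, hc_idvl, hc_idvr by bdry;
    reflexivity. }
assert (h2 : tot etai // tot eta = idv (a ⨾ c)).
{ destruct (@tot_surj D _ _ _ _ (vid A) (a ⨾ c) (a ⨾ c) (vid A)
    (tot etai // tot eta)) as [z hz]; [bdry..|].
  rewrite hz; apply (cartesian_inj ha); rewrite <- hz.
  rewrite <- (vc_idl (u := a) (x := idv a)) at 1 by bdry.
  rewrite <- hc_vc, he, hei, hc_vc, h3, vc_idl, <- !idv_comp,
    hcomp_assoc by bdry.
  reflexivity. }
unshelve eexists {| ha_1 := h1; ha_2 := h2; ha_3 := h3; ha_4 := h4 |}.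
- rewrite he, hc_vc, h4, vc_idl, hc_idvr by bdry; reflexivity.
- reflexivity.
Qed.

Lemma ha_vinv_eta (A C : ob D) (a : hor A C) (c : hor C A)
  (h : half_adjoint a c) : vinvertible (ha_eta h).
Proof. apply vinvertibleP; exists (ha_etai h); split; apply h. Qed.
Lemma ha_vinv_eps (A C : ob D) (a : hor A C) (c : hor C A)
  (h : half_adjoint a c) : vinvertible (ha_eps h).
Proof. apply vinvertibleP; exists (ha_epsi h); split; apply h. Qed.

(** The second equation prescribes [tot t ** tot l], and [t] is the corresponding factor through
    [l]. The first equation is then checked after composing with [l], by the triangle identities. *)
Lemma cartesian_inverse (A C A' C' : ob D) (u : ver A A') (a : hor A C)
    (a' : hor A' C') (w : ver C C') (l : sq u a a' w) c c'
    (h : half_adjoint a c) (h' : half_adjoint a' c') :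
  cartesian l -> exists t : sq w c c' u,
    tot (ha_eta h) // (tot l ** tot t) = idh u // tot (ha_eta h') /\
    tot (ha_eps h) // idh w = (tot t ** tot l) // tot (ha_eps h').
Proof.
intros hl.
destruct (cartesian_ex hl (p := w) (f := c) (f' := c')
  (Y := tot (ha_eps h) // idh w // tot (ha_epsi h'))) as [t ht]; [bdry..|].
exists t; split; [|rewrite ht, vc_assoc, ha_4, vc_idr by bdry; reflexivity].
(* Both sides are inverse to [tot (ha_eta h) ** idv a], the right one by the triangle identity. *)
assert (tr : forall A C (a : hor A C) c (h : half_adjoint a c),
  tot (ha_etai h) ** idv a = idv a ** tot (ha_eps h)).
{ clear; intros A C a c h.
  transitivity ((tot (ha_etai h) ** idv a) //
    ((tot (ha_eta h) ** idv a) // (idv a ** tot (ha_eps h)))).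
  - rewrite ha_triangle, vc_idr by bdry; reflexivity.
  - rewrite <- vc_assoc, hc_vc, ha_2, vc_idl, <- idv_comp, vc_idl by bdry;
      reflexivity. }
assert (tr' : tot (ha_eta h') ** idv a' = idv a' ** tot (ha_epsi h')).
{ transitivity ((tot (ha_eta h') ** idv a') //
    ((idv a' ** tot (ha_eps h')) // (idv a' ** tot (ha_epsi h')))).
  - rewrite hc_vc, ha_3, vc_idl, <- idv_comp, vc_idr by bdry; reflexivity.
  - rewrite <- vc_assoc, ha_triangle, vc_idl by bdry; reflexivity. }
assert (k : tot l ** tot t = tot (ha_etai h) // idh u // tot (ha_eta h')).
{ destruct (@tot_surj D _ _ _ _ u (a ⨾ c) (a' ⨾ c') u (tot l ** tot t))
    as [z hz]; [bdry..|].
  destruct (@tot_surj D _ _ _ _ u (a ⨾ c) (a' ⨾ c') u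
    (tot (ha_etai h) // idh u // tot (ha_eta h'))) as [z' hz']; [bdry..|].
  rewrite hz, hz'; apply (cartesian_inj hl); rewrite <- hz, <- hz', hc_assoc,
    ht.
  transitivity ((idv a ** tot (ha_eps h)) // tot l // (idv a' ** tot (ha_epsi
    h'))).
  - rewrite <- (hc_idr (u := w) (x := tot l)) at 2 by bdry.
    rewrite hc_vc, hc_vc, vc_idl, vc_idr by bdry; reflexivity.
  - rewrite <- tr, <- tr', <- (hc_idl (u := u) (x := tot l)) at 1 by bdry.
    rewrite hc_vc, hc_vc, vc_idl, vc_idr by bdry; reflexivity. }
rewrite k, <- !vc_assoc, ha_1, vc_idl by bdry; reflexivity.
Qed.

Lemma cartesian_whi (A C A' C' : ob D) (u : ver A A') (a : hor A C)
    (a' : hor A' C') (w : ver C C') (l : sq u a a' w) c c'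
    (h : half_adjoint a c) (h' : half_adjoint a' c') (t : sq w c c' u) :
    tot (ha_eta h) // (tot l ** tot t) = idh u // tot (ha_eta h') ->
    tot (ha_eps h) // idh w = (tot t ** tot l) // tot (ha_eps h') ->
      cartesian l.
Proof.
intros h1 h2; apply weakly_hinvertible_cartesian.
exists c, c', t, (ha_eta h), (ha_eta h'), (ha_eps h), (ha_eps h').
split; [apply ha_vinv_eta|]; split; [apply ha_vinv_eta|].
split; [apply ha_vinv_eps|]; split; [apply ha_vinv_eps|].
split; apply tot_inj; now rewrite !tot_vcomp, !tot_hcomp.
Qed.

Lemma equivalence_half_adjoint (A C : ob D) (a : hor A C) :
  horizontal_equivalence a -> exists c, inhabited (half_adjoint a c).
Proof.
intros ha; pose proof (sqvid_cartesian ha) as hr.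
destruct ha as (c & _ & eps & _ & he).
destruct (half_adjoint_ex hr he) as [h _].
exists c; exact (inhabits h).
Qed.

(** Unique factorisation does not obviously compose vertically; inverses
    relative to fixed adjoint equivalences do. *)
Lemma cartesian_vcomp (A C A' C' A'' C'' : ob D)
    (a : hor A C) (a' : hor A' C') (a'' : hor A'' C'')
    (u : ver A A') (w : ver C C') (u' : ver A' A'') (w' : ver C' C'')
    (l : sq u a a' w) (l' : sq u' a' a'' w') :
  horizontal_equivalence a -> horizontal_equivalence a' ->
  horizontal_equivalence a'' -> cartesian l -> cartesian l' ->
    cartesian (l / l').
Proof.
intros [c [h]]%equivalence_half_adjoint [c' [h']]%equivalence_half_adjoint.
intros [c'' [h'']]%equivalence_half_adjoint hl hl'.
destruct (cartesian_inverse h h' hl) as (t & h1 & h2).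
destruct (cartesian_inverse h' h'' hl') as (t' & h3 & h4).
apply (cartesian_whi (h := h) (h' := h'') (t := t / t'));
  rewrite !tot_vcomp, idh_comp.
- rewrite <- hc_vc, <- vc_assoc, h1, vc_assoc, h3, vc_assoc by bdry;
    reflexivity.
- rewrite <- hc_vc, vc_assoc, <- h4, <- vc_assoc, h2, vc_assoc by bdry;
    reflexivity.
Qed.

Lemma horizontal_equivalence_sym (A C : ob D) (a : hor A C) :
  horizontal_equivalence a -> exists c, horizontal_equivalence (c : hor C A).
Proof.
intros (c & eta & eps & [eta' [h1 h2]]%vinvertibleP &
  [eps' [h3 h4]]%vinvertibleP).
exists c, a, eps', eta'; split; apply vinvertibleP.
- exists eps; tauto.
- exists eta; tauto.
Qed.
End Equivalences.

(** * Horizontal morphisms up to invertible cells *)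

Section IsoClasses.
Context {D : doubleCat}.
Local Notation L := (dc_laws D).

(** Serves where only the existence of invertible cells matters: modulo [iso], horizontal
    equivalences are the invertible morphisms, and setoid rewriting replaces pasting. *)
Definition iso {A C : ob D} (a b : hor A C) : Prop :=
  exists s : sq (vid A) a b (vid C), vinvertible s.

#[global] Instance iso_equiv A C : Equivalence (@iso A C).
Proof.
split.
- intros a; exists (sqvid a); apply (vinvertible_sqvid L).
- intros a b (s & [t [h1 h2]]%vinvertibleP).
  exists t; apply vinvertibleP; exists s; tauto.
- intros a b c (s & [t [h1 h2]]%vinvertibleP) (s' & [t' [h1'
    h2']]%vinvertibleP).
  destruct (@tot_surj D _ _ _ _ (vid A) a c (vid C) (tot s // tot s'))
    as [z hz]; [bdry..|].
  destruct (@tot_surj D _ _ _ _ (vid A) c a (vid C) (tot t' // tot t))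
    as [z' hz']; [bdry..|].
  exists z; apply vinvertibleP; exists z'; rewrite <- hz, <- hz', !vc_assoc.
  rewrite <- (vc_assoc (tot s')), h1', <- (vc_assoc (tot t)), h2,
    !vc_idl by bdry; tauto.
Qed.

#[global] Instance hcomp_iso A B C :
  Proper (@iso A B ==> @iso B C ==> @iso A C) (@hcomp D A B C).
Proof.
intros a b (s & hs) c d (t & ht); exists (s ∣ t).
now apply (vinvertible_hcomp L).
Qed.

Lemma equivalence_iso (A C : ob D) (a : hor A C) :
  horizontal_equivalence a <->
  exists c, iso (a ⨾ c) (hid A) /\ iso (c ⨾ a) (hid C).
Proof.
split.
- intros (c & eta & eps & h1 & h2); exists c; split.
  + symmetry; exists eta; exact h1.
  + exists eps; exact h2.
- intros (c & h1 & (eps & h2)); symmetry in h1; destruct h1 as (eta & h1).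
  exists c, eta, eps; tauto.
Qed.

Lemma equivalence_cancel_l (A B C : ob D) (e : hor A B) (b b' : hor B C) :
  horizontal_equivalence e -> iso (e ⨾ b) (e ⨾ b') -> iso b b'.
Proof.
intros (c & _ & h)%equivalence_iso k.
rewrite <- (hcomp_idl b), <- (hcomp_idl b'), <- h, !hcomp_assoc, k; reflexivity.
Qed.

Lemma equivalence_of_iso (A C : ob D) (a b : hor A C) :
  iso a b -> horizontal_equivalence a -> horizontal_equivalence b.
Proof.
intros h (c & h1 & h2)%equivalence_iso; apply equivalence_iso; exists c.
now rewrite <- h.
Qed.

Lemma equivalence_comp (A B C : ob D) (a : hor A B) (b : hor B C) :
  horizontal_equivalence a -> horizontal_equivalence b ->
  horizontal_equivalence (a ⨾ b).
Proof.
intros (c & h1 & h2)%equivalence_iso (d & h3 & h4)%equivalence_iso.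
apply equivalence_iso; exists (d ⨾ c).
rewrite hcomp_assoc, <- (hcomp_assoc b), h3, hcomp_idl, h1.
rewrite hcomp_assoc, <- (hcomp_assoc c), h2, hcomp_idl, h4; split; reflexivity.
Qed.
End IsoClasses.

(** * Strict functors and squares *)

Section InvertibleCells.
Context {D : doubleCat}.
Local Notation L := (dc_laws D).

(** The boundary is a parameter separate from the total square, so that it can be replaced by an
    equal one without transport, as in [invertible_cell_eq]. *)
Definition invertible_cell {A C : ob D} (a b : hor A C)
    (T : option sqT) : Prop :=
  exists s : sq (vid A) a b (vid C), vinvertible s /\ tot s = T.

Lemma invertible_cell_tot (A C : ob D) (a b : hor A C) (s : sq (vid A) a b (vid
  C)) :
  vinvertible s -> invertible_cell a b (tot s).
Proof. intros h; exists s; split; trivial. Qed.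

Lemma invertible_cell_idv (A C : ob D) (a : hor A C) : invertible_cell a a (idv
  a).
Proof. apply invertible_cell_tot, (vinvertible_sqvid L). Qed.

Lemma invertible_cell_h (A B C : ob D) (a b : hor A B) (c d : hor B C) S T :
  invertible_cell a b S -> invertible_cell c d T ->
    invertible_cell (a ⨾ c) (b ⨾ d) (S ** T).
Proof.
intros (s & hs & <-) (t & ht & <-); exists (s ∣ t).
split; [now apply (vinvertible_hcomp L)|apply tot_hcomp].
Qed.

Lemma invertible_cell_v (A C : ob D) (a b b' c : hor A C) S T :
  invertible_cell a b S -> invertible_cell b' c T -> b = b' ->
    invertible_cell a c (S // T).
Proof.
intros (s & hs & <-) (t & ht & <-) <-.
apply vinvertibleP in hs as (s' & h1 & h2), ht as (t' & h3 & h4).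
destruct (@tot_surj D _ _ _ _ (vid A) a c (vid C) (tot s // tot t))
  as [z hz]; [bdry..|].
destruct (@tot_surj D _ _ _ _ (vid A) c a (vid C) (tot t' // tot s'))
  as [z' hz']; [bdry..|].
rewrite hz; apply invertible_cell_tot, vinvertibleP; exists z'.
rewrite <- hz, <- hz', !vc_assoc, <- (vc_assoc (tot t)), h3, vc_idl by bdry.
rewrite h1, <- (vc_assoc (tot s')), h2, vc_idl by bdry; tauto.
Qed.

Lemma invertible_cell_eq (A C : ob D) (a b a1 b1 : hor A C) T :
  invertible_cell a b T -> a = a1 -> b = b1 -> invertible_cell a1 b1 T.
Proof. intros h <- <-; exact h. Qed.

Lemma invertible_cell_boundary (A C : ob D) (a b : hor A C) T :
  invertible_cell a b T ->
  (tp T = toH a /\ bt T = toH b) /\ (lf T = toV (vid A) /\ rt T = toV (vid C)).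
Proof. intros (s & _ & <-); repeat split; bdry. Qed.

Lemma invertible_cell_inv (A C : ob D) (a b : hor A C) T :
  invertible_cell a b T ->
  exists T', invertible_cell b a T' /\ T // T' = idv a /\ T' // T = idv b.
Proof.
intros (s & [t [h1 h2]]%vinvertibleP & <-); exists (tot t).
split; [apply invertible_cell_tot, vinvertibleP; exists s|]; tauto.
Qed.

Lemma invertible_cell_cancel (A C : ob D) (a b : hor A C) T x y :
  invertible_cell a b T ->
  tp x = toH b -> tp y = toH b -> T // x = T // y -> x = y.
Proof.
intros (T' & _ & _ & h2)%invertible_cell_inv hx hy e.
apply (f_equal (fun z => T' // z)) in e.
rewrite <- !vc_assoc, h2, !vc_idl in e by bdry; exact e.
Qed.
End InvertibleCells.

(** * Lifting and comparing squares along a functor *)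

Section FunctorTot.
Context {D E : doubleCat} (F : doubleFunctor D E).

Lemma tot_fsq {A C A' C' : ob D}
    {u : ver A A'} {a : hor A C} {a' : hor A' C'} {w : ver C C'}
    {v : ver A A'} {b : hor A C} {b' : hor A' C'} {x : ver C C'}
    (s : sq u a a' w) (t : sq v b b' x) :
  tot s = tot t -> tot (fsq F s) = tot (fsq F t).
Proof. intros h; now destruct (tot_inj h). Qed.

Lemma tot_fsq_hcomp A B C A' B' C' (u : ver A A') (v : ver B B')
    (w : ver C C') (a : hor A B) (a' : hor A' B') (c : hor B C)
    (c' : hor B' C') (s : sq u a a' v) (t : sq v c c' w) :
  tot (fsq F (s ∣ t)) = tot (fsq F s) ** tot (fsq F t).
Proof. rewrite <- tot_hcomp; apply tot_eq, fsq_hcomp. Qed.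
Lemma tot_fsq_vcomp A C A' C' A'' C'' (a : hor A C) (a' : hor A' C')
    (a'' : hor A'' C'') (u : ver A A') (w : ver C C')
    (u' : ver A' A'') (w' : ver C' C'')
    (s : sq u a a' w) (t : sq u' a' a'' w') :
  tot (fsq F (s / t)) = tot (fsq F s) // tot (fsq F t).
Proof. rewrite <- tot_vcomp; apply tot_eq, fsq_vcomp. Qed.
Lemma tot_fsq_I A C (a : hor A C) : tot (fsq F (sqvid a)) = idv (fhor F a).
Proof. apply tot_eq, fsq_vid. Qed.
Lemma tot_fsq_J A C (a : ver A C) : tot (fsq F (sqhid a)) = idh (fver F a).
Proof. apply tot_eq, fsq_hid. Qed.
Lemma tot_fsq_cast A C A' C' (u v : ver A A') (a b : hor A C)
    (a' b' : hor A' C') (w x : ver C C')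
    (eu : u = v) (ea : a = b) (ea' : a' = b') (ew : w = x) (s : sq u a a' w) :
  tot (fsq F (sqcast eu ea ea' ew s)) = tot (fsq F s).
Proof. apply tot_fsq, tot_cast. Qed.
Lemma tot_fsq_vcompE A C A' C' A'' C''
    (a : hor A C) (b b' : hor A' C') (c : hor A'' C'')
    (u : ver A A') (w : ver C C') (u' : ver A' A'') (w' : ver C' C'')
    (s : sq u a b w) (e : b = b') (t : sq u' b' c w') :
  tot (fsq F (s /[e] t)) = tot (fsq F s) // tot (fsq F t).
Proof. unfold sqvcompE; rewrite tot_fsq_vcomp, tot_fsq_cast; reflexivity. Qed.

Lemma fhor_iso A C (a b : hor A C) : iso a b -> iso (fhor F a) (fhor F b).
Proof.
intros (s & h); apply (vinvertible_fsq F) in h.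
exists (sqcast (fver_id F A) eq_refl eq_refl (fver_id F C) (fsq F s)).
eapply vinvertible_tot; [symmetry; apply tot_cast|exact h].
Qed.

Lemma fsq_invertible_cell A C (a b : hor A C) (s : sq (vid A) a b (vid C)) :
  vinvertible s -> invertible_cell (fhor F a) (fhor F b) (tot (fsq F s)).
Proof.
intros h; apply (vinvertible_fsq F) in h.
exists (sqcast (fver_id F A) eq_refl eq_refl (fver_id F C) (fsq F s)).
split; [|apply tot_cast].
eapply vinvertible_tot; [symmetry; apply tot_cast|exact h].
Qed.

(** A functor preserves equations rather than unique factorisations, so the image of the weak
    inverse is used. *)
Lemma cartesian_fsq A C A' C' (u : ver A A') (a : hor A C) (a' : hor A' C')
    (w : ver C C') (s : sq u a a' w) :
  weakly_hinvertible s -> cartesian (fsq F s).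
Proof.
intros (c & c' & t & eta & eta' & eps & eps' & i1 & i2 & i3 & i4 & h1 & h2).
apply tot_eq, tot_fsq in h1, h2.
rewrite !tot_fsq_vcomp, tot_fsq_hcomp, tot_fsq_J in h1, h2.
apply fsq_invertible_cell in i1, i2, i3, i4.
apply (fun h => invertible_cell_eq h (fhor_id F _) (fhor_comp F _ _)) in i1, i2.
apply (fun h => invertible_cell_eq h (fhor_comp F _ _) (fhor_id F _)) in i3, i4.
destruct i1 as (eta1 & i1 & e1), i2 as (eta2 & i2 & e2),
  i3 as (eps1 & i3 & e3), i4 as (eps2 & i4 & e4).
rewrite <- e1, <- e2 in h1; rewrite <- e3, <- e4 in h2.
apply weakly_hinvertible_cartesian.
exists (fhor F c), (fhor F c'), (fsq F t), eta1, eta2, eps1, eps2.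
repeat (split; [assumption|]).
split; apply tot_inj; rewrite !tot_vcomp, tot_hcomp; assumption.
Qed.

Definition fully_faithful_on_squares : Prop :=
  forall A C A' C' (u : ver A A') (a : hor A C) (a' : hor A' C')
    (w : ver C C') (t : sq (fver F u) (fhor F a) (fhor F a') (fver F w)),
    exists! s : sq u a a' w, fsq F s = t.

Hypothesis ff : fully_faithful_on_squares.

Lemma ff_inj A C A' C' (u v : ver A A') (a b : hor A C) (a' b' : hor A' C')
    (w x : ver C C') (s : sq u a a' w) (t : sq v b b' x) :
  u = v -> a = b -> a' = b' -> w = x ->
  tot (fsq F s) = tot (fsq F t) -> tot s = tot t.
Proof.
intros <- <- <- <- h; apply tot_inj, sqeq_eq in h.
destruct (ff (fsq F s)) as (z & _ & hz).
now rewrite <- (hz s eq_refl), <- (hz t (eq_sym h)).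
Qed.

Lemma ff_ex A C A' C' (u : ver A A') (a : hor A C) (a' : hor A' C')
    (w : ver C C') Y : lf Y = toV (fver F u) -> tp Y = toH (fhor F a) ->
  bt Y = toH (fhor F a') -> rt Y = toV (fver F w) ->
  exists s : sq u a a' w, tot (fsq F s) = Y.
Proof.
intros h1 h2 h3 h4; destruct (tot_surj h1 h2 h3 h4) as [y ->].
destruct (ff y) as (s & hs & _); exists s; now rewrite hs.
Qed.

(** Factorisation through [r], then full faithfulness of [F]. The left boundary [r0] is a variable
    because it is often only provably in the image of [F]: for [r] an identity square it is
    [vid (F C)], not [fver F (vid C)]. *)
Lemma lift_ex A C A' C' (u : ver A A') (k : hor A C) (k' : hor A' C')
    (w : ver C C') X X' (c : hor (F C) X) (c' : hor (F C') X') (v : ver X X')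
    (r0 : ver (F C) (F C')) (r : sq r0 c c' v) Y :
  cartesian r -> r0 = fver F w ->
  lf Y = toV (fver F u) -> tp Y = toH (fhor F k ⨾ c) ->
  bt Y = toH (fhor F k' ⨾ c') -> rt Y = toV v ->
  exists x : sq u k k' w, tot (fsq F x) ** tot r = Y.
Proof.
intros hr -> h1 h2 h3 h4; destruct (cartesian_ex hr h1 h2 h3 h4) as [y hy].
destruct (ff y) as (s & hs & _); exists s; now rewrite hs.
Qed.

Lemma lift_inj A C A' C' (u u1 : ver A A') (k k1 : hor A C)
    (k' k1' : hor A' C')
    (w w1 : ver C C') X X' (c : hor (F C) X) (c' : hor (F C') X') (v : ver X X')
    (r0 : ver (F C) (F C')) (r : sq r0 c c' v) (x : sq u k k' w)
    (y : sq u1 k1 k1' w1) : cartesian r -> r0 = fver F w ->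
  u = u1 -> k = k1 -> k' = k1' -> w = w1 ->
  tot (fsq F x) ** tot r = tot (fsq F y) ** tot r -> tot x = tot y.
Proof.
intros hr -> <- <- <- <- h; apply (cartesian_inj hr) in h.
now apply ff_inj in h.
Qed.

(** The test used for the coherence laws: compare images after pasting [r] on the right and an
    invertible cell on top; [between_inj] also allows one at the bottom. *)
Lemma over_inj P Q P' Q' (Z : ob E) (Z' : ob E) (u u1 : ver P P')
    (k k1 : hor P Q) (k' k1' : hor P' Q') (w w1 : ver Q Q') (c : hor (F Q) Z)
    (c' : hor (F Q') Z') (v : ver Z Z') (r0 : ver (F Q) (F Q'))
    (r : sq r0 c c' v) d t (x : sq u k k' w) (y : sq u1 k1 k1' w1) :
  cartesian r -> invertible_cell d (fhor F k ⨾ c) t -> r0 = fver F w ->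
  u = u1 -> k = k1 -> k' = k1' -> w = w1 ->
  t // (tot (fsq F x) ** tot r) = t // (tot (fsq F y) ** tot r) -> x ≈ y.
Proof.
intros hr ht h0 h1 h2 h3 h4 h; apply tot_inj.
apply (lift_inj hr); trivial.
apply (invertible_cell_cancel ht) in h; trivial; subst; bdry.
Qed.

Lemma between_inj P Q P' Q' (Z : ob E) (Z' : ob E) (u u1 : ver P P')
    (k k1 : hor P Q) (k' k1' : hor P' Q') (w w1 : ver Q Q') (c : hor (F Q) Z)
    (c' : hor (F Q') Z') (v : ver Z Z') (r0 : ver (F Q) (F Q'))
    (r : sq r0 c c' v) d t d' t' (x : sq u k k' w) (y : sq u1 k1 k1' w1) :
  cartesian r -> invertible_cell d (fhor F k ⨾ c) t ->
    invertible_cell (fhor F k' ⨾ c') d' t' ->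
  r0 = fver F w ->
  u = u1 -> k = k1 -> k' = k1' -> w = w1 ->
  t // (tot (fsq F x) ** tot r) // t' = t // (tot (fsq F y) ** tot r) // t' ->
  x ≈ y.
Proof.
intros hr ht ht' h0 h1 h2 h3 h4 h.
apply (over_inj hr ht); trivial; subst.
apply invertible_cell_boundary in ht as [[? ?] [? ?]].
apply invertible_cell_inv in ht' as (ti & hti & e1 & e2).
apply invertible_cell_boundary in hti as [[? ?] [? ?]].
apply (f_equal (fun z => z // ti)) in h.
now rewrite !(vc_assoc _ t' ti), e1, !vc_idr in h by bdry.
Qed.

Lemma between_ex P Q P' Q' (Z : ob E) (Z' : ob E) (u : ver P P') (k : hor P Q)
    (k' : hor P' Q') (w : ver Q Q') (c : hor (F Q) Z) (c' : hor (F Q') Z')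
    (v : ver Z Z') (r0 : ver (F Q) (F Q')) (r : sq r0 c c' v) d d' t t' S :
  cartesian r -> r0 = fver F w ->
  invertible_cell d (fhor F k ⨾ c) t ->
  invertible_cell (fhor F k' ⨾ c') d' t' ->
  lf S = toV (fver F u) -> tp S = toH d -> bt S = toH d' -> rt S = toV v ->
  exists x : sq u k k' w, t // (tot (fsq F x) ** tot r) // t' = S.
Proof.
intros hr h0 ht ht' h1 h2 h3 h4.
apply invertible_cell_inv in ht as (ti & hti & e1 & e2).
apply invertible_cell_inv in ht' as (ti' & hti' & e1' & e2').
apply invertible_cell_boundary in hti' as [[? ?] [? ?]], hti as [[? ?] [? ?]].
destruct (@lift_ex _ _ _ _ u k k' w _ _ c c' v r0 r (ti // S // ti'))
  as [x hx]; trivial; [bdry..|].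
exists x; rewrite hx, <- !vc_assoc, e1, vc_idl, vc_assoc, e2', vc_idr by bdry;
  reflexivity.
Qed.

Lemma vinvertible_lift A C (a b : hor A C) (s : sq (vid A) a b (vid C)) :
  invertible_cell (fhor F a) (fhor F b) (tot (fsq F s)) -> vinvertible s.
Proof.
intros (T & hT & h1 & h2)%invertible_cell_inv.
apply invertible_cell_boundary in hT as [[? ?] [? ?]].
destruct (@ff_ex A C A C (vid A) b a (vid C) T) as [t ht]; [bdry..|].
rewrite <- ht in h1, h2.
exists (vid A), (vid C), t; split; apply tot_inj.
- eapply ff_inj; rewrite ?tot_fsq_vcomp, ?tot_fsq_I; trivial;
    apply (vid_l (dc_laws D)).
- eapply ff_inj; rewrite ?tot_fsq_vcomp, ?tot_fsq_I; trivial;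
    apply (vid_l (dc_laws D)).
Qed.

Lemma iso_lift A C (a b : hor A C) : iso (fhor F a) (fhor F b) -> iso a b.
Proof.
intros (s & hs).
destruct (@ff_ex A C A C (vid A) a b (vid C) (tot s)) as [t ht]; [bdry..|].
exists t; apply vinvertible_lift; rewrite ht; now apply invertible_cell_tot.
Qed.
End FunctorTot.

(** * The quasi-inverse and the counit *)

Section Pasting.
Context {D : doubleCat}.
(** Naturality equations of adjacent squares paste: the cell [b] at the end of the first slides past
    [s1], and [t1] past [X]. *)
Lemma over_hcomp {K K1 K2 B B1 B2 K' K1' K2' B' B1' B2' : ob D}
  {k : hor K K1} {k1 : hor K1 K2} {k' : hor K' K1'} {k1' : hor K1' K2'}
  {h : hor B B1} {h1 : hor B1 B2} {h' : hor B' B1'} {h1' : hor B1' B2'}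
  {e : hor K B} {e1 : hor K1 B1} {e2 : hor K2 B2}
  {e' : hor K' B'} {e1' : hor K1' B1'} {e2' : hor K2' B2'}
  {u : ver K K'} {u1 : ver K1 K1'} {u2 : ver K2 K2'}
  {v : ver B B'} {v1 : ver B1 B1'} {v2 : ver B2 B2'}
  {l : sq u e e' v} {m : sq u1 e1 e1' v1} {r : sq u2 e2 e2' v2}
  {t : sq (vid K) (e ⨾ h) (k ⨾ e1) (vid B1)}
  {t1 : sq (vid K1) (e1 ⨾ h1) (k1 ⨾ e2) (vid B2)}
  {b : sq (vid K') (e' ⨾ h') (k' ⨾ e1') (vid B1')}
  {b1 : sq (vid K1') (e1' ⨾ h1') (k1' ⨾ e2') (vid B2')}
  {X : sq u k k' u1} {Y : sq u1 k1 k1' u2}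
  {s : sq v h h' v1} {s1 : sq v1 h1 h1' v2} :
  (tot l ** tot s) // tot b = tot t // (tot X ** tot m) ->
  (tot m ** tot s1) // tot b1 = tot t1 // (tot Y ** tot r) ->
  (tot l ** (tot s ** tot s1)) // ((tot b ** idv h1') // (idv k' ** tot b1)) =
  ((tot t ** idv h1) // (idv k ** tot t1)) // ((tot X ** tot Y) ** tot r).
Proof.
intros H1 H2.
rewrite <- hc_assoc, <- vc_assoc, hc_vc, H1, vc_idr by bdry.
rewrite <- (vc_idl (u := h1) (x := tot s1)) at 1 by bdry.
rewrite <- hc_vc by bdry.
rewrite vc_assoc, hc_assoc, hc_vc, H2, vc_idr by bdry.
rewrite <- (vc_idl (u := k) (x := tot X)) at 1 by bdry.
rewrite <- hc_vc by bdry.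
now rewrite hc_assoc, vc_assoc.
Qed.
End Pasting.

(** [gob X], [ghor b] and [gver v] are the values of the quasi-inverse, and
    [e X], [gt b] and [gl v] the components of the counit. *)
Section Inverse.
Context {A B : doubleCat} (F : doubleFunctor A B).
Hypothesis ff : fully_faithful_on_squares F.
Context (gob : ob B -> ob A) (e : forall X, hor (F (gob X)) X).
Hypothesis he : forall X, horizontal_equivalence (e X).
Context (ghor : forall X Y, hor X Y -> hor (gob X) (gob Y)).
Context (gt : forall X Y (b : hor X Y),
  sq (vid _) (e X ⨾ b) (fhor F (ghor b) ⨾ e Y) (vid _)).
Hypothesis hgt : forall X Y (b : hor X Y), vinvertible (gt b).
Context (gver : forall X Y, ver X Y -> ver (gob X) (gob Y)).
Context (gl : forall X Y (v : ver X Y), sq (fver F (gver v)) (e X) (e Y) v).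
Hypothesis hgl : forall X Y (v : ver X Y), cartesian (gl v).

Lemma gt_cell X Y (b : hor X Y) :
  invertible_cell (e X ⨾ b) (fhor F (ghor b) ⨾ e Y) (tot (gt b)).
Proof. apply invertible_cell_tot, hgt. Qed.

Lemma gt_eq X Y (b b' : hor X Y) : b = b' -> tot (gt b) = tot (gt b').
Proof. now intros <-. Qed.
Lemma gl_eq X Y (b b' : ver X Y) : b = b' -> tot (gl b) = tot (gl b').
Proof. now intros <-. Qed.

(** The cell that [a ⨾ c] would receive if [ghor] preserved composition; [gPhi] compares it with the
    chosen one. *)
Definition gtc X Y Z (a : hor X Y) (c : hor Y Z) : option sqT :=
  (tot (gt a) ** idv c) // (idv (fhor F (ghor a)) ** tot (gt c)).

Lemma gtc_cell X Y Z (a : hor X Y) (c : hor Y Z) :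
  invertible_cell (e X ⨾ (a ⨾ c)) (fhor F (ghor a ⨾ ghor c) ⨾ e Z) (gtc a c).
Proof.
eapply invertible_cell_eq; [eapply invertible_cell_v|..].
- eapply invertible_cell_h; [apply gt_cell|apply invertible_cell_idv].
- eapply invertible_cell_h; [apply invertible_cell_idv|apply gt_cell].
- apply hcomp_assoc.
- apply hcomp_assoc.
- now rewrite fhor_comp, hcomp_assoc.
Qed.

Lemma over_ex P Q P' Q' (X : ob B) (X' : ob B) (u : ver P P') (k : hor P Q)
    (k' : hor P' Q') (w : ver Q Q') (c : hor (F Q) X) (c' : hor (F Q') X')
    (v : ver X X') (r0 : ver (F Q) (F Q')) (r : sq r0 c c' v) d d' t t' S :
  cartesian r -> r0 = fver F w ->
  invertible_cell d (fhor F k ⨾ c) t ->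
  invertible_cell d' (fhor F k' ⨾ c') t' ->
  lf S = toV (fver F u) -> tp S = toH d -> bt S = toH d' -> rt S = toV v ->
  exists x : sq u k k' w, S // t' = t // (tot (fsq F x) ** tot r).
Proof.
intros hr h0 ht ht' h1 h2 h3 h4.
apply invertible_cell_inv in ht as (ti & hti & e1 & e2).
apply invertible_cell_boundary in ht' as [[? ?] [? ?]], hti as [[? ?] [? ?]].
destruct (@lift_ex _ _ F ff _ _ _ _ u k k' w _ _ c c' v r0 r (ti // (S // t')))
  as [x hx]; trivial; [bdry..|].
exists x; rewrite hx, <- vc_assoc, e1, vc_idl by bdry; reflexivity.
Qed.

(** Naturality of the counit, taken as the definition of the quasi-inverse on squares. *)
Lemma gsq_ex X Y X' Y' (u : ver X X') (a : hor X Y) (a' : hor X' Y')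
    (w : ver Y Y') (s : sq u a a' w) :
  { x : sq (gver u) (ghor a) (ghor a') (gver w) |
    (tot (gl u) ** tot s) // tot (gt a') =
      tot (gt a) // (tot (fsq F x) ** tot (gl w)) }.
Proof.
apply constructive_indefinite_description.
eapply over_ex; try apply gt_cell; [apply hgl|reflexivity|bdry..].
Qed.
Definition gsq X Y X' Y' (u : ver X X') (a : hor X Y) (a' : hor X' Y')
    (w : ver Y Y') (s : sq u a a' w) := proj1_sig (gsq_ex s).
Definition gsqP X Y X' Y' (u : ver X X') (a : hor X Y) (a' : hor X' Y')
    (w : ver Y Y') (s : sq u a a' w) :
    (tot (gl u) ** tot s) // tot (gt a') =
      tot (gt a) // (tot (fsq F (gsq s)) ** tot (gl w)) := proj2_sig (gsq_ex s).

Lemma cartesian_e X : cartesian (sqvid (e X)).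
Proof. apply sqvid_cartesian, he. Qed.

(** Two candidates [k] and [k'] for the image of one morphism are compared by a cell; the horizontal
    comparison squares arise in this way. *)
Lemma gcell_ex X Y (k k' : hor (gob X) (gob Y)) d t t' :
  invertible_cell d (fhor F k ⨾ e Y) t ->
    invertible_cell d (fhor F k' ⨾ e Y) t' ->
  exists x : sq (vid _) k k' (vid _), t' = t // (tot (fsq F x) ** idv (e Y)).
Proof.
intros ht ht'.
destruct (@over_ex _ _ _ _ Y Y (vid _) k k' (vid _) _ _ _ _ (sqvid (e Y))
  d d t t' (idv d)) as [x hx]; try bdry.
- apply cartesian_e.
- exact ht.
- exact ht'.
- exists x; rewrite <- hx.
  apply invertible_cell_boundary in ht' as [[? ?] [? ?]];
    rewrite vc_idl by bdry; reflexivity.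
Qed.

(** Invertibility can be tested after applying [F] and whiskering with [e Y], where [x] becomes the
    inverse of [t] followed by [t']. *)
Lemma gcell_inv X Y (k k' : hor (gob X) (gob Y)) d t t'
    (x : sq (vid _) k k' (vid _)) :
  invertible_cell d (fhor F k ⨾ e Y) t ->
    invertible_cell d (fhor F k' ⨾ e Y) t' ->
  t' = t // (tot (fsq F x) ** idv (e Y)) -> vinvertible x.
Proof.
intros ht ht' h.
apply (vinvertible_lift ff).
destruct (@tot_surj _ _ _ _ _ (vid _) (fhor F k) (fhor F k') (vid _)
  (tot (fsq F x))) as [z hz]; [bdry..|].
rewrite hz in *; apply invertible_cell_tot,
  (vinvertible_reflect (cartesian_e Y)).
apply invertible_cell_inv in ht as (ti & hti & h1 & h2).
destruct (invertible_cell_v hti ht' eq_refl) as (y & hy1 & hy2).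
eapply vinvertible_tot; [|exact hy1].
apply invertible_cell_boundary in hti as [[? ?] [? ?]].
rewrite hy2, h, tot_hcomp, <- vc_assoc, h2, vc_idl by bdry; reflexivity.
Qed.

Lemma gPhi_ex X Y Z (a : hor X Y) (c : hor Y Z) :
  { x : sq (vid _) (ghor a ⨾ ghor c) (ghor (a ⨾ c)) (vid _) |
    tot (gt (a ⨾ c)) = gtc a c // (tot (fsq F x) ** idv (e Z)) }.
Proof.
apply constructive_indefinite_description.
eapply gcell_ex; [apply gtc_cell|apply gt_cell].
Qed.
Definition gPhi X Y Z (a : hor X Y) (c : hor Y Z) := proj1_sig (gPhi_ex a c).
Definition gPhiP X Y Z (a : hor X Y) (c : hor Y Z) :
  tot (gt (a ⨾ c)) = gtc a c // (tot (fsq F (gPhi a c)) ** idv (e Z)) :=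
  proj2_sig (gPhi_ex a c).
Lemma gPhi_inv X Y Z (a : hor X Y) (c : hor Y Z) : vinvertible (gPhi a c).
Proof. eapply gcell_inv; [apply gtc_cell|apply gt_cell|apply gPhiP]. Qed.

Lemma ghid_cell X : invertible_cell (e X ⨾ hid X) (fhor F (hid (gob X)) ⨾ e X)
  (idv (e X)).
Proof.
eapply invertible_cell_eq;
  [apply invertible_cell_idv|symmetry; apply hcomp_idr|].
now rewrite fhor_id, hcomp_idl.
Qed.

Lemma gPhi0_ex X :
  { x : sq (vid _) (hid (gob X)) (ghor (hid X)) (vid _) |
    tot (gt (hid X)) = tot (fsq F x) ** idv (e X) }.
Proof.
apply constructive_indefinite_description.
destruct (gcell_ex (ghid_cell X) (gt_cell (hid X))) as [x hx].
exists x; rewrite hx, vc_idl by bdry; reflexivity.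
Qed.
Definition gPhi0 X := proj1_sig (gPhi0_ex X).
Definition gPhi0P X : tot (gt (hid X)) = tot (fsq F (gPhi0 X)) ** idv (e X) :=
  proj2_sig (gPhi0_ex X).
Lemma gPhi0_inv X : vinvertible (gPhi0 X).
Proof.
eapply gcell_inv; [apply ghid_cell|apply gt_cell|].
rewrite gPhi0P, vc_idl by bdry; reflexivity.
Qed.

(** The vertical analogue of [gcell_ex]: the top and bottom of [l] are read as an identity followed
    by [e]. When both squares are cartesian, each factors through the other, whence [gvert_inv]. *)
Lemma gvert_ex X Y (u u' : ver (gob X) (gob Y)) v
    (l : sq (fver F u) (e X) (e Y) v) (l' : sq (fver F u') (e X) (e Y) v) :
  cartesian l' ->
  exists x : sq u (hid _) (hid _) u', tot l = tot (fsq F x) ** tot l'.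
Proof.
intros h.
destruct (@lift_ex _ _ F ff _ _ _ _ u (hid _) (hid _) u' _ _ _ _ _ _ l' (tot l))
  as [x hx]; trivial; [bdry..|].
now exists x.
Qed.

Lemma gvert_inv X Y (u u' : ver (gob X) (gob Y)) v
    (l : sq (fver F u) (e X) (e Y) v) (l' : sq (fver F u') (e X) (e Y) v)
    (x : sq u (hid _) (hid _) u') :
  cartesian l -> cartesian l' -> tot l = tot (fsq F x) ** tot l' ->
    hinvertible x.
Proof.
intros h h' hx; destruct (gvert_ex l' h) as [y hy].
exists (hid _), (hid _), y; split; apply tot_inj.
- eapply (lift_inj ff h); trivial; try apply hcomp_idl.
  rewrite tot_fsq_hcomp, hc_assoc, <- hy, <- hx, tot_fsq_J, hc_idl by bdry;
    reflexivity.
- eapply (lift_inj ff h'); trivial; try apply hcomp_idl.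
  rewrite tot_fsq_hcomp, hc_assoc, <- hx, <- hy, tot_fsq_J, hc_idl by bdry;
    reflexivity.
Qed.

Definition glc X Y Z (u : ver X Y) (v : ver Y Z) :
  sq (fver F (gver u • gver v)) (e X) (e Z) (u • v) :=
  sqcast (eq_sym (fver_comp F _ _)) eq_refl eq_refl eq_refl (gl u / gl v).
Lemma glc_tot X Y Z (u : ver X Y) (v : ver Y Z) :
  tot (glc u v) = tot (gl u) // tot (gl v).
Proof. unfold glc; rewrite tot_cast; apply tot_vcomp. Qed.
Lemma glc_cartesian X Y Z (u : ver X Y) (v : ver Y Z) : cartesian (glc u v).
Proof.
eapply cartesian_tot; [symmetry; apply tot_cast|].
apply cartesian_vcomp; trivial.
Qed.
Definition gl0 X : sq (fver F (vid (gob X))) (e X) (e X) (vid X) :=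
  sqcast (eq_sym (fver_id F _)) eq_refl eq_refl eq_refl (sqvid (e X)).
Lemma gl0_tot X : tot (gl0 X) = idv (e X).
Proof. apply tot_cast. Qed.
Lemma gl0_cartesian X : cartesian (gl0 X).
Proof. eapply cartesian_tot; [symmetry; apply tot_cast|apply cartesian_e]. Qed.

Lemma gPsi_ex X Y Z (u : ver X Y) (v : ver Y Z) :
  { x : sq (gver u • gver v) (hid _) (hid _) (gver (u • v)) |
    tot (glc u v) = tot (fsq F x) ** tot (gl (u • v)) }.
Proof.
apply constructive_indefinite_description, gvert_ex, hgl.
Qed.
Definition gPsi X Y Z (a : ver X Y) (c : ver Y Z) := proj1_sig (gPsi_ex a c).
Lemma gPsiP X Y Z (u : ver X Y) (v : ver Y Z) :
  tot (gl u) // tot (gl v) = tot (fsq F (gPsi u v)) ** tot (gl (u • v)).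
Proof. rewrite <- glc_tot; exact (proj2_sig (gPsi_ex u v)). Qed.
Lemma gPsi_inv X Y Z (u : ver X Y) (v : ver Y Z) : hinvertible (gPsi u v).
Proof.
eapply gvert_inv; [apply glc_cartesian|apply hgl|].
exact (proj2_sig (gPsi_ex u v)).
Qed.

Lemma gPsi0_ex X :
  { x : sq (vid (gob X)) (hid _) (hid _) (gver (vid X)) |
    tot (gl0 X) = tot (fsq F x) ** tot (gl (vid X)) }.
Proof.
apply constructive_indefinite_description, gvert_ex, hgl.
Qed.
Definition gPsi0 X := proj1_sig (gPsi0_ex X).
Lemma gPsi0P X : idv (e X) = tot (fsq F (gPsi0 X)) ** tot (gl (vid X)).
Proof. rewrite <- gl0_tot; exact (proj2_sig (gPsi0_ex X)). Qed.
Lemma gPsi0_inv X : hinvertible (gPsi0 X).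
Proof.
eapply gvert_inv; [apply gl0_cartesian|apply hgl|].
exact (proj2_sig (gPsi0_ex X)).
Qed.

(** * Coherence laws of the quasi-inverse *)

Lemma gPhi_nat X Y Z X' Y' Z' (u : ver X X') (v : ver Y Y')
    (w : ver Z Z') (a : hor X Y) (a' : hor X' Y') (c : hor Y Z)
    (c' : hor Y' Z') (s : sq u a a' v) (t : sq v c c' w) :
    (gsq s ∣ gsq t) / gPhi a' c' ≈ gPhi a c / gsq (s ∣ t).
Proof.
eapply (over_inj ff (hgl w) (t := gtc a c)); try bdry; [apply gtc_cell|].
rewrite !tot_fsq_vcomp, tot_fsq_hcomp.
pose proof (over_hcomp (gsqP s) (gsqP t)) as h; fold (gtc a c) (gtc a' c') in h.
pose proof (invertible_cell_boundary (gtc_cell a c)) as [[? ?] [? ?]].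
pose proof (invertible_cell_boundary (gtc_cell a' c')) as [[? ?] [? ?]].
(* Both sides become the naturality square of [s ∣ t]: one by pasting those of [s] and [t], the
   other directly. *)
transitivity ((tot (gl u) ** tot (s ∣ t)) // tot (gt (a' ⨾ c'))).
- rewrite gPhiP, <- vc_assoc, tot_hcomp, h, vc_assoc; f_equal.
  rewrite <- (vc_idr (u := e Z') (x := tot (gl w))) at 1 by bdry.
  rewrite <- hc_vc by bdry; reflexivity.
- rewrite gsqP, gPhiP, vc_assoc; f_equal.
  rewrite hc_vc, vc_idl by bdry; reflexivity.
Qed.

Lemma gPhi0_nat X X' (u : ver X X') :
  sqhid (gver u) / gPhi0 X' ≈ gPhi0 X / gsq (sqhid u).
Proof.
eapply (over_inj ff (hgl u) (ghid_cell X)); try bdry.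
rewrite !tot_fsq_vcomp, tot_fsq_J, !vc_idl by bdry.
transitivity (tot (gl u) // tot (gt (hid X'))).
- rewrite gPhi0P.
  rewrite <- (vc_idr (u := e X') (x := tot (gl u))) at 1 by bdry.
  rewrite <- hc_vc, hc_idl by bdry; reflexivity.
- rewrite <- (hc_idr (u := u) (x := tot (gl u))) at 1 by bdry.
  rewrite gsqP, gPhi0P, hc_vc, vc_idl by bdry.
  reflexivity.
Qed.

Lemma gPhi_assoc X Y Z W (a : hor X Y) (b : hor Y Z) (c : hor Z W) :
    (gPhi a b ∣ sqvid (ghor c)) / gPhi (a ⨾ b) c
    ≈ (sqvid (ghor a) ∣ gPhi b c) / gPhi a (b ⨾ c).
Proof.
(* The unbracketed cell for a triple composite. Followed by either side of the law, it becomes the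
   chosen cell of [a ⨾ b ⨾ c]. *)
set (t := ((tot (gt a) ** idv b ** idv c) //
  (idv (fhor F (ghor a)) ** tot (gt b) ** idv c))
  // (idv (fhor F (ghor a)) ** idv (fhor F (ghor b)) ** tot (gt c))).
assert (ht : invertible_cell (e X ⨾ a ⨾ b ⨾ c)
  (fhor F (ghor a ⨾ ghor b ⨾ ghor c) ⨾ e W) t).
{ eapply invertible_cell_eq; [eapply invertible_cell_v;
    [eapply invertible_cell_v|..]|reflexivity|..].
  - eapply invertible_cell_h; [eapply invertible_cell_h|];
      [apply gt_cell|apply invertible_cell_idv..].
  - eapply invertible_cell_h; [eapply invertible_cell_h|];
      [apply invertible_cell_idv|apply gt_cell|apply invertible_cell_idv].
  - now rewrite !hcomp_assoc.
  - eapply invertible_cell_h; [eapply invertible_cell_h|];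
      [apply invertible_cell_idv|apply invertible_cell_idv|apply gt_cell].
  - now rewrite !hcomp_assoc.
  - now rewrite !fhor_comp, !hcomp_assoc. }
eapply (over_inj ff (cartesian_e W) ht); try bdry.
rewrite !tot_fsq_vcomp, !tot_fsq_hcomp, !tot_fsq_I.
transitivity (tot (gt (a ⨾ b ⨾ c))).
- rewrite gPhiP; unfold gtc; rewrite gPhiP; unfold gtc; subst t.
  rewrite (whisker_r c), (whisker_r c) by bdry.
  rewrite (hc_assoc (tot (fsq F (gPhi a b)))), <- (idv_comp (e Z) c).
  rewrite (vc_assoc _ (_ ** idv (_ ⨾ _)) (idv _ ** _)).
  rewrite (exchange (a := fhor F (ghor a) ⨾ fhor F (ghor b))
    (d := fhor F (ghor c) ⨾ e W)) by bdry.
  rewrite !idv_comp, !hc_assoc, !vc_assoc, whisker_r by bdry.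
  rewrite !hc_assoc; reflexivity.
- rewrite (gt_eq (hcomp_assoc a b c)), gPhiP; unfold gtc; rewrite gPhiP;
    unfold gtc; subst t.
  rewrite !(whisker_l (fhor F (ghor a))) by bdry.
  rewrite whisker_r, !idv_comp, !hc_assoc, !vc_assoc by bdry; reflexivity.
Qed.

Lemma gPhi_unit_l X Y (a : hor X Y) :
    (gPhi0 X ∣ sqvid (ghor a)) / gPhi (hid X) a ≈ sqvid (ghor a).
Proof.
eapply (over_inj ff (cartesian_e Y) (t := tot (gt a)));
  try (rewrite ?hcomp_idl; bdry).
- eapply invertible_cell_eq; [apply gt_cell|reflexivity|].
  now rewrite hcomp_idl.
- rewrite tot_fsq_vcomp, tot_fsq_hcomp, !tot_fsq_I.
  rewrite <- idv_comp, vc_idr by bdry.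
  rewrite whisker_r, hc_assoc, <- idv_comp by bdry.
  rewrite <- (hc_idvl (x := tot (gt a))) at 1 by bdry.
  rewrite <- vc_assoc, <- (exchange (c := e X ⨾ a) (b := fhor F (ghor (hid X))))
    by bdry.
  rewrite idv_comp, <- hc_assoc, <- gPhi0P.
  rewrite <- (gt_eq (hcomp_idl a)) at 2; rewrite gPhiP; reflexivity.
Qed.

Lemma gPhi_unit_r X Y (a : hor X Y) :
    (sqvid (ghor a) ∣ gPhi0 Y) / gPhi a (hid Y) ≈ sqvid (ghor a).
Proof.
eapply (over_inj ff (cartesian_e Y) (t := tot (gt a)));
  try (rewrite ?hcomp_idr; bdry).
- eapply invertible_cell_eq; [apply gt_cell|reflexivity|].
  now rewrite hcomp_idr.
- rewrite tot_fsq_vcomp, tot_fsq_hcomp, !tot_fsq_I.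
  rewrite <- idv_comp, vc_idr by bdry.
  rewrite whisker_r, hc_assoc, <- gPhi0P by bdry.
  rewrite <- (gt_eq (hcomp_idr a)) at 2; rewrite gPhiP; unfold gtc.
  rewrite hc_idvr, vc_assoc by bdry; reflexivity.
Qed.

Lemma gPsi_nat X Y X' Y' X'' Y'' (a : hor X Y) (a' : hor X' Y')
    (a'' : hor X'' Y'') (u : ver X X') (w : ver Y Y')
    (u' : ver X' X'') (w' : ver Y' Y'')
    (s : sq u a a' w) (t : sq u' a' a'' w') :
    (gsq s / gsq t) ∣ gPsi w w' ≈ gPsi u u' ∣ gsq (s / t).
Proof.
eapply (over_inj ff (hgl (w • w')) (t := tot (gt a)));
  try (rewrite ?hcomp_idr, ?hcomp_idl; bdry).
- eapply invertible_cell_eq; [apply gt_cell|reflexivity|].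
  now rewrite hcomp_idr.
- rewrite !tot_fsq_hcomp, tot_fsq_vcomp, !hc_assoc, <- gPsiP.
  transitivity (((tot (gl u) // tot (gl u')) ** tot (s / t)) // tot (gt a'')).
  + rewrite tot_vcomp, <- (hc_vc (p := tot (gl u))) by bdry.
    rewrite <- (hc_vc (p := tot (fsq F (gsq s)))) by bdry.
    rewrite (vc_assoc (tot (gl u) ** _)), gsqP, <- !vc_assoc, gsqP; reflexivity.
  + rewrite gPsiP, hc_assoc.
    rewrite <- (hc_idvl (x := tot (gt a''))) by bdry.
    rewrite <- (hc_idvl (x := tot (gt a))) by bdry.
    rewrite hc_vc, gsqP, hc_vc, vc_idl, vc_idr by bdry; reflexivity.
Qed.

Lemma gPsi0_nat X Y (a : hor X Y) :
    sqvid (ghor a) ∣ gPsi0 Y ≈ gPsi0 X ∣ gsq (sqvid a).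
Proof.
eapply (over_inj ff (hgl (vid Y)) (t := tot (gt a)));
  try (rewrite ?hcomp_idr, ?hcomp_idl; bdry).
- eapply invertible_cell_eq; [apply gt_cell|reflexivity|].
  now rewrite hcomp_idr.
- rewrite !tot_fsq_hcomp, !hc_assoc, <- gPsi0P, tot_fsq_I.
  rewrite <- idv_comp, vc_idr by bdry.
  rewrite <- (hc_idvl (x := tot (gt a))) at 2 by bdry.
  rewrite hc_vc, <- gsqP, vc_idl by bdry.
  rewrite <- (vc_idr (u := hid _) (x := tot (fsq F (gPsi0 X)))) by bdry.
  rewrite <- hc_vc, <- hc_assoc, <- gPsi0P, <- idv_comp by bdry.
  rewrite hc_idvl, vc_idl by bdry; reflexivity.
Qed.

Lemma gPsi_assoc X Y Z W (u : ver X Y) (v : ver Y Z) (w : ver Z W) :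
    (gPsi u v / sqhid (gver w)) ∣ gPsi (u • v) w
    ≈ (sqhid (gver u) / gPsi v w) ∣ gPsi u (v • w).
Proof.
(* Both sides of the law have top [hid _ ⨾ hid _], so the identity of [e X] is given a matching
   boundary. *)
assert (ht : invertible_cell (e X) (fhor F (hid _ ⨾ hid _) ⨾ e X) (idv (e X))).
{ eapply invertible_cell_eq; [apply invertible_cell_idv|reflexivity|].
  now rewrite fhor_comp, !fhor_id, !hcomp_idl. }
eapply (over_inj ff (hgl (u • v • w)) ht); try bdry.
rewrite !tot_fsq_hcomp, !tot_fsq_vcomp, !tot_fsq_J, !hc_assoc; f_equal.
rewrite (gl_eq (vcomp_assoc u v w)) at 2.
rewrite <- !gPsiP, <- !hc_vc, <- !gPsiP, !hc_idl by bdry.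
apply vc_assoc.
Qed.

Lemma gPsi_unit_l X Y (u : ver X Y) :
    (gPsi0 X / sqhid (gver u)) ∣ gPsi (vid X) u ≈ sqhid (gver u).
Proof.
assert (ht : invertible_cell (e X) (fhor F (hid _ ⨾ hid _) ⨾ e X) (idv (e X))).
{ eapply invertible_cell_eq; [apply invertible_cell_idv|reflexivity|].
  now rewrite fhor_comp, !fhor_id, !hcomp_idl. }
eapply (over_inj ff (hgl u) ht); try (rewrite ?hcomp_idl; bdry).
rewrite !tot_fsq_hcomp, !tot_fsq_vcomp, !tot_fsq_J, !hc_assoc; f_equal.
rewrite <- (gl_eq (vcomp_idl u)) at 1.
rewrite <- !gPsiP, <- !hc_vc, <- !gPsi0P, !hc_idl, vc_idl by bdry.
reflexivity.
Qed.

Lemma gPsi_unit_r X Y (u : ver X Y) :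
    (sqhid (gver u) / gPsi0 Y) ∣ gPsi u (vid Y) ≈ sqhid (gver u).
Proof.
assert (ht : invertible_cell (e X) (fhor F (hid _ ⨾ hid _) ⨾ e X) (idv (e X))).
{ eapply invertible_cell_eq; [apply invertible_cell_idv|reflexivity|].
  now rewrite fhor_comp, !fhor_id, !hcomp_idl. }
eapply (over_inj ff (hgl u) ht); try (rewrite ?hcomp_idl; bdry).
rewrite !tot_fsq_hcomp, !tot_fsq_vcomp, !tot_fsq_J, !hc_assoc; f_equal.
rewrite <- (gl_eq (vcomp_idr u)) at 1.
rewrite <- !gPsiP, <- !hc_vc, <- !gPsi0P, !hc_idl, vc_idr by bdry.
reflexivity.
Qed.

Definition quasi_inverse : pseudoFunctor B A := {|
  pob := gob; phor := ghor; pver := gver; psq := gsq;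
  pPhi := gPhi; pPhi0 := gPhi0; pPsi := gPsi; pPsi0 := gPsi0;
  pPhi_inv := gPhi_inv; pPhi0_inv := gPhi0_inv;
  pPsi_inv := gPsi_inv; pPsi0_inv := gPsi0_inv;
  pPhi_nat := gPhi_nat; pPhi0_nat := gPhi0_nat; pPhi_assoc := gPhi_assoc;
  pPhi_unit_l := gPhi_unit_l; pPhi_unit_r := gPhi_unit_r;
  pPsi_nat := gPsi_nat; pPsi0_nat := gPsi0_nat; pPsi_assoc := gPsi_assoc;
  pPsi_unit_l := gPsi_unit_l; pPsi_unit_r := gPsi_unit_r |}.

Lemma counit_nat X Y X' Y' (u : ver X X') (a : hor X Y) (a' : hor X' Y')
    (w : ver Y Y') (s : sq u a a' w) :
  (gl u ∣ s) / gt a' ≈ gt a / (fsq F (gsq s) ∣ gl w).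
Proof. apply tot_inj; rewrite !tot_vcomp, !tot_hcomp; apply gsqP. Qed.

Lemma counit_ver_comp X Y Z (u : ver X Y) (v : ver Y Z) :
  pPsi (psBefore F quasi_inverse) u v ∣ gl (u • v)
  ≈ (gl u / gl v) ∣ pPsi (psId B) u v.
Proof.
apply tot_inj; rewrite !tot_hcomp, tot_vcomp; cbn.
rewrite tot_cast, hc_idr by bdry; symmetry; apply gPsiP.
Qed.

(** Each law is the equation by which the corresponding datum of [quasi_inverse] was chosen. The
    term is transparent so that its components compute to [e], [gt] and [gl]. *)
Definition counit_trans : hTrans (psBefore F quasi_inverse) (psId B).
Proof.
refine (@Build_hTrans _ _ (psBefore F quasi_inverse) (psId B)
  e gt gl hgt counit_nat _ _ counit_ver_comp _).
- intros X Y Z a c; apply tot_inj; cbn.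
  rewrite tot_vcomp, !tot_vcompE, !tot_hcomp, tot_cast, <- idv_comp.
  rewrite vc_idl, gPhiP, <- vc_assoc by bdry; reflexivity.
- intros X; apply tot_inj; cbn.
  rewrite tot_vcomp, !tot_hcomp, tot_cast, <- idv_comp.
  rewrite vc_idl by bdry; apply gPhi0P.
- intros X; apply tot_inj; cbn.
  rewrite !tot_hcomp, tot_cast, hc_idr, gPsi0P by bdry; reflexivity.
Defined.
End Inverse.

(** * Lifting transformations along a functor *)

Section TransTot.
Context {D E : doubleCat} {F G : pseudoFunctor D E} (phi : hTrans F G).

Lemma tot_t_nat A C A' C' (u : ver A A') (a : hor A C) (a' : hor A' C')
    (w : ver C C') (s : sq u a a' w) :
  (tot (tver phi u) ** tot (psq G s)) // tot (thor phi a') =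
  tot (thor phi a) // (tot (psq F s) ** tot (tver phi w)).
Proof. rewrite <- !tot_hcomp, <- !tot_vcomp; apply tot_eq, t_nat. Qed.
Lemma tot_thor_comp A B C (a : hor A B) (c : hor B C) :
  (idv (tob phi A) ** tot (pPhi G a c)) // tot (thor phi (a ⨾ c)) =
  (tot (thor phi a) ** idv (phor G c)) //
  ((idv (phor F a) ** tot (thor phi c)) // (tot (pPhi F a c) ** idv (tob phi
    C))).
Proof.
rewrite <- !tot_hcomp, <- !tot_vcomp, (tot_eq (thor_comp phi a c)).
now rewrite !tot_vcompE.
Qed.
Lemma tot_thor_id A : (idv (tob phi A) ** tot (pPhi0 G A)) //
  tot (thor phi (hid A)) = tot (pPhi0 F A) ** idv (tob phi A).
Proof. rewrite <- !tot_hcomp, <- !tot_vcomp; apply tot_eq, thor_id. Qed.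
Lemma tot_tver_comp A B C (u : ver A B) (v : ver B C) :
  tot (pPsi F u v) ** tot (tver phi (u • v)) =
  (tot (tver phi u) // tot (tver phi v)) ** tot (pPsi G u v).
Proof. rewrite <- !tot_vcomp, <- !tot_hcomp; apply tot_eq, tver_comp. Qed.
Lemma tot_tver_id A : tot (pPsi0 F A) ** tot (tver phi (vid A)) =
  idv (tob phi A) ** tot (pPsi0 G A).
Proof. rewrite <- !tot_hcomp; apply tot_eq, tver_id. Qed.
Lemma thor_cell A C (a : hor A C) : invertible_cell (tob phi A ⨾ phor G a)
  (phor F a ⨾ tob phi C) (tot (thor phi a)).
Proof. apply invertible_cell_tot, thor_inv. Qed.
End TransTot.

Section TransAlong.
Context {D A B : doubleCat} (F : doubleFunctor A B).
Context (K : pseudoFunctor D A) (M : pseudoFunctor D B).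

(** The laws of a transformation [psBefore F K => M], without the transports in
    the comparison squares of [psBefore F K]. *)
Record trans_along (o : forall X, hor (F (K X)) (M X))
  (h : forall X Y (a : hor X Y), sq (vid (F (K X))) (o X ⨾ phor M a)
    (fhor F (phor K a) ⨾ o Y) (vid (M Y)))
  (v : forall X Y (u : ver X Y), sq (fver F (pver K u)) (o X) (o Y) (pver M u)) :
  Prop := {
  ta_inv : forall X Y (a : hor X Y), vinvertible (h X Y a);
  ta_nat : forall X Y X' Y' (u : ver X X') (a : hor X Y) (a' : hor X' Y')
    (w : ver Y Y') (s : sq u a a' w),
    (tot (v _ _ u) ** tot (psq M s)) // tot (h _ _ a') =
    tot (h _ _ a) // (tot (fsq F (psq K s)) ** tot (v _ _ w));
  ta_comp : forall X Y Z (a : hor X Y) (c : hor Y Z),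
    (idv (o X) ** tot (pPhi M a c)) // tot (h _ _ (a ⨾ c)) =
    (tot (h _ _ a) ** idv (phor M c)) // ((idv (fhor F (phor K a)) **
      tot (h _ _ c)) // (tot (fsq F (pPhi K a c)) ** idv (o Z)));
  ta_id : forall X, (idv (o X) ** tot (pPhi0 M X)) // tot (h _ _ (hid X)) =
    tot (fsq F (pPhi0 K X)) ** idv (o X);
  ta_ver_comp : forall X Y Z (u : ver X Y) (w : ver Y Z),
    tot (fsq F (pPsi K u w)) ** tot (v _ _ (u • w)) =
    (tot (v _ _ u) // tot (v _ _ w)) ** tot (pPsi M u w);
  ta_ver_id : forall X, tot (fsq F (pPsi0 K X)) ** tot (v _ _ (vid X)) =
    idv (o X) ** tot (pPsi0 M X)
}.

End TransAlong.

(** Given [e : F K2 => M], [b : F K1 => M] and invertible cells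
    [iota X : F (n X) ⨾ e X => b X], there is a unique transformation [K1 => K2]
    with components [n X] for which [iota] is a modification. *)
Section LiftTransformation.
Context {D A B : doubleCat} {F : doubleFunctor A B}.
Hypothesis ff : fully_faithful_on_squares F.
Context {K1 K2 : pseudoFunctor D A} {M : pseudoFunctor D B}.
Context {eo : forall X, hor (F (K2 X)) (M X)}
  {eh : forall X Y (a : hor X Y), sq (vid (F (K2 X))) (eo X ⨾ phor M a)
    (fhor F (phor K2 a) ⨾ eo Y) (vid (M Y))}
  {ev : forall X Y (u : ver X Y),
    sq (fver F (pver K2 u)) (eo X) (eo Y) (pver M u)}
  {bo : forall X, hor (F (K1 X)) (M X)}
  {bh : forall X Y (a : hor X Y), sq (vid (F (K1 X))) (bo X ⨾ phor M a)
    (fhor F (phor K1 a) ⨾ bo Y) (vid (M Y))}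
  {bv : forall X Y (u : ver X Y),
    sq (fver F (pver K1 u)) (bo X) (bo Y) (pver M u)}.
Hypothesis heps : trans_along eh ev.
Hypothesis hbeta : trans_along bh bv.
Hypothesis hr : forall X, cartesian (sqvid (eo X)).
Hypothesis hr' : forall X Y (u : ver X Y), cartesian (ev u).
Context {n : forall X, hor (K1 X) (K2 X)}.
Context {iota : forall X,
  sq (vid (F (K1 X))) (fhor F (n X) ⨾ eo X) (bo X) (vid (M X))}.
Hypothesis hiota : forall X, vinvertible (iota X).

Lemma eh_cell X Y (a : hor X Y) : invertible_cell (eo X ⨾ phor M a)
  (fhor F (phor K2 a) ⨾ eo Y) (tot (eh a)).
Proof. apply invertible_cell_tot, (ta_inv heps). Qed.
Lemma bh_cell X Y (a : hor X Y) : invertible_cell (bo X ⨾ phor M a)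
  (fhor F (phor K1 a) ⨾ bo Y) (tot (bh a)).
Proof. apply invertible_cell_tot, (ta_inv hbeta). Qed.

Lemma iota_cell X : invertible_cell (fhor F (n X) ⨾ eo X) (bo X) (tot (iota X)).
Proof. apply invertible_cell_tot, hiota. Qed.

(** In the modification law for [iota] at [a], the unknown component whiskered with [eo Y] stands
    between [lift_top a] and [lift_bot a]. Both are invertible, so the law can be solved for it. *)
Definition lift_top X Y (a : hor X Y) : option sqT :=
  idv (fhor F (n X)) ** tot (eh a).
Definition lift_bot X Y (a : hor X Y) : option sqT :=
  idv (fhor F (phor K1 a)) ** tot (iota Y).

Lemma lift_top_cell X Y (a : hor X Y) : invertible_cell
  (fhor F (n X) ⨾ (eo X ⨾ phor M a))
  (fhor F (n X ⨾ phor K2 a) ⨾ eo Y) (lift_top a).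
Proof.
eapply invertible_cell_eq; [eapply invertible_cell_h;
  [apply invertible_cell_idv|apply eh_cell]|reflexivity|].
now rewrite fhor_comp, hcomp_assoc.
Qed.
Lemma lift_bot_cell X Y (a : hor X Y) : invertible_cell
  (fhor F (phor K1 a ⨾ n Y) ⨾ eo Y)
  (fhor F (phor K1 a) ⨾ bo Y) (lift_bot a).
Proof.
eapply invertible_cell_eq; [eapply invertible_cell_h;
  [apply invertible_cell_idv|apply iota_cell]| |reflexivity].
now rewrite fhor_comp, hcomp_assoc.
Qed.

Lemma lift_ver_ex X X' (u : ver X X') :
  { x : sq (pver K1 u) (n X) (n X') (pver K2 u) |
    (tot (fsq F x) ** tot (ev u)) // tot (iota X') =
    tot (iota X) // tot (bv u) }.
Proof.
apply constructive_indefinite_description.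
destruct (@between_ex _ _ F ff _ _ _ _ _ _ (pver K1 u) (n X) (n X')
  (pver K2 u) _ _ _ _ (ev u) (fhor F (n X) ⨾ eo X) (bo X')
  (idv (fhor F (n X) ⨾ eo X)) (tot (iota X'))
  (tot (iota X) // tot (bv u))) as [x hx];
  [apply hr'|bdry|apply invertible_cell_idv|apply iota_cell|bdry..|].
exists x; rewrite <- hx, vc_idl by bdry; reflexivity.
Qed.
Definition lift_ver X X' (u : ver X X') := proj1_sig (lift_ver_ex u).
Definition lift_verP X X' (u : ver X X') :
    (tot (fsq F (lift_ver u)) ** tot (ev u)) // tot (iota X') =
    tot (iota X) // tot (bv u) := proj2_sig (lift_ver_ex u).

Lemma lift_hor_ex X Y (a : hor X Y) :
  { x : sq (vid (K1 X)) (n X ⨾ phor K2 a) (phor K1 a ⨾ n Y) (vid (K2 Y)) |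
    lift_top a // (tot (fsq F x) ** idv (eo Y)) // lift_bot a =
    (tot (iota X) ** idv (phor M a)) // tot (bh a) }.
Proof.
apply constructive_indefinite_description.
destruct (@between_ex _ _ F ff _ _ _ _ _ _ (vid (K1 X)) (n X ⨾ phor K2 a)
  (phor K1 a ⨾ n Y) (vid (K2 Y)) _ _ _ _ (sqvid (eo Y))
  (fhor F (n X) ⨾ (eo X ⨾ phor M a)) (fhor F (phor K1 a) ⨾ bo Y)
  (lift_top a) (lift_bot a)
  ((tot (iota X) ** idv (phor M a)) // tot (bh a))) as [x hx];
  [apply hr|bdry|apply lift_top_cell|apply lift_bot_cell|bdry..|].
exists x; exact hx.
Qed.
Definition lift_hor X Y (a : hor X Y) := proj1_sig (lift_hor_ex a).
Definition lift_horP X Y (a : hor X Y) :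
    lift_top a // (tot (fsq F (lift_hor a)) ** idv (eo Y)) // lift_bot a =
    (tot (iota X) ** idv (phor M a)) // tot (bh a) := proj2_sig (lift_hor_ex a).

(** All other cells in [lift_horP] are invertible, and both [F] and whiskering with [eo Y] reflect
    invertibility. *)
Lemma lift_hor_inv X Y (a : hor X Y) : vinvertible (lift_hor a).
Proof.
apply (vinvertible_lift ff).
destruct (@tot_surj _ _ _ _ _ (vid _) (fhor F (n X ⨾ phor K2 a))
  (fhor F (phor K1 a ⨾ n Y)) (vid _)
  (tot (fsq F (lift_hor a)))) as [z hz]; [bdry..|].
rewrite hz; apply invertible_cell_tot, (vinvertible_reflect (hr Y)).
pose proof (lift_horP a) as h; rewrite hz in h.
destruct (invertible_cell_inv (lift_top_cell a)) as (t & ht & h1 & h2).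
destruct (invertible_cell_inv (lift_bot_cell a)) as (t' & ht' & h1' & h2').
assert (c : invertible_cell (fhor F (n X) ⨾ (eo X ⨾ phor M a))
  (fhor F (phor K1 a) ⨾ bo Y)
  ((tot (iota X) ** idv (phor M a)) // tot (bh a))).
{ eapply invertible_cell_eq; [eapply invertible_cell_v; [|apply bh_cell|]|..].
  - eapply invertible_cell_h; [apply iota_cell|apply invertible_cell_idv].
  - reflexivity.
  - apply hcomp_assoc.
  - reflexivity. }
destruct (invertible_cell_v (invertible_cell_v ht c eq_refl) ht' eq_refl) as (y
  & hy1 & hy2).
eapply vinvertible_tot; [|exact hy1].
apply invertible_cell_boundary in ht as [[? ?] [? ?]], ht' as [[? ?] [? ?]].
pose proof (invertible_cell_boundary (lift_top_cell a)) as [[? ?] [? ?]].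
pose proof (invertible_cell_boundary (lift_bot_cell a)) as [[? ?] [? ?]].
rewrite hy2, <- h, tot_hcomp, <- !vc_assoc, h2, vc_idl, vc_assoc, h1',
  vc_idr by bdry.
reflexivity.
Qed.

Ltac compare_lifts r a b := eapply (between_inj ff r a b); try bdry.

(** Between [lift_top a] and [lift_bot a'], both sides become [iota X] followed by the naturality
    square of the second family at [s]. *)
Lemma lift_nat X Y X' Y' (u : ver X X') (a : hor X Y) (a' : hor X' Y')
    (w : ver Y Y') (s : sq u a a' w) :
  (lift_ver u ∣ psq K2 s) / lift_hor a' ≈ lift_hor a / (psq K1 s ∣ lift_ver w).
Proof.
compare_lifts (hr' w) (lift_top_cell a) (lift_bot_cell a').
rewrite !tot_fsq_vcomp, !tot_fsq_hcomp.
pose proof (ta_nat heps s) as e1.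
pose proof (ta_nat hbeta s) as e2.
transitivity ((tot (iota X) ** idv (phor M a)) //
  (tot (bh a) // (tot (fsq F (psq K1 s)) ** tot (bv w)))).
- rewrite <- (vc_idr (u := eo Y') (x := tot (ev w))) by bdry.
  rewrite <- hc_vc, hc_assoc, <- vc_assoc by bdry.
  unfold lift_top at 1; rewrite hc_vc, <- e1, vc_idl by bdry.
  rewrite <- (vc_idr (u := fhor F (n X')) (x :=
    tot (fsq F (lift_ver u)))) by bdry.
  rewrite <- hc_vc by bdry; fold (lift_top a').
  rewrite vc_assoc, vc_assoc, <- (vc_assoc (lift_top a')), lift_horP,
    <- hc_assoc, <- vc_assoc, hc_vc by bdry.
  rewrite lift_verP, vc_idr, <- e2, <- vc_assoc, hc_vc, vc_idl by bdry;
    reflexivity.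
- rewrite <- vc_assoc, <- lift_horP, !vc_assoc; f_equal.
  rewrite <- (vc_idl (u := eo Y) (x := tot (ev w))) by bdry.
  rewrite <- hc_vc, vc_assoc by bdry; f_equal.
  unfold lift_bot; rewrite hc_assoc, !hc_vc, lift_verP, vc_idl, vc_idr by bdry;
    reflexivity.
Qed.

(** The equalities [e1] and [e2] are arbitrary so as to fit those in the type of [thor_comp]. Both
    sides reduce to the composition law of the second family below [iota X]. *)
Lemma lift_comp X Y Z (a : hor X Y) (c : hor Y Z) e1 e2 :
  (sqvid (n X) ∣ pPhi K2 a c) / lift_hor (a ⨾ c)
  ≈ (lift_hor a ∣ sqvid (phor K2 c)) /[e1]
    ((sqvid (phor K1 a) ∣ lift_hor c) /[e2] (pPhi K1 a c ∣ sqvid (n Z))).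
Proof.
set (t := idv (fhor F (n X)) ** ((tot (eh a) ** idv (phor M c)) //
  (idv (fhor F (phor K2 a)) ** tot (eh c)))).
assert (ht : invertible_cell (fhor F (n X) ⨾ (eo X ⨾ (phor M a ⨾ phor M c)))
  (fhor F (n X ⨾ (phor K2 a ⨾ phor K2 c)) ⨾ eo Z) t).
{ eapply invertible_cell_eq; [eapply invertible_cell_h;
    [apply invertible_cell_idv|eapply invertible_cell_v]|..].
  - eapply invertible_cell_h; [apply eh_cell|apply invertible_cell_idv].
  - eapply invertible_cell_h; [apply invertible_cell_idv|apply eh_cell].
  - apply hcomp_assoc.
  - now rewrite !hcomp_assoc.
  - now rewrite !fhor_comp, !hcomp_assoc. }
compare_lifts (hr Z) ht (lift_bot_cell (a ⨾ c)).
rewrite !tot_fsq_vcomp, !tot_fsq_vcompE, !tot_fsq_hcomp, !tot_fsq_I.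
rewrite !whisker_r by bdry; subst t.
transitivity ((((tot (iota X) ** idv (phor M a)) // tot (bh a)) **
    idv (phor M c)) //
  (idv (fhor F (phor K1 a)) ** tot (bh c)) //
  (tot (fsq F (pPhi K1 a c)) ** idv (bo Z))).
- rewrite <- vc_assoc, (hc_assoc _ _ (idv (eo Z))), <- whisker_l,
    (vc_assoc (tot (eh a) ** _)) by bdry.
  rewrite <- (ta_comp heps), whisker_l by bdry; fold (lift_top (a ⨾ c)).
  rewrite !vc_assoc, <- (vc_assoc (lift_top _)), lift_horP.
  rewrite <- vc_assoc, <- hc_assoc, <- idv_comp.
  rewrite <- (exchange (c := phor M a ⨾ phor M c) (b := bo X)) by bdry.
  rewrite vc_assoc, (ta_comp hbeta), idv_comp, whisker_r, !vc_assoc,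
    !hc_assoc by bdry; reflexivity.
- pose proof (invertible_cell_boundary (lift_top_cell a)) as [[? ?] [? ?]].
  pose proof (invertible_cell_boundary (lift_bot_cell a)) as [[? ?] [? ?]].
  pose proof (invertible_cell_boundary (lift_top_cell c)) as [[? ?] [? ?]].
  pose proof (invertible_cell_boundary (lift_bot_cell c)) as [[? ?] [? ?]].
  assert (k : (lift_bot a ** idv (phor M c)) //
      (idv (fhor F (phor K1 a)) ** tot (bh c)) =
    idv (fhor F (phor K1 a)) ** (lift_top c //
      (tot (fsq F (lift_hor c)) ** idv (eo Z)) //
      lift_bot c)).
  { rewrite lift_horP, whisker_l by bdry; unfold lift_bot;
      now rewrite hc_assoc. }
  rewrite <- lift_horP, !whisker_r, (vc_assoc _ (lift_bot a ** _)), k by bdry.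
  (* [k1] and [k2] are exchanges of independent cells: [lift_hor a] past [eh c], and [iota Z] past
     the comparison square of [K1]. *)
  assert (k1 : (tot (fsq F (lift_hor a)) ** (idv (eo Y) ** idv (phor M c))) //
      (idv (fhor F (phor K1 a)) ** (idv (fhor F (n Y)) ** tot (eh c))) =
    (idv (fhor F (n X)) ** (idv (fhor F (phor K2 a)) ** tot (eh c))) //
      (tot (fsq F (lift_hor a)) ** (idv (fhor F (phor K2 c)) ** idv (eo Z)))).
  { rewrite <- !(hc_assoc _ _ (tot (eh c))), <- !idv_comp; apply exchange;
      bdry. }
  assert (k2 : (idv (fhor F (phor K1 a)) ** (idv (fhor F (phor K1 c)) **
      tot (iota Z))) // (tot (fsq F (pPhi K1 a c)) ** idv (bo Z)) =
    (tot (fsq F (pPhi K1 a c)) ** (idv (fhor F (n Z)) ** idv (eo Z))) //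
      (idv (fhor F (phor K1 (a ⨾ c))) ** tot (iota Z))).
  { rewrite <- !(hc_assoc _ _ (tot (iota Z))), <- !idv_comp; symmetry.
    apply exchange; bdry. }
  unfold lift_top, lift_bot; rewrite !whisker_l, !vc_assoc, !hc_assoc, k2,
    <- (vc_assoc (_ ** (idv (eo Y) ** _))), k1 by bdry.
  rewrite !vc_assoc; reflexivity.
Qed.

Lemma lift_id X : (sqvid (n X) ∣ pPhi0 K2 X) / lift_hor (hid X) ≈
  pPhi0 K1 X ∣ sqvid (n X).
Proof.
assert (ht : invertible_cell (fhor F (n X) ⨾ eo X) (fhor F (n X ⨾ hid _) ⨾ eo X)
  (idv (fhor F (n X) ⨾ eo X))).
{ eapply invertible_cell_eq; [apply invertible_cell_idv|reflexivity|].
  now rewrite hcomp_idr. }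
compare_lifts (hr X) ht (lift_bot_cell (hid X)).
rewrite !tot_fsq_vcomp, !tot_fsq_hcomp, !tot_fsq_I.
rewrite whisker_r, !hc_assoc by bdry.
rewrite <- (ta_id heps), whisker_l by bdry; fold (lift_top (hid X)).
rewrite !vc_assoc, <- (vc_assoc (lift_top _)), lift_horP.
rewrite <- (vc_assoc (idv (fhor F (n X)) ** _)), <- hc_assoc,
  <- (idv_comp (fhor F (n X)) (eo X)).
rewrite <- (exchange (c := hid (M X)) (b := bo X)), vc_assoc,
  (ta_id hbeta) by bdry.
unfold lift_bot.
rewrite (exchange (a := hid _) (d := bo X)) by bdry.
rewrite hc_idvl, hc_idvr by bdry; reflexivity.
Qed.

Lemma lift_ver_comp X Y Z (u : ver X Y) (v : ver Y Z) :
  pPsi K1 u v ∣ lift_ver (u • v) ≈ (lift_ver u / lift_ver v) ∣ pPsi K2 u v.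
Proof.
assert (ht : invertible_cell (fhor F (n X) ⨾ eo X) (fhor F (hid _ ⨾ n X) ⨾ eo X)
  (idv (fhor F (n X) ⨾ eo X))).
{ eapply invertible_cell_eq; [apply invertible_cell_idv|reflexivity|].
  now rewrite hcomp_idl. }
assert (ht' : invertible_cell (fhor F (hid _ ⨾ n Z) ⨾ eo Z) (bo Z) (tot (iota
  Z))).
{ eapply invertible_cell_eq; [apply iota_cell| |reflexivity].
  now rewrite hcomp_idl. }
compare_lifts (hr' (u • v)) ht ht'; try (rewrite ?hcomp_idr, ?hcomp_idl; bdry).
rewrite !tot_fsq_hcomp, !tot_fsq_vcomp, !hc_assoc, !vc_assoc; f_equal.
rewrite (ta_ver_comp heps), <- (hc_assoc (_ // _)), <- hc_vc by bdry.
transitivity (tot (iota X) // ((tot (bv u) // tot (bv v)) ** tot (pPsi M u v))).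
- rewrite <- (hc_idvl (x := tot (iota Z))) by bdry.
  rewrite hc_vc, lift_verP, vc_idr, <- (ta_ver_comp hbeta) by bdry.
  rewrite <- (hc_idvl (x := tot (iota X))) at 2 by bdry.
  rewrite hc_vc, vc_idl by bdry; reflexivity.
- rewrite <- (hc_idvr (x := tot (iota Z))) by bdry.
  rewrite (hc_vc (s := idv (hid _))), vc_assoc, lift_verP, <- vc_assoc,
    lift_verP, vc_assoc, vc_idr by bdry.
  rewrite <- (hc_idvr (x := tot (iota X))) at 1 by bdry.
  rewrite (hc_vc (p := tot (iota X))), vc_idl by bdry; reflexivity.
Qed.

Lemma lift_ver_id X : pPsi0 K1 X ∣ lift_ver (vid X) ≈ sqvid (n X) ∣ pPsi0 K2 X.
Proof.
assert (ht : invertible_cell (fhor F (n X) ⨾ eo X) (fhor F (hid _ ⨾ n X) ⨾ eo X)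
  (idv (fhor F (n X) ⨾ eo X))).
{ eapply invertible_cell_eq; [apply invertible_cell_idv|reflexivity|].
  now rewrite hcomp_idl. }
assert (ht' : invertible_cell (fhor F (hid _ ⨾ n X) ⨾ eo X) (bo X) (tot (iota
  X))).
{ eapply invertible_cell_eq; [apply iota_cell| |reflexivity].
  now rewrite hcomp_idl. }
compare_lifts (hr' (vid X)) ht ht'; try (rewrite ?hcomp_idr, ?hcomp_idl; bdry).
rewrite !tot_fsq_hcomp, !tot_fsq_I, !hc_assoc, !vc_assoc; f_equal.
rewrite (ta_ver_id heps), <- (hc_assoc (idv (fhor F (n X)))), <- idv_comp.
transitivity (tot (iota X) // (idv (bo X) ** tot (pPsi0 M X))).
- rewrite <- (hc_idvl (x := tot (iota X))) at 1 by bdry.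
  rewrite hc_vc, lift_verP, vc_idr, <- (ta_ver_id hbeta) by bdry.
  rewrite <- (hc_idvl (x := tot (iota X))) at 2 by bdry.
  rewrite hc_vc, vc_idl by bdry; reflexivity.
- rewrite <- (hc_idvr (x := tot (iota X))) at 1 by bdry.
  rewrite <- (hc_idvr (x := tot (iota X))) at 2 by bdry.
  rewrite !hc_vc, !vc_idl, !vc_idr by bdry; reflexivity.
Qed.

Definition lifted : hTrans K1 K2 := {|
  tob := n; thor := lift_hor; tver := lift_ver;
  thor_inv := lift_hor_inv; t_nat := lift_nat;
  thor_comp _ _ _ a c := lift_comp _ _;
  thor_id := lift_id; tver_comp := lift_ver_comp; tver_id := lift_ver_id |}.
End LiftTransformation.

(** * Pointwise equivalences are equivalences *)

Section Modifications.
Context {D E : doubleCat} {F G : pseudoFunctor D E}.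

Lemma tot_m_hor (phi psi : hTrans F G) (th : modification phi psi)
    A C (a : hor A C) :
  (tot (mob th A) ** idv (phor G a)) // tot (thor psi a) =
  tot (thor phi a) // (idv (phor F a) ** tot (mob th C)).
Proof. rewrite <- !tot_hcomp, <- !tot_vcomp; apply tot_eq, m_hor. Qed.

Lemma tot_m_ver (phi psi : hTrans F G) (th : modification phi psi)
    A A' (u : ver A A') :
  tot (mob th A) // tot (tver psi u) = tot (tver phi u) // tot (mob th A').
Proof. rewrite <- !tot_vcomp; apply tot_eq, m_ver. Qed.

Lemma tot_tcomp_hor H (phi : hTrans F G) (psi : hTrans G H) A C (a : hor A C) :
  tot (thor (tComp phi psi) a) = (idv (tob phi A) ** tot (thor psi a)) //
    (tot (thor phi a) ** idv (tob psi C)).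
Proof.
cbn; rewrite (tot_eq (tcomp_horE phi psi a)), tot_vcompE, !tot_hcomp.
reflexivity.
Qed.

Lemma minvertible_componentwise (phi psi : hTrans F G) (th : modification phi
  psi) :
  (forall A, vinvertible (mob th A)) -> minvertible th.
Proof.
intros h.
assert (inv : forall A, { t : sq (vid _) (tob psi A) (tob phi A) (vid _) |
  tot (mob th A) // tot t = idv (tob phi A) /\
  tot t // tot (mob th A) = idv (tob psi A) }).
{ intros A; apply constructive_indefinite_description, vinvertibleP, h. }
unshelve eexists (@Build_modification _ _ _ _ psi phi
  (fun A => proj1_sig (inv A)) _ _); cbn.
- intros A C a; apply tot_inj; rewrite !tot_vcomp, !tot_hcomp.
  destruct (inv A) as (t & h1 & h2), (inv C) as (t' & h1' & h2'); cbn.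
  rewrite <- (vc_idr (u := phor F a ⨾ tob phi C) (x :=
    tot (thor phi a))) by bdry.
  rewrite idv_comp, <- h1', whisker_l by bdry.
  rewrite <- (vc_assoc (tot (thor phi a))), <- tot_m_hor.
  rewrite vc_assoc, <- vc_assoc, hc_vc, h2, vc_idl, <- idv_comp, <- vc_assoc,
    vc_idl by bdry; reflexivity.
- intros A C a; apply tot_inj; rewrite !tot_vcomp.
  destruct (inv A) as (t & h1 & h2), (inv C) as (t' & h1' & h2'); cbn.
  rewrite <- (vc_idr (u := tob phi C) (x := tot (tver phi a))) by bdry.
  rewrite <- h1', <- (vc_assoc (tot (tver phi a))), <- tot_m_ver.
  rewrite vc_assoc, <- vc_assoc, h2, <- vc_assoc, vc_idl by bdry; reflexivity.
- split; intros A; apply tot_inj; rewrite tot_vcomp;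
    destruct (inv A) as (t & h1 & h2); assumption.
Qed.
End Modifications.

(** Lifting along this functor turns the construction above into one for transformations within a
    single double category. *)
Definition idFunctor (D : doubleCat) : doubleFunctor D D.
Proof.
refine (@Build_doubleFunctor D D (fun A => A) (fun A C a => a) (fun A C a => a)
  (fun A C A' C' u a a' w s => s) (fun A => eq_refl) (fun A B C a c => eq_refl)
  (fun A => eq_refl) (fun A B C a c => eq_refl) _ _ _ _);
  intros; apply sqeq_refl.
Defined.

Lemma idFunctor_ff (D : doubleCat) : fully_faithful_on_squares (idFunctor D).
Proof. intros A C A' C' u a a' w t; exists t; split; [|intros x h]; auto. Qed.

Lemma cartesian_between_inj {D : doubleCat} (P Q P' Q' Z Z' : ob D)
    (u u1 : ver P P') (k k1 : hor P Q) (k' k1' : hor P' Q') (w w1 : ver Q Q')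
    (c : hor Q Z) (c' : hor Q' Z') (v : ver Z Z') (r0 : ver Q Q')
    (r : sq r0 c c' v) d t d' t' (x : sq u k k' w) (y : sq u1 k1 k1' w1) :
  cartesian r -> invertible_cell d (k ⨾ c) t ->
    invertible_cell (k' ⨾ c') d' t' ->
  r0 = w -> u = u1 -> k = k1 -> k' = k1' -> w = w1 ->
  t // (tot x ** tot r) // t' = t // (tot y ** tot r) // t' -> x ≈ y.
Proof. exact (@between_inj D D (idFunctor D) (idFunctor_ff (D :=
  D)) P Q P' Q' Z Z' u u1 k k1
  k' k1' w w1 c c' v r0 r d t d' t' x y). Qed.

Lemma thor_tId {D E : doubleCat} (F : pseudoFunctor D E) A C (a : hor A C) :
  tot (thor (tId F) a) = idv (phor F a).
Proof. apply tot_cast. Qed.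

Section PointwiseEquivalence.
Context {D E : doubleCat} {K M : pseudoFunctor D E} (phi : hTrans K M).
Hypothesis hphi : forall X, horizontal_equivalence (tob phi X).
Hypothesis hphi' : forall X Y (u : ver X Y), cartesian (tver phi u).

Lemma along_phi : @trans_along _ _ _ (idFunctor E) K M (tob phi)
  (@thor _ _ _ _ phi)
  (@tver _ _ _ _ phi).
Proof.
split; intros; [apply (thor_inv phi)|apply (tot_t_nat phi)
  |apply (tot_thor_comp phi)
  |apply (tot_thor_id phi)|apply (tot_tver_comp phi)|apply (tot_tver_id phi)].
Qed.
Lemma along_id : @trans_along _ _ _ (idFunctor E) M M (tob (tId M))
  (@thor _ _ _ _ (tId M)) (@tver _ _ _ _ (tId M)).
Proof.
split; intros; [apply (thor_inv (tId M))|apply (tot_t_nat (tId M))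
  |apply (tot_thor_comp (tId M))|apply (tot_thor_id (tId M))
  |apply (tot_tver_comp (tId M))|apply (tot_tver_id (tId M))].
Qed.

Lemma cartesian_phi X : cartesian (sqvid (tob phi X)).
Proof. apply sqvid_cartesian, hphi. Qed.

Lemma adjoint_ex X : inhabited { c & half_adjoint (tob phi X) c }.
Proof.
destruct (equivalence_half_adjoint (hphi X)) as (c & [h]).
exact (inhabits (existT _ c h)).
Qed.
Definition adjoint X := epsilon (adjoint_ex X) (fun _ => True).

Let iota X :
    sq (vid (M X)) (projT1 (adjoint X) ⨾ tob phi X) (hid (M X)) (vid (M X))
  := ha_eps (projT2 (adjoint X)).
Lemma iota_inv X : vinvertible (iota X).
Proof. apply ha_vinv_eps. Qed.

(** The lift of the identity of [M] through [phi] for which the counits [iota] form a modification.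
    The law of [pinv_counit] thus holds by construction, and only the unit needs an argument. *)
Definition pinv : hTrans M K := lifted (idFunctor_ff (D :=
  E)) along_phi along_id
  cartesian_phi hphi' iota_inv.

Lemma pinv_hor X Y (a : hor X Y) :
  (idv (tob pinv X) ** tot (thor phi a)) //
    (tot (thor pinv a) ** idv (tob phi Y)) // (idv (phor M a) ** tot (iota Y)) =
  tot (iota X) ** idv (phor M a).
Proof.
transitivity ((tot (iota X) ** idv (phor M a)) // tot (thor (tId M) a));
  [exact (lift_horP (idFunctor_ff (D := E)) along_phi cartesian_phi
  (bh := @thor _ _ _ _ (tId M)) iota_inv a)|].
rewrite thor_tId, vc_idr by bdry; reflexivity.
Qed.

Lemma pinv_ver X Y (u : ver X Y) :
  (tot (tver pinv u) ** tot (tver phi u)) // tot (iota Y) =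
  tot (iota X) // idh (pver M u).
Proof.
exact (lift_verP (idFunctor_ff (D := E)) (n := fun X => projT1 (adjoint X))
  hphi' (bv := @tver _ _ _ _ (tId M)) iota_inv u).
Qed.

Definition pinv_counit : modification (tComp pinv phi) (tId M).
Proof.
refine (@Build_modification _ _ _ _ (tComp pinv phi) (tId M) iota _ _).
- intros X Y a; apply tot_inj.
  rewrite !tot_vcomp, !tot_hcomp, thor_tId, tot_tcomp_hor, pinv_hor.
  apply vc_idr; bdry.
- intros X Y u; apply tot_inj; cbn.
  rewrite !tot_vcomp, tot_hcomp; symmetry; apply pinv_ver.
Defined.

Let theta X : sq (vid (K X)) (hid (K X)) (tob phi X ⨾ tob pinv X) (vid (K X))
  := ha_eta (projT2 (adjoint X)).

Lemma pinv_triangle X : (tot (theta X) ** idv (tob phi X)) //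
  (idv (tob phi X) ** tot (iota X)) = idv (tob phi X).
Proof. apply (ha_triangle (projT2 (adjoint X))). Qed.

(** Both laws are tested after composing with [phi] on the right and pasting [iota] below: the
    triangle identity cancels [theta] against [iota], and a component of [phi] remains on either
    side. *)
Definition pinv_unit : modification (tId K) (tComp phi pinv).
Proof.
refine (@Build_modification _ _ _ _ (tId K) (tComp phi pinv) theta _ _).
- intros X Y a.
  apply (cartesian_between_inj (cartesian_phi Y) (t := tot (thor phi a))
    (t' := (idv (phor K a) ** (idv (tob phi Y) ** tot (iota Y))))
    (d := tob phi X ⨾ phor M a) (d' := phor K a ⨾ (tob phi Y ⨾ hid _))).
  + eapply invertible_cell_eq; [apply thor_cell|reflexivity|]. cbn;
      now rewrite hcomp_idl.
  + eapply invertible_cell_eq; [eapply invertible_cell_h;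
      [apply invertible_cell_idv|eapply invertible_cell_h;
      [apply invertible_cell_idv|apply invertible_cell_tot,
        iota_inv]]| |reflexivity].
    cbn; now rewrite !hcomp_assoc.
  + bdry.
  + bdry.
  + cbn; bdry.
  + cbn; bdry.
  + bdry.
  + rewrite !tot_vcomp, !tot_hcomp, thor_tId, tot_tcomp_hor.
    cbn [tob tComp tId].
    transitivity (tot (thor phi a)).
    * rewrite !whisker_r, !hc_assoc, !vc_assoc by bdry.
      assert (k : (tot (thor phi a) ** (idv (tob pinv Y) ** idv (tob phi Y))) //
        (idv (phor K a) ** (idv (tob phi Y) ** tot (iota Y))) =
        (idv (tob phi X) ** (idv (phor M a) ** tot (iota Y))) // tot (thor phi
          a)).
      { rewrite <- !(hc_assoc _ _ (tot (iota Y))), <- !idv_comp.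
        rewrite (exchange (a := tob phi X ⨾ phor M a) (d := hid _)) by bdry.
        rewrite hc_idvr by bdry; reflexivity. }
      rewrite k, <- (vc_assoc (idv (tob phi X) ** _)), hc_vc by bdry.
      assert (k' : tot (thor phi a) // (tot (theta X) ** (idv (phor K a) **
          idv (tob phi Y))) =
        (tot (theta X) ** (idv (tob phi X) ** idv (phor M a))) //
        (idv (tob phi X) ** (idv (tob pinv X) ** tot (thor phi a)))).
      { rewrite <- (hc_assoc _ _ (tot (thor phi a))), <- !idv_comp.
        rewrite (exchange (a := hid _) (d := phor K a ⨾ tob phi Y)) by bdry.
        rewrite hc_idvl by bdry; reflexivity. }
      rewrite <- vc_assoc, k', vc_assoc, <- (vc_assoc (idv (tob phi X) ** _)) by
        bdry.
      rewrite hc_vc, vc_idl, <- (vc_assoc (idv (tob pinv X) ** _)),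
        pinv_hor by bdry.
      rewrite <- !hc_assoc, <- vc_assoc, hc_vc, vc_idl,
        pinv_triangle by bdry. rewrite vc_idl, <- idv_comp, vc_idl by bdry.
      reflexivity.
    * rewrite vc_idl, hc_assoc, vc_assoc, hc_vc, pinv_triangle, vc_idl,
        <- idv_comp, vc_idr by bdry.
      reflexivity.
- intros X Y u.
  apply (cartesian_between_inj (hphi' u) (t := idv (tob phi X))
    (t' := (idv (tob phi Y) ** tot (iota Y)))
    (d := tob phi X) (d' := tob phi Y ⨾ hid _)).
  + eapply invertible_cell_eq; [apply invertible_cell_idv|reflexivity|]. cbn;
      now rewrite hcomp_idl.
  + eapply invertible_cell_eq; [eapply invertible_cell_h;
      [apply invertible_cell_idv|apply invertible_cell_tot, iota_inv]
      | |reflexivity].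
    cbn; now rewrite !hcomp_assoc.
  + bdry.
  + cbn; bdry.
  + bdry.
  + bdry.
  + cbn; bdry.
  + cbn [tver tob tComp tId]; rewrite !tot_vcomp, tot_hcomp.
    transitivity (tot (tver phi u)).
    * rewrite <- (vc_idl (u := tob phi X) (x := tot (tver phi u))) at 2 by bdry.
      rewrite <- hc_vc, hc_assoc, !vc_assoc, (hc_vc (p := tot (tver phi u))),
        pinv_ver by bdry.
      rewrite (vc_idr (x := tot (tver phi u))) by bdry.
      rewrite <- (vc_idl (u := tob phi X) (x := tot (tver phi u))) at 1 by bdry.
      rewrite <- hc_vc, <- (vc_assoc (_ ** idv _)), pinv_triangle, hc_idr,
        !vc_idl by bdry.
      reflexivity.
    * rewrite <- (vc_idr (u := tob phi Y) (x := tot (tver phi u))) at 2 by bdry.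
      rewrite <- hc_vc, !vc_assoc, pinv_triangle, hc_idl, vc_idl,
        vc_idr by bdry.
      reflexivity.
Defined.

Lemma pointwise_equivalence : is_hEquivalence phi.
Proof.
exists pinv, pinv_unit, pinv_counit; split; apply minvertible_componentwise;
  intros X.
- apply ha_vinv_eta.
- apply ha_vinv_eps.
Qed.
End PointwiseEquivalence.

(** * The unit *)

Lemma cartesian_sqhid (D : doubleCat) (A C : ob D) (u : ver A C) :
  cartesian (sqhid u).
Proof.
apply cartesianI; intros X X' p f f'.
- intros x y; rewrite !hc_idr by bdry; trivial.
- intros y.
  destruct (@tot_surj D _ _ _ _ p f f' u (tot y)) as [x hx]; [bdry..|].
  exists x; rewrite <- hx, hc_idr by bdry; reflexivity.
Qed.

(** * Reflection along a functor fully faithful on squares *)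

Section Reflection.
Context {A B : doubleCat} (F : doubleFunctor A B).
Hypothesis ff : fully_faithful_on_squares F.
Hypothesis full : forall X Y (b : hor (F X) (F Y)), exists a, iso b (fhor F a).

Lemma cartesian_reflect X Y X' Y' (u : ver X X') (a : hor X Y) (a' : hor X' Y')
    (w : ver Y Y') (s : sq u a a' w) : cartesian (fsq F s) -> cartesian s.
Proof.
intros h; apply cartesianI; intros Z Z' p f f'.
- intros x y k; apply (ff_inj ff); trivial.
  apply (cartesian_inj h); rewrite <- !tot_fsq_hcomp; apply tot_fsq.
  now rewrite !tot_hcomp.
- intros y.
  destruct (lift_ex ff (u := p) (k := f) (k' := f') (w := u) (Y :=
    tot (fsq F y))
    h eq_refl) as [x hx]; [bdry..|].
  exists x; rewrite <- tot_hcomp; apply (ff_inj ff); trivial.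
  now rewrite tot_fsq_hcomp.
Qed.

Lemma equivalence_reflect X Y (a : hor X Y) :
  horizontal_equivalence (fhor F a) -> horizontal_equivalence a.
Proof.
intros (c & h1 & h2)%equivalence_iso; destruct (full c) as [d hd].
apply equivalence_iso; exists d; split; apply (iso_lift ff);
  now rewrite fhor_comp, fhor_id, <- hd.
Qed.
End Reflection.

Section Unit.
Context {A B : doubleCat} (F : doubleFunctor A B).
Hypothesis ff : fully_faithful_on_squares F.
Hypothesis full : forall X Y (b : hor (F X) (F Y)), exists a, iso b (fhor F a).
Context (gob : ob B -> ob A) (e : forall X, hor (F (gob X)) X).
Hypothesis he : forall X, horizontal_equivalence (e X).
Context (ghor : forall X Y, hor X Y -> hor (gob X) (gob Y)).
Context (gt : forall X Y (b : hor X Y),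
  sq (vid _) (e X ⨾ b) (fhor F (ghor b) ⨾ e Y) (vid _)).
Hypothesis hgt : forall X Y (b : hor X Y), vinvertible (gt b).
Context (gver : forall X Y, ver X Y -> ver (gob X) (gob Y)).
Context (gl : forall X Y (v : ver X Y), sq (fver F (gver v)) (e X) (e Y) v).
Hypothesis hgl : forall X Y (v : ver X Y), cartesian (gl v).

Let G := quasi_inverse ff he hgt hgl.
Let eps := counit_trans ff he hgt hgl.

Lemma counit_equivalence : is_hEquivalence eps.
Proof. apply pointwise_equivalence; [apply he|apply hgl]. Qed.

(** The counit restricted along [F], a transformation from [F G F] to [F]; the identity of [F] will
    be lifted through it. *)
Lemma along_counit : @trans_along _ _ _ F (psAfter G F) (psAfter (psId B) F)
  (fun X => e (F X)) (fun X Y a => gt (fhor F a)) (fun X Y u => gl (fver F u)).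
Proof.
split; intros.
- apply hgt.
- apply (tot_t_nat eps (fsq F s)).
- generalize (tot_thor_comp eps (fhor F a) (fhor F c)); cbn -[sqcast].
  rewrite !tot_cast, tot_fsq_cast, (gt_eq gt (fhor_comp F a c)); trivial.
- generalize (tot_thor_id eps (F X)); cbn -[sqcast].
  rewrite !tot_cast, tot_fsq_cast, (gt_eq gt (fhor_id F X)); trivial.
- generalize (tot_tver_comp eps (fver F u) (fver F w)); cbn -[sqcast].
  rewrite !tot_cast, tot_fsq_cast, (gl_eq gl (fver_comp F u w)); trivial.
- generalize (tot_tver_id eps (F X)); cbn -[sqcast].
  rewrite !tot_cast, tot_fsq_cast, (gl_eq gl (fver_id F X)); trivial.
Qed.

(** The identity transformation of [F], from [F] after the identity to the identity after [F]. *)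
Let strict_tob X : hor (F X) (F X) := hid (F X).
Let strict_thor X Y (a : hor X Y) :
  sq (vid (F X)) (strict_tob X ⨾ fhor F a) (fhor F a ⨾ strict_tob Y) (vid (F Y)) :=
  sqcast eq_refl (eq_sym (hcomp_idl _)) (eq_sym (hcomp_idr _)) eq_refl (sqvid
    (fhor F a)).

Lemma along_strict : @trans_along _ _ _ F (psId A) (psAfter (psId B) F)
  strict_tob strict_thor (fun X Y u => sqhid (fver F u)).
Proof.
split; intros; cbn -[sqcast]; unfold strict_tob, strict_thor; rewrite ?tot_cast.
- eapply vinvertible_tot; [symmetry; apply tot_cast|].
  apply (vinvertible_sqvid (dc_laws B)).
- rewrite hc_idl, hc_idr, vc_idl, vc_idr by bdry; reflexivity.
- rewrite tot_fsq_I, fhor_comp, hc_idvl, hc_idvr, <- !idv_comp, !vc_idl by bdry.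
  reflexivity.
- rewrite tot_fsq_I, fhor_id, hc_idvl, vc_idl by bdry; reflexivity.
- rewrite tot_fsq_J, fver_comp, <- idh_comp; reflexivity.
- rewrite tot_fsq_J, fver_id, idh_vid, hc_idvl by bdry; reflexivity.
Qed.

(** By fullness, [n] is a preimage up to isomorphism of a pseudo-inverse of [e (F X)], and [F]
    reflects equivalences. *)
Lemma unit_ob_ex X : exists n : hor X (gob (F X)),
  horizontal_equivalence n /\ iso (fhor F n ⨾ e (F X)) (hid (F X)).
Proof.
destruct (proj1 (equivalence_iso _) (he (F X))) as (c & h1 & h2).
destruct (full c) as [n hn]; exists n; rewrite hn in h2; split; [|exact h2].
apply (equivalence_reflect ff full), equivalence_iso.
exists (e (F X)); rewrite hn in h1; tauto.
Qed.
Definition unit_ob X : hor X (gob (F X)) :=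
  proj1_sig (constructive_indefinite_description _ (unit_ob_ex X)).
Lemma unit_ob_equivalence X : horizontal_equivalence (unit_ob X).
Proof.
exact (proj1 (proj2_sig (constructive_indefinite_description _ (unit_ob_ex
  X)))).
Qed.
Lemma unit_ob_iso X : iso (fhor F (unit_ob X) ⨾ e (F X)) (hid (F X)).
Proof.
exact (proj2 (proj2_sig (constructive_indefinite_description _ (unit_ob_ex
  X)))).
Qed.
Definition unit_iota X :=
  proj1_sig (constructive_indefinite_description _ (unit_ob_iso X)).
Lemma unit_iota_inv X : vinvertible (unit_iota X).
Proof.
exact (proj2_sig (constructive_indefinite_description _ (unit_ob_iso X))).
Qed.

Lemma cartesian_unit_ob X : cartesian (sqvid (e (F X))).
Proof. apply sqvid_cartesian, he. Qed.
Lemma cartesian_unit_ver X Y (u : ver X Y) : cartesian (gl (fver F u)).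
Proof. apply hgl. Qed.

Definition unit_trans : hTrans (psId A) (psAfter G F) :=
  lifted ff along_counit along_strict cartesian_unit_ob cartesian_unit_ver
    unit_iota_inv.

(** The image under [F] of a vertical component, composed with [gl (fver F u)], is an identity
    square conjugated by cells [unit_iota], hence cartesian. Cancelling [gl (fver F u)] and
    reflecting along [F] shows that the component is cartesian. *)
Lemma unit_equivalence : is_hEquivalence unit_trans.
Proof.
apply pointwise_equivalence; [apply unit_ob_equivalence|].
intros X Y u; apply (cartesian_reflect ff).
apply (cartesian_cancel (t := gl (fver F u))); [|apply hgl].
pose proof (lift_verP ff (K1 := psId A) (K2 := psAfter G F)
  (M := psAfter (psId B) F) (bo := strict_tob) cartesian_unit_ver (bv :=
    fun X Y u => sqhid (fver F u))
  unit_iota_inv u) as h.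
destruct (proj1 (vinvertibleP _) (unit_iota_inv Y)) as (t & h1 & h2).
apply (cartesian_conj (s := sqhid (fver F u)) (i := unit_iota X) (j := t)).
- apply unit_iota_inv.
- apply vinvertibleP; exists (unit_iota Y); tauto.
- rewrite tot_hcomp.
  transitivity ((tot (fsq F (tver unit_trans u)) ** tot (gl (fver F u))) //
    tot (unit_iota Y) // tot t).
  + rewrite vc_assoc, h1, vc_idr by (cbn; bdry); reflexivity.
  + f_equal; exact h.
- apply cartesian_sqhid.
Qed.
End Unit.

(** * The theorem *)

Section WhiProps.
Context {D : doubleCat}.

Lemma weakly_hinvertible_sym {A C A' C' : ob D} {u : ver A A'} {a : hor A C}
    {a' : hor A' C'} {w : ver C C'} (s : sq u a a' w) :
  weakly_hinvertible s -> exists c c' (t : sq w c c' u),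
    weakly_hinvertible t /\ (iso (a ⨾ c) (hid A) /\ iso (c ⨾ a) (hid C)) /\
    (iso (a' ⨾ c') (hid A') /\ iso (c' ⨾ a') (hid C')).
Proof.
intros (c & c' & t & eta & eta' & eps & eps' & i1 & i2 & i3 & i4 & h1 & h2).
exists c, c', t; split; [|split; split; [symmetry; now exists eta
  |now exists eps|symmetry; now exists eta'|now exists eps']].
apply vinvertibleP in i1 as (etai & e1 & f1), i2 as (etai' & e2 & f2),
  i3 as (epsi & e3 & f3), i4 as (epsi' & e4 & f4).
apply tot_eq in h1, h2; rewrite !tot_vcomp, tot_hcomp in h1, h2.
exists a, a', s, epsi, epsi', etai, etai'.
repeat split; try (apply vinvertibleP; eauto).
- apply tot_inj; rewrite !tot_vcomp, tot_hcomp.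
  rewrite <- (vc_idr (u := c' ⨾ a') (x := tot t ** tot s)) by bdry.
  rewrite <- e4, <- (vc_assoc (tot t ** tot s)), <- h2, <- !vc_assoc, f3,
    vc_idl by bdry.
  reflexivity.
- apply tot_inj; rewrite !tot_vcomp, tot_hcomp.
  rewrite <- (vc_idl (u := a ⨾ c) (x := tot s ** tot t)) by bdry.
  rewrite <- f1, (vc_assoc (tot etai)), h1, !vc_assoc, e2, vc_idr by bdry.
  reflexivity.
Qed.

Lemma weakly_hinvertible_inj_l {A C A' C' : ob D} {u : ver A A'} {a : hor A C}
    {a' : hor A' C'} {w : ver C C'} (s : sq u a a' w)
    X X' (p : ver X X') (f : hor C X) (f' : hor C' X') (x y : sq w f f' p) :
  weakly_hinvertible s -> tot s ** tot x = tot s ** tot y -> tot x = tot y.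
Proof.
intros (c & c' & t & _ & _ & eps & eps' & _ & _ &
  [epsi [f1 f2]]%vinvertibleP & _ & _ & h2) k.
apply tot_eq in h2; rewrite !tot_vcomp, tot_hcomp in h2.
now rewrite (whi_retract_l f2 h2 x), (whi_retract_l f2 h2 y), k.
Qed.
End WhiProps.

Section EquivalenceComponents.
Context {D E : doubleCat}.

Lemma minvertible_component {F G : pseudoFunctor D E} (phi psi : hTrans F G)
    (th : modification phi psi) A : minvertible th -> vinvertible (mob th A).
Proof.
intros (th' & h1 & h2); exists (vid _), (vid _), (mob th' A); auto.
Qed.

Context {F G : pseudoFunctor D E}.

Lemma hEquivalence_equivalence (phi : hTrans F G) A :
  is_hEquivalence phi -> horizontal_equivalence (tob phi A).
Proof.
intros (psi & eta & eps & h1 & h2).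
exists (tob psi A), (mob eta A), (mob eps A).
split; [exact (minvertible_component A h1)|exact (minvertible_component A h2)].
Qed.

(** The vertical laws of the unit and counit modifications at [u] are the two equations of weak
    horizontal invertibility. *)
Lemma hEquivalence_whi (phi : hTrans F G) A A' (u : ver A A') :
  is_hEquivalence phi -> weakly_hinvertible (tver phi u).
Proof.
intros (psi & eta & eps & h1 & h2).
exists (tob psi A), (tob psi A'), (tver psi u), (mob eta A), (mob eta A'),
  (mob eps A), (mob eps A').
split; [exact (minvertible_component A h1)|].
split; [exact (minvertible_component A' h1)|].
split; [exact (minvertible_component A h2)|].
split; [exact (minvertible_component A' h2)|].
split; [apply (m_ver eta)|apply (m_ver eps)].
Qed.

Lemma hEquivalence_sym (phi : hTrans F G) :
  is_hEquivalence phi -> exists psi : hTrans G F, is_hEquivalence psi.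
Proof.
intros (psi & eta & eps & (eta' & h1 & h2) & (eps' & h3 & h4)).
exists psi, phi, eps', eta'; split; [exists eps|exists eta]; auto.
Qed.

Lemma hEquivalence_iso (phi : hTrans F G) A C (a : hor A C) :
  iso (tob phi A ⨾ phor G a) (phor F a ⨾ tob phi C).
Proof. exists (thor phi a); apply thor_inv. Qed.
End EquivalenceComponents.

(** Naturality of [phi] makes [s] and [psq E s] determine each other: [s] is recovered by cancelling
    [tver phi w] on the right, [psq E s] by cancelling [tver phi u] on the left. *)
Lemma equivalent_id_ff {D : doubleCat} (E : pseudoFunctor D D)
    (phi : hTrans (psId D) E) : is_hEquivalence phi ->
  forall A C A' C' (u : ver A A') (a : hor A C) (a' : hor A' C') (w : ver C C')
    (t : sq (pver E u) (phor E a) (phor E a') (pver E w)),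
  exists! s : sq u a a' w, psq E s = t.
Proof.
intros h A C A' C' u a a' w t.
pose proof (weakly_hinvertible_cartesian (hEquivalence_whi w h)) as hw.
destruct (invertible_cell_inv (thor_cell phi a)) as (ai & hai & e1 & e2).
apply invertible_cell_boundary in hai as [[? ?] [? ?]].
destruct (cartesian_ex hw (p := u) (f := a) (f' := a')
  (Y := ai // ((tot (tver phi u) ** tot t) // tot (thor phi a'))))
  as [s hs]; [cbn; bdry..|].
assert (inj : forall s s' : sq u a a' w,
  tot (psq E s) = tot (psq E s') -> tot s = tot s').
{ intros x y k; apply (cartesian_inj hw).
  apply (invertible_cell_cancel (thor_cell phi a)); [cbn; bdry..|].
  transitivity ((tot (tver phi u) ** tot (psq E x)) // tot (thor phi a')).
  - symmetry; apply (tot_t_nat phi).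
  - rewrite k; apply (tot_t_nat phi). }
assert (k : psq E s = t).
{ apply sqeq_eq, tot_inj, (weakly_hinvertible_inj_l (hEquivalence_whi u h)).
  destruct (invertible_cell_inv (thor_cell phi a')) as (ai' & hai' & e1' & e2').
  apply invertible_cell_boundary in hai' as [[? ?] [? ?]].
  assert (n : (tot (tver phi u) ** tot (psq E s)) // tot (thor phi a') =
    tot (thor phi a) // (tot s ** tot (tver phi w))) by apply (tot_t_nat phi).
  rewrite hs in n.
  rewrite <- !vc_assoc, e1, vc_assoc, vc_idl in n by bdry.
  apply (f_equal (fun z => z // ai')) in n.
  rewrite !vc_assoc, e1', !vc_idr in n by bdry; exact n. }
exists s; split; [exact k|]; intros s' k'.
apply sqeq_eq, tot_inj, inj.
exact (f_equal (fun z => tot z) (eq_trans k (eq_sym k'))).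
Qed.

(** * From a quasi-inverse to a double biequivalence *)

Section Sufficiency.
Context {A B : doubleCat} (F : doubleFunctor A B) (G : pseudoFunctor B A).
Context (phi : hTrans (psId A) (psAfter G F))
  (psi : hTrans (psBefore F G) (psId B)).
Hypothesis hphi : is_hEquivalence phi.
Hypothesis hpsi : is_hEquivalence psi.

Lemma inverse_up_to_equivalence_ff : fully_faithful_on_squares F.
Proof.
destruct (hEquivalence_sym hpsi) as (psi' & hpsi').
pose proof (equivalent_id_ff hphi) as h1; cbn in h1.
pose proof (equivalent_id_ff hpsi') as h2; cbn in h2.
intros X Y X' Y' u a a' w t.
destruct (h1 _ _ _ _ u a a' w (psq G t)) as (s & hs & us).
exists s; split.
(* By the choice of [s], the squares [fsq F s] and [t] have equal images under [G], hence under
   [F G], which is injective on squares. *)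
- destruct (h2 _ _ _ _ _ _ _ _ (fsq F (psq G t))) as (r & _ & ur).
  rewrite <- (ur t eq_refl); symmetry; apply ur; now rewrite hs.
- intros s' <-; now apply us.
Qed.

(** The preimage is [phor G b] conjugated by the unit. Naturality of [phi] makes [phor G b] and
    [phor G (fhor F a)] isomorphic, and naturality of [psi] carries this over to [b] and
    [fhor F a]. *)
Lemma inverse_up_to_equivalence_full X Y (b : hor (F X) (F Y)) :
  exists a, iso b (fhor F a).
Proof.
pose proof (hEquivalence_equivalence X hphi) as hX.
destruct (proj1 (equivalence_iso _) (hEquivalence_equivalence Y hphi))
  as (p & _ & hp).
exists (tob phi X ⨾ phor G b ⨾ p).
set (a := tob phi X ⨾ phor G b ⨾ p).
assert (k : iso (phor G b) (phor G (fhor F a))).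
{ apply (equivalence_cancel_l hX).
  transitivity (a ⨾ tob phi Y).
  - unfold a; rewrite hcomp_assoc, hp, hcomp_idr; reflexivity.
  - symmetry; apply (hEquivalence_iso phi a). }
apply (equivalence_cancel_l (hEquivalence_equivalence (F X) hpsi)).
transitivity (fhor F (phor G b) ⨾ tob psi (F Y)).
- apply (hEquivalence_iso psi b).
- rewrite (fhor_iso F k); symmetry; apply (hEquivalence_iso psi (fhor F a)).
Qed.

Lemma inverse_up_to_equivalence : double_biequivalence F.
Proof.
destruct (hEquivalence_sym hpsi) as (psi' & hpsi').
split; [|split; [|split; [|exact inverse_up_to_equivalence_ff]]].
- intros X; exists (G X), (tob psi' X).
  exact (hEquivalence_equivalence X hpsi').
- intros X Y b; destruct (inverse_up_to_equivalence_full b) as (a & s & hs).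
  now exists a, s.
- intros X Y v; exists (G X), (G Y), (pver G v), (tob psi' X), (tob psi' Y),
    (tver psi' v).
  exact (hEquivalence_whi v hpsi').
Qed.
End Sufficiency.

(** * From a double biequivalence to a quasi-inverse *)

Section Necessity.
Context {A B : doubleCat} (hA : weakly_horizontally_invariant A).
Context (F : doubleFunctor A B) (hF : double_biequivalence F).

Lemma biequivalence_ff : fully_faithful_on_squares F.
Proof. exact (proj2 (proj2 (proj2 hF))). Qed.

Lemma biequivalence_full X Y (b : hor (F X) (F Y)) : exists a, iso b (fhor F a).
Proof.
destruct hF as (_ & h & _); destruct (h X Y b) as (a & s & hs).
now exists a, s.
Qed.

Lemma biequivalence_ob X :
  { g : ob A & { e : hor (F g) X | horizontal_equivalence e } }.
Proof.
destruct (constructive_indefinite_description _ (proj1 hF X)) as (g & h).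
exists g; apply constructive_indefinite_description.
destruct h as (b & hb); now apply horizontal_equivalence_sym in hb.
Qed.
Let gob X := projT1 (biequivalence_ob X).
Let e X : hor (F (gob X)) X := proj1_sig (projT2 (biequivalence_ob X)).
Let he X : horizontal_equivalence (e X) :=
  proj2_sig (projT2 (biequivalence_ob X)).

Lemma biequivalence_hor X Y (b : hor X Y) : { k : hor (gob X) (gob Y) &
  { t : sq (vid _) (e X ⨾ b) (fhor F k ⨾ e Y) (vid _) | vinvertible t } }.
Proof.
assert (h : exists k : hor (gob X) (gob Y), iso (e X ⨾ b) (fhor F k ⨾ e Y)).
{ destruct (proj1 (equivalence_iso _) (he Y)) as (c & _ & hc).
  (* Fullness is applied to [b] conjugated by [e X] and a pseudo-inverse of [e Y]. *)
  destruct (biequivalence_full (e X ⨾ b ⨾ c)) as (k & hk); exists k.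
  rewrite <- hk, hcomp_assoc, hc, hcomp_idr; reflexivity. }
destruct (constructive_indefinite_description _ h) as (k & hk); exists k.
exact (constructive_indefinite_description _ hk).
Qed.

(** The third axiom yields, after reversal, a square [t] from [fver F u0] to [v] with [u0] between
    uncontrolled objects [P] and [Q]. The comparisons of [gob X] with [P] and of [gob Y] with [Q]
    lift to equivalences in [A], along which weak horizontal invariance pulls [u0] back to [u]. The
    composite [fsq F r ∣ t] is cartesian with top and bottom isomorphic to [e X] and [e Y], and a
    conjugation makes them equal. *)
Lemma biequivalence_ver X Y (v : ver X Y) : { u : ver (gob X) (gob Y) &
  { l : sq (fver F u) (e X) (e Y) v | cartesian l } }.
Proof.
assert (h : exists (u : ver (gob X) (gob Y)) (l : sq (fver F u) (e X) (e Y) v),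
  cartesian l).
{ destruct hF as (_ & _ & d3 & _).
  destruct (d3 X Y v) as (P & Q & u0 & b & b' & s & hs).
  apply weakly_hinvertible_sym in hs as (c & c' & t & ht & hb & hb').
  assert (hbe : forall X P (b : hor X (F P)) c,
    iso (b ⨾ c) (hid X) /\ iso (c ⨾ b) (hid (F P)) ->
    exists a : hor (gob X) P, horizontal_equivalence a /\ iso (fhor F a ⨾ c) (e
      X)).
  { clear - he; intros X P b c hb.
    destruct (biequivalence_full (e X ⨾ b)) as (a & ha); exists a; split.
    - apply (equivalence_reflect biequivalence_ff biequivalence_full).
      apply (equivalence_of_iso ha), equivalence_comp; [apply he|].
      apply equivalence_iso; now exists c.
    - rewrite <- ha, hcomp_assoc, (proj1 hb), hcomp_idr; reflexivity. }
  destruct (hbe _ _ _ _ hb) as (a & ha & ia),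
    (hbe _ _ _ _ hb') as (a' & ha' & ia').
  destruct (hA u0 ha ha') as (u & r & hr); exists u.
  symmetry in ia; destruct ia as (i & hi), ia' as (j & hj).
  destruct (@tot_surj _ _ _ _ _ (fver F u) (e X) (e Y) v
    (tot i // tot (fsq F r ∣ t) // tot j)) as [l hl]; [rewrite tot_hcomp;
      bdry..|].
  exists l; apply (cartesian_conj hi hj (s := fsq F r ∣ t)); [now rewrite hl|].
  apply cartesian_hcomp; [now apply cartesian_fsq|now apply
    weakly_hinvertible_cartesian]. }
destruct (constructive_indefinite_description _ h) as (u & hu); exists u.
exact (constructive_indefinite_description _ hu).
Qed.

Lemma biequivalence_inverse : exists G : pseudoFunctor B A,
    (exists phi : hTrans (psId A) (psAfter G F), is_hEquivalence phi) /\
    (exists psi : hTrans (psBefore F G) (psId B), is_hEquivalence psi).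
Proof.
set (hgt := fun X Y (b : hor X Y) => proj2_sig (projT2 (biequivalence_hor b))).
set (hgl := fun X Y (v : ver X Y) => proj2_sig (projT2 (biequivalence_ver v))).
exists (quasi_inverse biequivalence_ff he hgt hgl); split.
- exists (unit_trans biequivalence_ff biequivalence_full he hgt hgl).
  apply unit_equivalence.
- exists (counit_trans biequivalence_ff he hgt hgl).
  apply counit_equivalence.
Qed.
End Necessity.

Theorem theorem4 (A B : doubleCat) (hA : weakly_horizontally_invariant A)
    (F : doubleFunctor A B) :
  double_biequivalence F <->
  exists G : pseudoFunctor B A,
    (exists phi : hTrans (psId A) (psAfter G F), is_hEquivalence phi) /\
    (exists psi : hTrans (psBefore F G) (psId B), is_hEquivalence psi).
Proof.
split; [exact (biequivalence_inverse hA (F := F))|].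
intros (G & (phi & hphi) & (psi & hpsi)).
exact (inverse_up_to_equivalence hphi hpsi).
Qed.
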